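(* Let $\overline{X}=(X_0,X_1)$ be a compatible (quasi-)Banach couple and let $0<\theta_0<\theta_1<1$. Let $E,E_0,E_1,F_0,F_1$ be r.i. spaces and let $a_0,a_1,b,b_0,b_1\in SV$ be such that $\|b_0\|_{\widetilde{E}_0(1,\infty)}<\infty$ and $\|b_1\|_{\widetilde{E}_1(0,1)}<\infty$. Put $$\rho(u)=u^{\theta_1-\theta_0}\frac{a_0(u)\|b_0\|_{\widetilde{E}_0(u,\infty)}}{a_1(u)\|b_1\|_{\widetilde{E}_1(0,u)}},\qquad u>0.$$ (a) If $0<\theta<1$, then $$\big(\overline{X}^{\mathcal L}_{\theta_0,b_0,E_0,a_0,F_0},\overline{X}^{\mathcal R}_{\theta_1,b_1,E_1,a_1,F_1}\big)_{\theta,b,E}=\overline{X}_{\tilde\theta,B_\theta,E},$$ where $\tilde\theta=(1-\theta)\theta_0+\theta\theta_1$ and $B_\theta(u)=\big(a_0(u)\|b_0\|_{\widetilde{E}_0(u,\infty)}\big)^{1-\theta}\big(a_1(u)\|b_1\|_{\widetilde{E}_1(0,u)}\big)^{\theta}\,b(\rho(u))$, $u>0$. (b) If $\theta=0$ and $\|b\|_{\widetilde{E}(1,\infty)}<\infty$, then $$\big(\overline{X}^{\mathcal L}_{\theta_0,b_0,E_0,a_0,F_0},\overline{X}^{\mathcal R}_{\theta_1,b_1,E_1,a_1,F_1}\big)_{0,b,E}=\overline{X}^{\mathcal L}_{\theta_0,B_0,E,a_0,F_0}\cap\overline{X}^{\mathcal L,\mathcal L}_{\theta_0,b\circ\rho,E,b_0,E_0,a_0,F_0},$$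 where $B_0(u)=\|b_0\|_{\widetilde{E}_0(u,\infty)}\,b(\rho(u))$, $u>0$. (c) If $\theta=1$ and $\|b\|_{\widetilde{E}(0,1)}<\infty$, then $$\big(\overline{X}^{\mathcal L}_{\theta_0,b_0,E_0,a_0,F_0},\overline{X}^{\mathcal R}_{\theta_1,b_1,E_1,a_1,F_1}\big)_{1,b,E}=\overline{X}^{\mathcal R}_{\theta_1,B_1,E,a_1,F_1}\cap\overline{X}^{\mathcal R,\mathcal R}_{\theta_1,b\circ\rho,E,b_1,E_1,a_1,F_1},$$ where $B_1(u)=\|b_1\|_{\widetilde{E}_1(0,u)}\,b(\rho(u))$, $u>0$.
   Context: R.i. spaces: an ''r.i. space'' $E$ is a rearrangement invariant Banach function space on $(0,\infty)$ (Lebesgue measure) with the Fatou property. $\widetilde{E}$ denotes the corresponding r.i. space with respect to the measure $dt/t$ on $(0,\infty)$: if $E=\mathcal F(L_1,L_\infty)$ for an interpolation functor $\mathcal F$, then $\widetilde{E}=\mathcal F(\widetilde L_1,L_\infty)$ with $\widetilde L_1=L_1((0,\infty),dt/t)$; concretely $\|f\|_{\widetilde E}=\|f^\star\|_E$, where $f^\star$ is the non-increasing rearrangement of $f$ with respect to $dt/t$. For an interval $I\subset(0,\infty)$, $\|f\|_{\widetilde E(I)}=\|f\chi_I\|_{\widetilde E}$. Slowly varying functions: a positive (finite) measurable function $b$ on $(0,\infty)$ belongs to $SV$ if for every $\varepsilon>0$, $t^{\varepsilon}b(t)$ is equivalent to a non-decreasing function and $t^{-\varepsilon}b(t)$ is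 equivalent to a non-increasing function on $(0,\infty)$ (equivalent: each bounded by a constant multiple of the other). Spaces: for a compatible (quasi-)Banach couple $\overline X=(X_0,X_1)$, $K(t,f)=\inf\{\|f_0\|_{X_0}+t\|f_1\|_{X_1}: f=f_0+f_1,\ f_i\in X_i\}$. The following spaces consist of all $f\in X_0+X_1$ for which the indicated (quasi-)norm is finite (the innermost norm is taken in the variable $s$, the next in $t$, the outermost in $u$, when present): - $\overline X_{\theta,b,E}$ (also written $(X_0,X_1)_{\theta,b,E}$): $\|t^{-\theta}b(t)K(t,f)\|_{\widetilde E}$, $0\le\theta\le1$; - $\overline X^{\mathcal R}_{\theta,b,E,a,F}$: $\big\|b(t)\|s^{-\theta}a(s)K(s,f)\|_{\widetilde F(t,\infty)}\big\|_{\widetilde E}$; - $\overline X^{\mathcal L}_{\theta,b,E,a,F}$: $\big\|b(t)\|s^{-\theta}a(s)K(s,f)\|_{\widetilde F(0,t)}\big\|_{\widetilde E}$; - $\overline X^{\mathcal R,\mathcal R}_{\theta,c,E,b,F,a,G}$: $\Big\|c(u)\big\|b(t)\|s^{-\theta}a(s)K(s,f)\|_{\widetilde G(t,\infty)}\big\|_{\widetilde F(u,\infty)}\Big\|_{\widetilde E}$; - $\overline X^{\mathcal L,\mathcal L}_{\theta,c,E,b,F,a,G}$: $\Big\|c(u)\big\|b(t)\|s^{-\theta}a(s)K(s,f)\|_{\widetilde G(0,t)}\big\|_{\widetilde F(0,u)}\Big\|_{\widetilde E}$. Equality of spaces means equality as sets with equivalent (quasi-)norms; an intersection carries the maximum of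 the two (quasi-)norms. *)

(* Defs.v *)
From HB Require Import structures.
From mathcomp Require Export all_boot all_order all_algebra.
From mathcomp Require Export all_classical all_reals all_analysis.
From mathcomp Require Export measurable_realfun.

Set Implicit Arguments.
Unset Strict Implicit.
Unset Printing Implicit Defensive.

Import Order.TTheory GRing.Theory Num.Theory.
Import numFieldNormedType.Exports.

Local Open Scope classical_set_scope.
Local Open Scope ring_scope.

(* A function on (0, +oo) is encoded as a function on R whose values at x <= 0
   are ignored. *)

Section Rearrangement.
Context {R : realType}.

Definition posline : set R := `]0, +oo[.

(* The measure dt/t on (0, +oo). *)
Definition dtt (A : set R) : \bar R :=
  (\int[@lebesgue_measure R]_(t in A `&` posline) (t^-1)%:E)%E.

Definition distrib (mu : set R -> \bar R) (f : R -> \bar R) (l : R) : \bar R :=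
  mu [set s | posline s /\ (l%:E < `|f s|)%E].

(* The infimum of the empty set is +oo. *)
Definition rearrangement (mu : set R -> \bar R) (f : R -> \bar R) (t : R) :
    \bar R :=
  ereal_inf [set l%:E | l in [set l : R | 0 <= l /\ (distrib mu f l <= t%:E)%E]].

Definition nneg_measurable (f : R -> \bar R) : Prop :=
  measurable_fun posline f /\ (forall t, posline t -> (0 <= f t)%E).

Definition ae_pos (P : R -> Prop) : Prop :=
  {ae @lebesgue_measure R, forall t, posline t -> P t}.

End Rearrangement.

(* Bennett--Sharpley: a Banach function norm (the Fatou property being one of
   its axioms) that depends only on the distribution function.  It is a
   functional on the [0, +oo]-valued measurable functions; the space consists
   of the functions f such that the norm of |f| is finite. *)
Record ri_space (R : realType) := RISpace {
  ri_norm :> (R -> \bar R) -> \bar R ;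
  ri_ge0 : forall f, nneg_measurable f -> (0 <= ri_norm f)%E ;
  ri_eq0 : forall f, nneg_measurable f ->
    ri_norm f = 0%E <-> ae_pos (fun t => f t = 0%E) ;
  ri_homo : forall (c : R) f, 0 <= c -> nneg_measurable f ->
    ri_norm (fun t => c%:E * f t)%E = (c%:E * ri_norm f)%E ;
  ri_triangle : forall f g, nneg_measurable f -> nneg_measurable g ->
    (ri_norm (fun t => f t + g t) <= ri_norm f + ri_norm g)%E ;
  ri_mono : forall f g, nneg_measurable f -> nneg_measurable g ->
    ae_pos (fun t => (f t <= g t)%E) -> (ri_norm f <= ri_norm g)%E ;
  ri_fatou : forall (f_ : nat -> R -> \bar R) f,
    (forall n, nneg_measurable (f_ n)) -> nneg_measurable f ->
    ae_pos (fun t => nondecreasing_seq (f_ ^~ t) /\ f_ ^~ t @ \oo --> f t) ->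
    (fun n => ri_norm (f_ n)) @ \oo --> ri_norm f ;
  ri_indic : forall A : set R, measurable A -> A `<=` posline ->
    (lebesgue_measure A < +oo)%E ->
    (ri_norm (fun t => (\1_A t)%:E) < +oo)%E ;
  ri_locint : forall A : set R, measurable A -> A `<=` posline ->
    (lebesgue_measure A < +oo)%E ->
    exists2 C : R, 0 < C & forall f, nneg_measurable f ->
      (\int[lebesgue_measure]_(t in A) f t <= C%:E * ri_norm f)%E ;
  ri_equimeasurable : forall f g, nneg_measurable f -> nneg_measurable g ->
    (forall l : R, 0 <= l ->
       distrib lebesgue_measure f l = distrib lebesgue_measure g l) ->
    ri_norm f = ri_norm g
}.

Section TildeNorm.
Context {R : realType}.

(* The norm of E~, the counterpart of E for the measure dt/t. *)
Definition tnorm (E : ri_space R) (f : R -> \bar R) : \bar R :=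
  E (rearrangement dtt f).

Definition tnorm_on (E : ri_space R) (I : set R) (f : R -> \bar R) : \bar R :=
  tnorm E (f \_ I).

Definition wnorm_on (E : ri_space R) (I : set R) (b : R -> R) : \bar R :=
  tnorm_on E I (fun t => (b t)%:E).

Definition equiv_pos (f g : R -> R) : Prop :=
  exists c C : R, [/\ 0 < c, 0 < C &
    forall t, posline t -> c * g t <= f t /\ f t <= C * g t].

Definition nondecr_pos (g : R -> R) : Prop :=
  forall s t, posline s -> posline t -> s <= t -> g s <= g t.

Definition nonincr_pos (g : R -> R) : Prop :=
  forall s t, posline s -> posline t -> s <= t -> g t <= g s.

Definition slowly_varying (b : R -> R) : Prop :=
  [/\ measurable_fun posline b,
      forall t, posline t -> 0 < b t &
      forall e : R, 0 < e ->
        (exists2 g, nondecr_pos g & equiv_pos (fun t => t `^ e * b t) g) /\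
        (exists2 g, nonincr_pos g & equiv_pos (fun t => t `^ (- e) * b t) g)].

End TildeNorm.

(* A subset of an ambient space V together with a functional, of which only the
   values on that subset matter. *)
Record nspace {R : realType} (V : lmodType R) := NSpace {
  ncarrier :> V -> Prop ;
  nnorm : V -> \bar R
}.

Section QuasiBanach.
Context {R : realType}.

Definition quasi_banach (V : lmodType R) (X : nspace V) : Prop :=
  [/\ X 0 /\ (forall (c : R) f g, X f -> X g -> X (c *: f + g)),
      [/\ forall f, X f -> (0 <= nnorm X f < +oo)%E,
          forall f, X f -> nnorm X f = 0%E -> f = 0,
          forall (c : R) f, X f -> nnorm X (c *: f) = (`|c|%:E * nnorm X f)%E &
          exists2 C : R, 1 <= C & forall f g, X f -> X g ->
            (nnorm X (f + g) <= C%:E * (nnorm X f + nnorm X g))%E] &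
      forall u : nat -> V, (forall n, X (u n)) ->
        (forall e : R, 0 < e -> exists N : nat, forall m n,
           (N <= m)%N -> (N <= n)%N -> (nnorm X (u m - u n) < e%:E)%E) ->
        exists2 l, X l & (fun n => nnorm X (u n - l)) @ \oo --> 0%E].

(* By linearity, continuity of the inclusion at 0 suffices. *)
Definition continuously_embedded (V : topologicalLmodType R) (X : nspace V) :
    Prop :=
  forall U : set V, nbhs 0 U ->
    exists2 e : R, 0 < e & forall f, X f -> (nnorm X f < e%:E)%E -> U f.

Definition compatible_couple (V : topologicalLmodType R) (X0 X1 : nspace V) :
    Prop :=
  [/\ hausdorff_space V,
      quasi_banach X0 /\ continuously_embedded X0 &
      quasi_banach X1 /\ continuously_embedded X1].

Context {V : lmodType R}.
Implicit Types X Y : nspace V.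

Definition sum_space X0 X1 : set V :=
  [set f | exists f0 f1, [/\ X0 f0, X1 f1 & f = f0 + f1]].

Definition Kfun X0 X1 (f : V) (t : R) : \bar R :=
  ereal_inf [set (nnorm X0 p.1 + t%:E * nnorm X1 p.2)%E
            | p in [set p : V * V | [/\ X0 p.1, X1 p.2 & f = p.1 + p.2]]].

Definition same_space X Y : Prop :=
  (forall f, X f <-> Y f) /\
  exists c C : R, [/\ 0 < c, 0 < C & forall f, X f ->
    (c%:E * nnorm Y f <= nnorm X f)%E /\ (nnorm X f <= C%:E * nnorm Y f)%E].

Definition cap_space X Y : nspace V :=
  NSpace [set f | X f /\ Y f] (fun f => maxe (nnorm X f) (nnorm Y f)).

Definition K_space X0 X1 (N : (R -> \bar R) -> \bar R) : nspace V :=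
  NSpace [set f | sum_space X0 X1 f /\ (N (Kfun X0 X1 f) < +oo)%E]
         (fun f => N (Kfun X0 X1 f)).

Definition wmul (b : R -> R) (g : R -> \bar R) : R -> \bar R :=
  fun t => ((b t)%:E * g t)%E.

Definition weighted (theta : R) (a : R -> R) (k : R -> \bar R) : R -> \bar R :=
  wmul (fun s => s `^ (- theta) * a s) k.

Definition space X0 X1 (theta : R) (b : R -> R) (E : ri_space R) : nspace V :=
  K_space X0 X1 (fun k => tnorm E (weighted theta b k)).

Definition spaceR X0 X1 (theta : R) (b : R -> R) (E : ri_space R)
    (a : R -> R) (F : ri_space R) : nspace V :=
  K_space X0 X1 (fun k =>
    tnorm E (wmul b (fun t => tnorm_on F `]t, +oo[ (weighted theta a k)))).

Definition spaceL X0 X1 (theta : R) (b : R -> R) (E : ri_space R)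
    (a : R -> R) (F : ri_space R) : nspace V :=
  K_space X0 X1 (fun k =>
    tnorm E (wmul b (fun t => tnorm_on F `]0, t[ (weighted theta a k)))).

Definition spaceRR X0 X1 (theta : R) (c : R -> R) (E : ri_space R)
    (b : R -> R) (F : ri_space R) (a : R -> R) (G : ri_space R) : nspace V :=
  K_space X0 X1 (fun k =>
    tnorm E (wmul c (fun u =>
      tnorm_on F `]u, +oo[ (wmul b (fun t =>
        tnorm_on G `]t, +oo[ (weighted theta a k)))))).

Definition spaceLL X0 X1 (theta : R) (c : R -> R) (E : ri_space R)
    (b : R -> R) (F : ri_space R) (a : R -> R) (G : ri_space R) : nspace V :=
  K_space X0 X1 (fun k =>
    tnorm E (wmul c (fun u =>
      tnorm_on F `]0, u[ (wmul b (fun t =>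
        tnorm_on G `]0, t[ (weighted theta a k)))))).

End QuasiBanach.

(* Main.v *)
Require Import Defs.
From mathcomp Require Import zify lra ring.

(** The measure dt/t gives mass 1 to each cell [e^n, e^(n+1)[, n an integer.
    Everything in the theorem (K-functionals, slowly varying weights and their
    norms over half-lines) varies by at most a constant factor on a cell, so
    the whole statement can be moved to two-sided sequences.  The norm [snorm]
    of a sequence x is the E~-norm of the step function equal to x n on the
    n-th cell.  Rearrangement invariance makes [snorm] invariant under every
    bijection of the integers, and the Fatou property makes it countably
    subadditive ([snorm_series]).  Slowly varying weights become regularly
    varying sequences ([rvseq]): w m <= C e^(al (m - n) + eps |m - n|) w n for
    every eps > 0.  If al > 0 such a sequence decays geometrically to the left,
    so that the norm of its restriction to k < n is comparable to w n, and,
    after shifts, a geometric series gives Hardy inequalities between arbitrary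
    r.i. norms ([hardy]).

    The heart is a Holmstedt formula for the K-functional of the couple Y0, Y1
    on the left-hand side.  With K the sampled K-functional of f for X0, X1,
    put
      Lo = P0 + Q0,   Up = P1 + Q1,
    where P0 is the defining norm of Y0 with its outer norm restricted to
    (0, e^n), Q0 is the norm of b0 over (e^n, oo) times the inner norm over
    (0, e^n), and P1, Q1 are their mirror images for Y1.  Then
      K(rho, f; Y0, Y1) is comparable to Lo + rho Up,   rho = rho(e^n)
    ([holmstedt_le_K], [K_le_holmstedt]).  For the lower estimate, Lo and Up
    are quasi-additive, are bounded by the norms of Y0 and Y1 respectively, and
    satisfy the cross estimates Lo <= C rho |.|_Y1 and Up <= (C / rho) |.|_Y0
    because rho is regularly varying of index theta1 - theta0 > 0.  For the
    upper estimate, take a decomposition f = f0 + f1 that is nearly optimal for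
    K(e^n, f; X0, X1): then K(t, f0) is dominated by K(min(t, e^n), f) and
    K(t, f1) by min(1, t / e^n) K(max(t, e^n), f), and the norms of these
    truncations in Y0 and Y1 are at most multiples of Lo and Up ([N0_min],
    [N1_max]); this is where theta0 > 0 and theta1 < 1 enter.

    Since rho is regularly varying of positive index, v = rho(u) is an
    admissible change of variable ([change_of_variable]), and the norm of f on
    the left-hand side is comparable to
      | rho^(-theta) b(rho) (P0 + Q0) | + | rho^(1-theta) b(rho) (P1 + Q1) |.
    Let W be the norm of rho^(-theta) b(rho) |b0| a0 t^(-theta0) K, where |b0|
    is the norm of b0 over (t, oo); by the definition of rho it is also the
    norm of rho^(1-theta) b(rho) |b1| a1 t^(-theta1) K.  Both the Q0 term and
    the Q1 term dominate W, as an r.i. norm dominates single entries.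
    Conversely, Hardy inequalities bound the first term by W if theta > 0 and
    the second by W if theta < 1.  Hence only W remains if 0 < theta < 1, which
    is (a); if theta = 0 only P0 and Q0 remain, and these are the norms of the
    two spaces on the right of (b); if theta = 1 only P1 and Q1 remain, which
    is (c).  The reflection n -> -n exchanges the roles of Y0 and Y1, so that
    each estimate is proved for one of them only. *)

Set Implicit Arguments.
Unset Strict Implicit.
Unset Printing Implicit Defensive.

Import Order.TTheory GRing.Theory Num.Theory.
Import numFieldNormedType.Exports.

Local Open Scope classical_set_scope.
Local Open Scope ring_scope.

(** * Step functions for the measure dt/t *)

Section Steps.
Context {R : realType}.
Notation leb := (@lebesgue_measure R).

Lemma dtt_le (A B : set R) : A `<=` B -> (dtt A <= dtt B)%E.
Proof.
move=> AB; rewrite /dtt.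
have p0 C : forall x : R, (C `&` posline) x -> (0 <= (x^-1)%:E)%E.
  by move=> x [_]; rewrite /posline /= in_itv /= andbT lee_fin invr_ge0 => /ltW.
rewrite !ge0_integralE //; try exact: p0.
apply: ge_ereal_sup => _ [h /= hA <-]; apply: ereal_sup_ubound; exists h => //= x.
apply: (le_trans (hA x)); rewrite /patch.
case: ifPn => [|xA]; case: ifPn => // xB; rewrite ?inE.
- move=> [Ax px]; exfalso; move/negP: xB; apply; rewrite inE; split => //; exact: AB.
- by move: xB; rewrite inE => -[_]; rewrite /posline /= in_itv /= andbT lee_fin invr_ge0 => /ltW.
Qed.

Lemma distrib_dtt_le (f g : R -> \bar R) (l : R) :
  (forall t, 0 < t -> (`|f t| <= `|g t|)%E) ->
  (distrib dtt f l <= distrib dtt g l)%E.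
Proof.
move=> fg; apply: dtt_le => t /= [pt lt]; split => //.
apply: (lt_le_trans lt); apply: fg.
by move: pt; rewrite /posline /= in_itv /= andbT.
Qed.

Lemma rearrangement_le (f g : R -> \bar R) (t : R) :
  (forall l, 0 <= l -> (distrib dtt f l <= distrib dtt g l)%E) ->
  (rearrangement dtt f t <= rearrangement dtt g t)%E.
Proof.
move=> fg; apply: ereal_inf_le_tmp => _ [l [l0 gl] <-]; exists l => //; split => //.
exact: le_trans (fg _ l0) gl.
Qed.

Lemma rearrangement_ge0 (f : R -> \bar R) (t : R) :
  (0 <= rearrangement dtt f t)%E.
Proof. by apply: le_ereal_inf_tmp => _ [l [l0 _] <-]; rewrite lee_fin. Qed.

Lemma rearrangement_nonincr (f : R -> \bar R) (s t : R) : s <= t ->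
  (rearrangement dtt f t <= rearrangement dtt f s)%E.
Proof.
move=> st; apply: ereal_inf_le_tmp => _ [l [l0 gl] <-]; exists l => //; split => //.
by apply: (le_trans gl); rewrite lee_fin.
Qed.

Lemma rearrangement_nneg (f : R -> \bar R) :
  nneg_measurable (rearrangement dtt f).
Proof.
split; last by move=> t _; exact: rearrangement_ge0.
apply: (@measurability _ _ _ _ _ _ (@ErealGenCInfty.G R)) => //.
  exact: ErealGenCInfty.measurableE.
move=> _ [_ [r ->] <-]; apply: is_interval_measurable => x y /= [px fx] [py fy] z xzy.
move: px py; rewrite /posline /= !in_itv /= !andbT => px py.
move/andP: xzy => [xz zy]; split; first exact: lt_le_trans xz.
move: fy; rewrite /= !in_itv /= !andbT => /le_trans; apply.
exact: rearrangement_nonincr.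
Qed.

Lemma ri_mono_pos (E : ri_space R) (f g : R -> \bar R) :
  nneg_measurable f -> nneg_measurable g ->
  (forall t, 0 < t -> (f t <= g t)%E) -> (E f <= E g)%E.
Proof.
move=> mf mg fg; apply: ri_mono => //; apply: aeW => t.
by rewrite /posline /= in_itv /= andbT; exact: fg.
Qed.

(** The E~-norm sees a function only through its distribution function, so no
    measurability is needed to compare two of them: rearrangements are monotone. *)
Lemma tnorm_le_distrib (E : ri_space R) (f g : R -> \bar R) :
  (forall l, 0 <= l -> (distrib dtt f l <= distrib dtt g l)%E) ->
  (tnorm E f <= tnorm E g)%E.
Proof.
move=> fg; apply: ri_mono_pos; try exact: rearrangement_nneg.
by move=> t _; exact: rearrangement_le.
Qed.

Lemma tnorm_le (E : ri_space R) (f g : R -> \bar R) :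
  (forall t, 0 < t -> (`|f t| <= `|g t|)%E) -> (tnorm E f <= tnorm E g)%E.
Proof. by move=> fg; apply: tnorm_le_distrib => l _; exact: distrib_dtt_le. Qed.

Lemma tnorm_ge0 (E : ri_space R) (f : R -> \bar R) : (0 <= tnorm E f)%E.
Proof. exact/ri_ge0/rearrangement_nneg. Qed.

Definition step (x : int -> \bar R) (t : R) : \bar R := x (Num.floor (ln t)).

(** An enumeration of the integers by natural numbers; only its bijectivity
    matters. *)
Definition int_dec (k : nat) : int := if odd k then Negz k./2 else Posz k./2.
Definition int_enc (n : int) : nat :=
  match n with Posz m => m.*2 | Negz m => m.*2.+1 end.

Lemma int_encK : cancel int_enc int_dec.
Proof.
by case=> m; rewrite /int_dec /int_enc /= ?odd_double /= ?half_double ?uphalf_double.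
Qed.

Lemma int_decK : cancel int_dec int_enc.
Proof.
move=> k; rewrite /int_dec; case: ifP => ok /=; rewrite -[RHS](odd_double_half k) ok //.
Qed.

(** A Lebesgue counterpart of [step]: the k-th term of the enumerated sequence
    is spread over the unit interval [k, k+1[.  Unlike the rearrangement of
    [step x], it is linear in x, so that the axioms of an r.i. space apply to it
    directly. *)
Definition unroll (x : int -> \bar R) (t : R) : \bar R := x (int_dec (Num.truncn t)).

Lemma trivIset_fiber (T : Type) (f : T -> nat) (P : set T) (D : set nat) :
  trivIset D (fun k => [set t | P t /\ f t = k]).
Proof.
by apply/trivIsetP => i j _ _ ij; apply/seteqP; split => // t /= [[_ fi] [_ fj]];
  move/eqP: ij; apply; rewrite -fi -fj.
Qed.

Definition cell (n : int) : set R := [set t | posline t /\ Num.floor (ln t) = n].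

Lemma cellE n : cell n = `[expR n%:~R, expR (n + 1)%:~R[%classic.
Proof.
apply/seteqP; split => t /=; rewrite /cell /posline /= !in_itv /= ?andbT.
  move=> [t0 <-]; have /andP[l1 l2] := floor_itv (ln t).
  by rewrite -{2 3}(lnK t0) ler_expR ltr_expR l1 l2.
move=> /andP[l1 l2]; have t0 : 0 < t by apply: lt_le_trans l1; exact: expR_gt0.
split => //; apply: floor_def.
by move: l1 l2; rewrite -{1 2}(lnK t0) ler_expR ltr_expR => -> ->.
Qed.

Lemma measurable_cell n : measurable (cell n).
Proof. by rewrite cellE; exact: measurable_itv. Qed.

Lemma cell_pos n : cell n `<=` posline.
Proof. by move=> t []. Qed.

Lemma measurable_invr_pos (D : set R) : measurable D -> D `<=` posline ->
  measurable_fun D (fun t : R => (t^-1)%:E).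
Proof.
move=> mD Dp; apply/measurable_EFinP.
apply: (measurable_funS (E := posline)) => //; first exact: measurable_itv.
apply: open_continuous_measurable_fun; first by apply: interval_open.
move=> x; rewrite inE /posline /= in_itv /= andbT => x0.
by apply: inv_continuous; rewrite gt_eqF.
Qed.

(** The integral of dt/t over [e^n, e^(n+1)[ is ln e^(n+1) - ln e^n. *)
Lemma dtt_cell n : dtt (cell n) = 1%E.
Proof.
rewrite /dtt (setIidl (@cell_pos n)) cellE.
have lt : expR n%:~R < expR (n + 1)%:~R :> R by rewrite ltr_expR ltr_int; lia.
rewrite integral_itv_bndo_bndc; last first.
  by apply: measurable_invr_pos; rewrite -cellE; [exact: measurable_cell|exact: cell_pos].
rewrite (@continuous_FTC2 _ (fun t : R => t^-1) (@ln R)) //.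
- by rewrite !expRK -EFinB intrD addrAC subrr add0r.
- apply: continuous_in_subspaceT => x; rewrite inE /= in_itv /= => /andP[l1 _].
  by apply: inv_continuous; rewrite gt_eqF// (lt_le_trans (expR_gt0 _) l1).
- split.
  + move=> x; rewrite in_itv /= => /andP[l1 _].
    have x0 : 0 < x by apply: lt_trans l1; exact: expR_gt0.
    by have [] := is_derive1_ln x0.
  + apply: cvg_at_right_filter; exact: (continuous_ln (expR_gt0 _)).
  + apply: cvg_at_left_filter; exact: (continuous_ln (expR_gt0 _)).
- move=> x; rewrite in_itv /= => /andP[l1 _].
  have x0 : 0 < x by apply: lt_trans l1; exact: expR_gt0.
  rewrite derive1E; exact: (@derive_val _ _ _ _ _ _ _ (is_derive1_ln x0)).
Qed.

(** By [int_countE] the sum depends on A only, and not on the enumeration. *)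
Definition int_count (A : set int) : \bar R :=
  (\sum_(k <oo | k \in [set k | A (int_dec k)]) 1)%E.

Lemma bigcup_fiber (T : Type) (f : T -> nat) (P : set T) (A : set nat) :
  [set t | P t /\ A (f t)] = \bigcup_(k in A) [set t | P t /\ f t = k].
Proof.
apply/seteqP; split => t /=; first by move=> [pt At]; exists (f t).
by case=> k Ak [pt e]; rewrite e.
Qed.

Lemma dtt_step (A : set int) :
  dtt [set t | posline t /\ A (Num.floor (ln t))] = int_count A.
Proof.
pose F k := [set t : R | posline t /\ int_enc (Num.floor (ln t)) = k].
have FE k : F k = cell (int_dec k).
  apply/seteqP; split => t /= [pt]; first by move=> <-; rewrite /cell /= int_encK.
  by move=> e; split => //; rewrite e int_decK.
have -> : [set t | posline t /\ A (Num.floor (ln t))] =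
    \bigcup_k (if k \in [set k | A (int_dec k)] then F k else set0).
  rewrite -bigcup_mkcond -(bigcup_fiber (fun t => int_enc (Num.floor (ln t)))).
  by apply/seteqP; split => t /=; rewrite int_encK.
have mF k : measurable (if k \in [set k | A (int_dec k)] then F k else set0).
  by case: ifP => // _; rewrite FE; exact: measurable_cell.
have Fp : \bigcup_k (if k \in [set k | A (int_dec k)] then F k else set0) `<=` posline.
  by move=> t [k _]; case: ifP => // _ [].
rewrite /dtt (setIidl Fp) ge0_integral_bigcup //.
- rewrite /int_count [RHS]eseries_mkcond; apply: eq_eseriesr => k _.
  case: ifP => _; last by rewrite integral_set0.
  have := dtt_cell (int_dec k); rewrite /dtt (setIidl (@cell_pos _)) -FE => <-.
  by [].
- by apply: measurable_invr_pos => //; exact: bigcupT_measurable.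
- by move=> x /Fp; rewrite /posline /= in_itv /= andbT lee_fin invr_ge0 => /ltW.
- have := @trivIset_fiber R (fun t : R => int_enc (Num.floor (ln t))) posline [set k | A (int_dec k)].
  by move=> /trivIset_mkcond.
Qed.

Lemma leb_unroll_fiber k : leb [set t | posline t /\ Num.truncn t = k] = 1%E
  /\ measurable [set t : R | posline t /\ Num.truncn t = k].
Proof.
have -> : [set t : R | posline t /\ Num.truncn t = k] =
   [set` Interval (if k == 0%N then BRight 0 else BLeft k%:R) (BLeft k.+1%:R)].
  apply/seteqP; split => t /=; rewrite /posline /= !in_itv /= ?andbT.
    move=> [t0 <-]; have /andP[l1 l2] := truncn_itv (ltW t0).
    by rewrite l2 andbT; case: ifP.
  move=> /andP[l1 l2]; have t0 : 0 < t.
    by move: l1; case: ifP => //= /negbT; rewrite -lt0n -(ltr0n R); apply: lt_le_trans.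
  split => //; apply: truncn_def; rewrite l2 andbT.
  by move: l1; case: ifP => [/eqP -> _|//]; exact: ltW.
split; last exact: measurable_itv.
rewrite lebesgue_measure_itv; case: eqP => [->|] /=.
  by rewrite lte_fin ltr01 oppr0 adde0.
by rewrite lte_fin ltr_nat leqnn -EFinB -natrB // subSnn.
Qed.

Lemma leb_unroll (A : set int) :
  leb [set t | posline t /\ A (int_dec (Num.truncn t))] = int_count A
  /\ measurable [set t : R | posline t /\ A (int_dec (Num.truncn t))].
Proof.
rewrite (bigcup_fiber (fun t => Num.truncn t) posline [set k | A (int_dec k)]).
split; last first.
  by apply: bigcup_measurable => k _; have [_] := leb_unroll_fiber k.
rewrite measure_bigcup.
- by apply: eq_eseriesr => k _; have [+ _] := leb_unroll_fiber k; exact.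
- by move=> k _; have [_] := leb_unroll_fiber k.
- exact: trivIset_fiber.
Qed.

(** The norm of E transported to sequences indexed by the integers. *)
Definition snorm (E : ri_space R) (x : int -> \bar R) : \bar R := tnorm E (step x).

Definition nonneg (x : int -> \bar R) := forall n, (0 <= x n)%E.

Lemma measurable_unroll (x : int -> \bar R) : nonneg x -> nneg_measurable (unroll x).
Proof.
move=> x0; split; last by move=> t _; exact: x0.
move=> _ Y mY.
have [_] := leb_unroll [set n | Y (x n)].
by congr (measurable _); apply/seteqP; split => t.
Qed.

Lemma distrib_step (x : int -> \bar R) (l : R) : nonneg x ->
  distrib dtt (step x) l = int_count [set n | (l%:E < x n)%E].
Proof.
move=> x0; rewrite -dtt_step /distrib; congr dtt.
by apply/seteqP; split => t /= [pt]; rewrite /step gee0_abs.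
Qed.

Lemma distrib_unroll (x : int -> \bar R) (l : R) : nonneg x ->
  distrib leb (unroll x) l = int_count [set n | (l%:E < x n)%E].
Proof.
move=> x0; have [<- _] := leb_unroll [set n | (l%:E < x n)%E].
rewrite /distrib; congr (leb _).
by apply/seteqP; split => t /= [pt]; rewrite /unroll gee0_abs.
Qed.

Lemma leb_lt_pos (d : \bar R) : (0 <= d)%E ->
  leb [set t : R | posline t /\ (t%:E < d)%E] = d.
Proof.
case: d => [d| |] //.
- rewrite lee_fin => d0.
  have -> : [set t : R | posline t /\ (t%:E < d%:E)%E] = `]0, d[%classic.
    apply/seteqP; split => t /=; rewrite /posline /= !in_itv /= andbT lte_fin.
      by move=> [-> ->].
    by move=> /andP[-> ->].
  rewrite lebesgue_measure_itv /= lte_fin; case: ltrP => [_|d0'].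
    by rewrite oppr0 adde0.
  by congr (_%:E); apply/eqP; rewrite eq_le d0 d0'.
- move=> _; have -> : [set t : R | posline t /\ (t%:E < +oo)%E] = `]0, +oo[%classic.
    by apply/seteqP; split => t /=; rewrite ltry /posline //=; case.
  by rewrite lebesgue_measure_itv /= ltry.
Qed.

(** Continuity of the measure from below along the level sets of height
    l + 1/(n+1), which increase to the level set of height l. *)
Lemma distrib_right_cont (f : R -> \bar R) (l : R) (t : R) :
  nneg_measurable f -> (t%:E < distrib leb f l)%E ->
  exists2 l', l < l' & (t%:E < distrib leb f l')%E.
Proof.
move=> [mf f0] tl; apply: contrapT => nex.
pose F n := [set s | posline s /\ ((l + n.+1%:R^-1)%:E < `|f s|)%E].
have mF n : measurable (F n).
  have -> : F n = posline `&` (fun s => `|f s|)%E @^-1` `](l + n.+1%:R^-1)%:E, +oo[%classic.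
    by apply/seteqP; split => s /=; rewrite in_itv /= andbT.
  have mf' : measurable_fun posline (fun s => `|f s|)%E by exact: measurableT_comp.
  by apply: mf'; [exact: measurable_itv|exact: emeasurable_itv].
have UF : \bigcup_n F n = [set s | posline s /\ (l%:E < `|f s|)%E].
  apply/seteqP; split => s /=.
    case=> n _ [ps lt]; split => //; apply: lt_trans lt.
    by rewrite lte_fin ltrDl invr_gt0.
  move=> [ps lt]; suff [n hn] : exists n, ((l + n.+1%:R^-1)%:E < `|f s|)%E by exists n.
  case: (`|f s|)%E lt => [r| |] //; last by exists 0%N; rewrite ltry.
  rewrite lte_fin -subr_gt0 => lr.
  exists (Num.truncn (r - l)^-1); rewrite lte_fin -ltrBrDl invf_plt ?posrE //.
  exact: truncnS_gt.
have ndF : nondecreasing_seq F.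
  move=> n m nm; apply/subsetPset => s [ps lt]; split => //; apply: le_lt_trans lt.
  by rewrite lee_fin lerD2l lef_pV2 ?posrE // ler_nat ltnS.
have mU : measurable (\bigcup_n F n) by exact: bigcupT_measurable.
have := nondecreasing_cvg_mu (mu := leb) mF mU ndF; rewrite UF => cv.
have : (leb [set s | posline s /\ (l%:E < `|f s|)%E] <= t%:E)%E.
  rewrite -(cvg_lim _ cv) //; apply: lime_le; first by apply/cvg_ex; eexists; exact: cv.
  apply: nearW => n /=; rewrite leNgt; apply/negP => lt.
  by apply: nex; exists (l + n.+1%:R^-1) => //; rewrite ltrDl invr_gt0.
by rewrite leNgt => /negP; exact.
Qed.

(** The rearrangement of [step x] for dt/t and the function [unroll x] have the
    same Lebesgue distribution function: both count the terms of x above a given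
    level.  This rests on the classical fact that the rearrangement of f exceeds
    l exactly on an interval whose length is the distribution function at l. *)
Lemma snormE (E : ri_space R) (x : int -> \bar R) : nonneg x ->
  snorm E x = E (unroll x).
Proof.
move=> x0; apply: ri_equimeasurable.
- exact: rearrangement_nneg.
- exact: measurable_unroll.
move=> l l0.
have dE r : distrib leb (unroll x) r = distrib dtt (step x) r.
  by rewrite distrib_unroll // distrib_step.
have -> : distrib leb (rearrangement dtt (step x)) l =
    leb [set t : R | posline t /\ (t%:E < distrib leb (unroll x) l)%E].
  rewrite {1}/distrib; congr (leb _); apply/seteqP.
  split => t /= [pt]; rewrite gee0_abs ?rearrangement_ge0 // => lt; split => //.
    rewrite ltNge; apply/negP => dt; move: lt; rewrite ltNge => /negP; apply.
    by apply: ereal_inf_lbound; exists l => //; split => //; rewrite -dE.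
  have [l' ll' lt'] := distrib_right_cont (measurable_unroll x0) lt.
  apply: (@lt_le_trans _ _ l'%:E); first by rewrite lte_fin.
  apply: le_ereal_inf_tmp => _ [r [r0 dr] <-]; rewrite lee_fin leNgt.
  apply/negP => rl'; move: lt'; rewrite ltNge => /negP; apply.
  apply: le_trans dr; rewrite -dE; apply: le_measure; rewrite ?inE.
  - have [_] := leb_unroll [set n | (l'%:E < `|x n|)%E]; congr measurable.
  - have [_] := leb_unroll [set n | (r%:E < `|x n|)%E]; congr measurable.
  - by move=> s [ps lt'']; split => //; apply: lt_trans lt''; rewrite lte_fin.
by rewrite leb_lt_pos // distrib_unroll //; apply: nneseries_ge0.
Qed.

End Steps.

(** * The r.i. norm on two-sided sequences *)

Section SeqNorm.
Context {R : realType}.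
Implicit Types (E F : ri_space R) (x y z : int -> \bar R).

Lemma int_countE (A : set int) : int_count A = (\esum_(n in A) (1 : \bar R))%E.
Proof.
rewrite /int_count nneseries_esum //.
rewrite (@reindex_esum R _ _ [set k | A (int_dec k)] A int_dec).
  by congr esum; apply/seteqP; split => k /=; rewrite inE.
split => [k //|k l _ _ /(can_inj int_decK) //|n An].
by exists (int_enc n); rewrite /= ?int_encK.
Qed.

Lemma int_count_le_inj (s : int -> int) (A B : set int) : set_inj A s ->
  (forall n, A n -> B (s n)) -> (int_count A <= int_count B :> \bar R)%E.
Proof.
move=> sinj AB; rewrite !int_countE -(@esum_image R _ _ A s (fun=> 1%E) sinj) esum_mkcond [leRHS]esum_mkcond.
apply: le_esum => n _; case: ifPn => [|_]; last by case: ifP.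
by rewrite inE => -[m Am <-]; rewrite mem_set //; exact: AB.
Qed.

Lemma snorm_ge0 E x : (0 <= snorm E x)%E.
Proof. exact: tnorm_ge0. Qed.

Lemma snorm_le E x y : nonneg x -> (forall n, (x n <= y n)%E) ->
  (snorm E x <= snorm E y)%E.
Proof.
move=> x0 xy; apply: tnorm_le => t _; rewrite /step !gee0_abs //.
exact: le_trans (x0 _) (xy _).
Qed.

Lemma snorm_eq E x y : (forall n, x n = y n) -> snorm E x = snorm E y.
Proof. by move=> xy; have -> : x = y by apply/funext. Qed.

Lemma snormD E x y : nonneg x -> nonneg y ->
  (snorm E (fun n => x n + y n) <= snorm E x + snorm E y)%E.
Proof.
move=> x0 y0; rewrite !snormE //; last by move=> n; exact: adde_ge0.
by apply: ri_triangle; exact: measurable_unroll.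
Qed.

Lemma snormZr E (c : R) x : 0 <= c -> nonneg x ->
  (snorm E (fun n => c%:E * x n) = c%:E * snorm E x)%E.
Proof.
move=> c0 x0; rewrite !snormE //; last by move=> n; rewrite mule_ge0 // lee_fin.
by apply: ri_homo => //; exact: measurable_unroll.
Qed.

Lemma snorm0 E : snorm E (fun=> 0%E) = 0%E.
Proof.
have := @snormZr E 0 (fun=> 0%E) (lexx _) (fun=> lexx _).
by rewrite !mul0e.
Qed.

(** For c = +oo, the left-hand side is bounded below by every finite multiple of
    the norm of x, unless x vanishes. *)
Lemma snormZ E (c : \bar R) x : (0 <= c)%E -> nonneg x ->
  (snorm E (fun n => c * x n) = c * snorm E x)%E.
Proof.
case: c => [c| |] //; first by rewrite lee_fin; exact: snormZr.
move=> _ x0.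
have [e0|] := eqVneq (snorm E x) 0%E; last first.
  move=> ne; have epos : (0 < snorm E x)%E by rewrite lt0e ne snorm_ge0.
  rewrite gt0_mulye //; apply/eqP; rewrite -leye_eq.
  have H (M : R) : 0 <= M -> (M%:E * snorm E x <= snorm E (fun n => +oo * x n))%E.
    move=> M0; rewrite -snormZr //; apply: snorm_le => n.
      by rewrite mule_ge0 // lee_fin.
    by rewrite lee_wpmul2r // leey.
  case: (snorm E x) epos H => [r| |] //; last first.
    by move=> _ /(_ 1 ler01); rewrite mul1e.
  rewrite lte_fin => r0 H; rewrite leye_eq; apply/eqP/eqyP => a a0.
  have := H (a / r) (divr_ge0 (ltW a0) (ltW r0)).
  by rewrite -EFinM mulfVK // gt_eqF.
rewrite e0 mule0; apply/eqP; rewrite eq_le snorm_ge0 andbT.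
(* If x has norm 0 then it vanishes almost everywhere, and so does +oo * x. *)
have -> : snorm E (fun n => +oo * x n)%E = snorm E x; last by rewrite e0.
move: e0; rewrite !snormE //; last by move=> n; rewrite mule_ge0.
move=> e0; have mx := measurable_unroll x0.
have mx' : nneg_measurable (unroll (fun n => +oo * x n)%E).
  by apply: measurable_unroll => n; rewrite mule_ge0.
rewrite e0; apply/(ri_eq0 E mx'); move/(ri_eq0 E mx): e0.
case=> N [mN N0 sub]; exists N; split => //; apply: subset_trans sub => t /= nt h.
by apply: nt => pt; move: (h pt); rewrite /unroll => ->; exact: mule0.
Qed.

Lemma snorm_sum E (L : nat) (x : nat -> int -> \bar R) : (forall i, nonneg (x i)) ->
  (snorm E (fun n => \sum_(i < L) x i n) <= \sum_(i < L) snorm E (x i))%E.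
Proof.
move=> x0; elim: L => [|L IH].
  rewrite big_ord0 (@snorm_eq _ _ (fun=> 0%E)) ?snorm0 // => n.
  by rewrite big_ord0.
rewrite big_ord_recr /= (@snorm_eq _ _ (fun n => \sum_(i < L) x i n + x L n)%E);
  last by move=> n; rewrite big_ord_recr.
apply: le_trans (snormD _ _ _) _ => //; first by move=> n; apply: sume_ge0 => i _; exact: x0.
exact: leeD.
Qed.

(** The Fatou property, applied to the partial sums. *)
Lemma snorm_series E (x : nat -> int -> \bar R) : (forall i, nonneg (x i)) ->
  (snorm E (fun n => \sum_(i <oo) x i n) <= \sum_(i <oo) snorm E (x i))%E.
Proof.
move=> x0.
have s0 : nonneg (fun n => \sum_(i <oo) x i n)%E.
  by move=> n; apply: nneseries_ge0 => i _ _; exact: x0.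
pose S k n := (\sum_(0 <= i < k) x i n)%E.
have S0 k : nonneg (S k) by move=> n; apply: sume_ge0 => i _; exact: x0.
rewrite snormE //.
have cv : (fun k => E (unroll (S k))) @ \oo --> E (unroll (fun n => \sum_(i <oo) x i n)%E).
  apply: ri_fatou.
  - by move=> k; exact: measurable_unroll.
  - exact: measurable_unroll.
  - apply: aeW => t _; split.
      by apply: ereal_nondecreasing_series => i _ _; exact: x0.
    by apply: is_cvg_nneseries => i _ _; exact: x0.
rewrite -(cvg_lim _ cv) //; apply: lime_le; first by apply/cvg_ex; eexists; exact: cv.
apply: nearW => k; rewrite -snormE //.
apply: (@le_trans _ _ (\sum_(0 <= i < k) snorm E (x i))%E).
  rewrite big_mkord (@snorm_eq _ _ (fun n => \sum_(i < k) x i n)%E); first exact: snorm_sum.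
  by move=> n; rewrite /S big_mkord.
by apply: nneseries_lim_ge => i _ _; exact: snorm_ge0.
Qed.

(** Rearrangement invariance: along an injection, the sequence x (s n) has at
    most as many entries above each level as x has. *)
Lemma snorm_inj E (s : int -> int) (P : pred int) x : nonneg x ->
  (forall i j, P i -> P j -> s i = s j -> i = j) ->
  (snorm E (fun n => if P n then x (s n) else 0) <= snorm E x)%E.
Proof.
move=> x0 sinj; apply: tnorm_le_distrib => l l0.
rewrite !distrib_step //; last by move=> n; case: ifP.
apply: (@int_count_le_inj s).
  move=> i j; rewrite !inE /=; case: ifP => Pi; case: ifP => Pj; rewrite ?lte_fin ?ltNge ?l0 //.
  by move=> _ _; exact: sinj.
by move=> n /=; case: ifP => //; rewrite lte_fin ltNge l0.
Qed.

Lemma snorm_bij E (s t : int -> int) x : nonneg x -> cancel s t -> cancel t s ->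
  snorm E (fun n => x (s n)) = snorm E x.
Proof.
move=> x0 st ts; apply/eqP; rewrite eq_le; apply/andP; split.
  apply: (@snorm_inj E s xpredT x) => // i j _ _; exact: can_inj.
rewrite -[leLHS](@snorm_eq E (fun n => x (s (t n)))); last by move=> n; rewrite ts.
by apply: (@snorm_inj E t xpredT (fun n => x (s n))) => // i j _ _; exact: can_inj.
Qed.

Lemma snorm_shift E (k : int) x : nonneg x -> snorm E (fun n => x (n + k)) = snorm E x.
Proof. by move=> x0; apply: (@snorm_bij E _ (fun n => n - k)) => // n; rewrite ?addrK ?subrK. Qed.

Lemma snorm_opp E x : nonneg x -> snorm E (fun n => x (- n)) = snorm E x.
Proof. by move=> x0; apply: (@snorm_bij E _ (fun n => - n)) => // n; rewrite opprK. Qed.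

(** Split the integers into the L residue classes modulo L: on each of them s is
    injective. *)
Lemma snorm_comp E (L : nat) (s : int -> int) x : nonneg x ->
  (forall i j, s i = s j -> (`|i - j| < L)%N) ->
  (snorm E (fun n => x (s n)) <= L%:R%:E * snorm E x)%E.
Proof.
move=> x0 sL.
have L0 : (0 < L)%N by have := sL 0 0 erefl; rewrite subrr.
pose P (r : nat) (n : int) := (n %% L)%Z == r.
rewrite (@snorm_eq E _ (fun n => \sum_(r < L) if P r n then x (s n) else 0)%E); last first.
  move=> n; have L0' : (L : int) != 0 by lia.
  have r1 := modz_ge0 n L0'; have r2 := ltz_mod n L0'.
  have rL : (`|(n %% L)%Z| < L)%N by lia.
  rewrite (bigD1 (Ordinal rL)) //= /P gez0_abs // eqxx big1 ?adde0 // => i /eqP ni.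
  case: eqP => // e; case: ni; apply: val_inj => /=; lia.
apply: le_trans (@snorm_sum E L (fun r n => if P r n then x (s n) else 0%E) _) _.
  by move=> r n; case: ifP.
apply: (@le_trans _ _ (\sum_(r < L) snorm E x)%E).
  apply: lee_sum => r _; apply: snorm_inj => // i j /eqP Pi /eqP Pj /sL ij.
  have e : i - j = ((i %/ L)%Z - (j %/ L)%Z) * L.
    by rewrite {1}(divz_eq i L) {1}(divz_eq j L) Pi Pj; ring.
  move: ij; rewrite e abszM absz_nat -[ltnRHS]mul1n ltn_pmul2r // ltnS leqn0 absz_eq0.
  by rewrite subr_eq0 => /eqP q; rewrite (divz_eq i L) (divz_eq j L) Pi Pj q.
by rewrite sumr_const card_ord mule_natl.
Qed.

Definition delta (m : int) : int -> \bar R := fun k => if k == m then 1%E else 0%E.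

Lemma delta_ge0 m : nonneg (delta m).
Proof. by move=> n; rewrite /delta; case: ifP. Qed.

Lemma snorm_delta E m : snorm E (delta m) = snorm E (delta 0).
Proof.
rewrite -[RHS](snorm_shift E (- m)); last exact: delta_ge0.
by apply: snorm_eq => n; rewrite /delta subr_eq0.
Qed.

(** The fundamental function of E at 1. *)
Definition phi E : R := fine (snorm E (delta 0)).

Lemma leb_delta : lebesgue_measure [set t : R | posline t /\ Num.truncn t = 0%N] = 1%E.
Proof. by have [] := @leb_unroll_fiber R 0. Qed.

Lemma snorm_delta_fin E : snorm E (delta 0) \is a fin_num.
Proof.
rewrite ge0_fin_numE ?snorm_ge0 // snormE; last exact: delta_ge0.
pose A := [set t : R | posline t /\ Num.truncn t = 0%N].
have mA : measurable A by have [] := @leb_unroll_fiber R 0.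
apply: (@le_lt_trans _ _ (E (fun t => (\1_A t)%:E))); last first.
  apply: ri_indic => //; first by move=> t [].
  by apply: (@le_lt_trans _ _ 1%E); rewrite ?ltry // leb_delta.
apply: ri_mono_pos.
- by apply: measurable_unroll; exact: delta_ge0.
- split; first by apply/measurable_EFinP; exact: measurable_indic.
  by move=> t _; rewrite lee_fin indicE.
move=> t t0; rewrite /unroll /delta indicE; case: eqP => e; last by rewrite lee_fin.
rewrite mem_set //; split; first by rewrite /posline /= in_itv /= andbT.
by rewrite -(int_decK (Num.truncn t)) e.
Qed.

Lemma phiE E m : snorm E (delta m) = (phi E)%:E.
Proof. by rewrite snorm_delta fineK // snorm_delta_fin. Qed.

(** The unit entry does not vanish on a set of measure 1, so its norm is not 0. *)
Lemma phi_gt0 E : 0 < phi E.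
Proof.
rewrite -lte_fin -(phiE E 0) lt0e snorm_ge0 andbT; apply/eqP.
have d0 := @delta_ge0 0.
rewrite snormE // => /(ri_eq0 E (measurable_unroll d0)) [N [mN N0 sub]].
have : (lebesgue_measure [set t : R | posline t /\ Num.truncn t = 0%N] <= lebesgue_measure N)%E.
  apply: le_measure; rewrite ?inE //; first by have [] := @leb_unroll_fiber R 0.
  move=> t [pt tr]; apply: sub => /= /(_ pt); rewrite /unroll tr /delta /= => /eqP.
  by rewrite eqe oner_eq0.
by rewrite N0 leb_delta lee_fin ler10.
Qed.

(** An r.i. norm dominates every single entry; this is the source of all lower
    bounds below. *)
Lemma snorm_entry E x m : nonneg x -> ((phi E)%:E * x m <= snorm E x)%E.
Proof.
move=> x0; rewrite -(phiE E m) muleC -snormZ //; last exact: delta_ge0.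
apply: snorm_le => n; first by rewrite mule_ge0 // delta_ge0.
by rewrite /delta; case: eqP => [->|_]; rewrite ?mule1 ?mule0.
Qed.

End SeqNorm.

(* From here on norms are handled through the lemmas above; transparency would
   let conversion unfold rearrangements in every side condition. *)
Global Opaque snorm phi.

(** * Regularly varying sequences and Hardy inequalities *)

Section Weights.
Context {R : realType}.
Implicit Types (E F : ri_space R) (x y z : int -> \bar R) (w v : int -> R).

Lemma ler_eq (a b : R) : a = b -> a <= b.
Proof. by move=> ->. Qed.

(** Regularly varying sequences of index al.  The loss e^(eps |m - n|), with eps
    arbitrary, absorbs slowly varying factors, and the class is closed under the
    operations that occur in rho and in the weights. *)
Definition rvseq (al : R) w := (forall n, 0 < w n) /\
  forall e : R, 0 < e -> exists2 C : R, 0 < C & forall m n : int,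
    w m <= C * expR (al * (m - n)%:~R + e * `|(m - n)%:~R|) * w n.

Lemma rvseq_mul al be w v : rvseq al w -> rvseq be v -> rvseq (al + be) (fun n => w n * v n).
Proof.
move=> [w0 hw] [v0 hv]; split => [n|e e0]; first exact: mulr_gt0.
have e2 : 0 < e / 2 by lra.
have [C C0 HC] := hw _ e2; have [D D0 HD] := hv _ e2.
exists (C * D) => [|m n]; first exact: mulr_gt0.
apply: (le_trans (ler_pM (ltW (w0 m)) (ltW (v0 m)) (HC m n) (HD m n))).
set t := (m - n)%:~R; set a := `|t|.
have -> : (al + be) * t + e * a = (al * t + e / 2 * a) + (be * t + e / 2 * a) by field.
rewrite [expR (_ + (be * _ + _))]expRD; apply: ler_eq.
set p := expR _; set q := expR _; ring.
Qed.

Lemma rvseq_inv al w : rvseq al w -> rvseq (- al) (fun n => (w n)^-1).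
Proof.
move=> [w0 hw]; split => [n|e e0]; first by rewrite invr_gt0.
have [C C0 HC] := hw _ e0; exists C => // m n.
rewrite ler_pdivlMr // mulrC ler_pdivrMr //.
apply: (le_trans (HC n m)); apply: ler_eq.
have -> : (n - m)%:~R = - (m - n)%:~R :> R by rewrite -mulrNz opprB.
by rewrite normrN mulrN mulNr.
Qed.

(** A negative power is the inverse of a positive one. *)
Lemma rvseq_powR al (p : R) w : rvseq al w -> rvseq (al * p) (fun n => w n `^ p).
Proof.
have pos q be v : 0 <= q -> rvseq be v -> rvseq (be * q) (fun n => v n `^ q).
  move=> q0 [v0 hv]; split => [n|e e0]; first exact: powR_gt0.
  have e2 : 0 < e / (q + 1) by apply: divr_gt0 => //; lra.
  have [C C0 HC] := hv _ e2.
  exists (C `^ q) => [|m n]; first exact: powR_gt0.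
  have : v m `^ q <= (C * expR (be * (m - n)%:~R + e / (q + 1) * `|(m - n)%:~R|) * v n) `^ q.
    apply: ge0_ler_powR => //; rewrite ?nnegrE ?ltW //.
    by rewrite !mulr_gt0 // expR_gt0.
  move=> h; apply: (le_trans h).
  have [C0' v0'] := (ltW C0, ltW (v0 n)).
  rewrite !powRM ?mulr_ge0 ?expR_ge0 //.
  apply: ler_wpM2r; first exact: powR_ge0.
  apply: ler_wpM2l; first exact: powR_ge0.
  rewrite /powR gt_eqF ?expR_gt0 // expRK ler_expR.
  set t := (m - n)%:~R.
  have -> : q * (be * t + e / (q + 1) * `|t|) = be * q * t + (q / (q + 1)) * (e * `|t|).
    field; lra.
  rewrite lerD2l; apply: ler_piMl; first by rewrite mulr_ge0 // ltW.
  rewrite ler_pdivrMr; lra.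
move=> hw; have [p0|p0] := leP 0 p; first exact: pos.
have p0' : 0 <= - p by lra.
have := pos _ _ _ p0' (rvseq_inv hw); rewrite mulNr mulrN opprK.
congr rvseq; apply/funext => n; rewrite -powR_inv1; last by case: hw => w0 _; exact: ltW.
by rewrite -powRrM mulN1r opprK.
Qed.

Lemma rvseq_opp al w : rvseq al w -> rvseq (- al) (fun n => w (- n)).
Proof.
move=> [w0 hw]; split => [n //|e e0].
have [C C0 HC] := hw _ e0; exists C => // m n.
apply: (le_trans (HC (- m) (- n))); apply: ler_eq.
have -> : (- m - - n)%:~R = - (m - n)%:~R :> R by rewrite -mulrNz; congr (_%:~R); lia.
by rewrite normrN mulrN mulNr.
Qed.

Lemma rvseq_exp (al : R) : rvseq al (fun n => expR (al * n%:~R)).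
Proof.
split => [n|e e0]; first exact: expR_gt0.
exists 1 => // m n; rewrite mul1r -expRD ler_expR intrB.
have : 0 <= e * `|m%:~R - n%:~R| by rewrite mulr_ge0 // ltW.
set a := _ * `|_|; lra.
Qed.

Lemma rvseq_eq al be w v : rvseq al w -> al = be -> w =1 v -> rvseq be v.
Proof. by move=> h <- e; have <- : w = v by apply/funext. Qed.

Lemma rvseq_scale al (c : R) w : 0 < c -> rvseq al w -> rvseq al (fun n => c * w n).
Proof.
move=> c0 [w0 hw]; split => [n|e e0]; first exact: mulr_gt0.
have [C C0 HC] := hw _ e0; exists C => // m n.
by rewrite mulrCA ler_pM2l.
Qed.

Lemma rvseq_near al w : rvseq al w ->
  exists2 C : R, 0 < C & forall m n : int, (`|m - n| <= 1)%N -> w m <= C * w n.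
Proof.
move=> [w0 hw]; have [C C0 HC] := hw _ ltr01.
exists (C * expR (`|al| + 1)) => [|m n mn]; first by rewrite mulr_gt0 // expR_gt0.
apply: (le_trans (HC m n)); rewrite ler_pM2r // ler_pM2l // ler_expR.
have t1 : `|(m - n)%:~R : R| <= 1.
  rewrite -intr_norm -abszE lerz1; lia.
have h : al * (m - n)%:~R <= `|al|.
  apply: (le_trans (ler_norm _)); rewrite normrM; apply: ler_piMr => //.
by rewrite mul1r; lra.
Qed.

(** Take eps = al / 2: the exponent al - eps is still positive. *)
Lemma rvseq_decay al w : rvseq al w -> 0 < al ->
  exists A q, [/\ 0 < A, 0 < q, q < 1 &
    forall n (i : nat), w (n - i%:Z) <= A * q ^+ i * w n].
Proof.
move=> [w0 hw] al0; have e0 : 0 < al / 2 by lra.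
have [C C0 HC] := hw _ e0.
exists C, (expR (- (al / 2))); split => //; first exact: expR_gt0.
  by rewrite expR_lt1; lra.
move=> n i; apply: (le_trans (HC _ n)); rewrite ler_pM2r // ler_pM2l //.
rewrite -expRM_natl ler_expR.
have -> : (n - i%:Z - n)%:~R = - i%:R :> R by rewrite addrAC subrr sub0r mulrNz.
rewrite normrN ger0_norm // -mulr_natl; lra.
Qed.

(** Truncations to the open half-lines, the sequence forms of the norms over
    (0, t) and (t, oo). *)
Definition below (n : int) x k := if (k < n)%R then x k else 0%E.
Definition above (n : int) x k := if (n < k)%R then x k else 0%E.
Definition smul w x n := ((w n)%:E * x n)%E.
Definition emb w n := (w n)%:E.

Lemma below_ge0 n x : nonneg x -> nonneg (below n x).
Proof. by move=> x0 k; rewrite /below; case: ifP. Qed.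
Lemma above_ge0 n x : nonneg x -> nonneg (above n x).
Proof. by move=> x0 k; rewrite /above; case: ifP. Qed.
Lemma smul_ge0 w x : (forall n, 0 < w n) -> nonneg x -> nonneg (smul w x).
Proof. by move=> w0 x0 k; rewrite mule_ge0 // lee_fin ltW. Qed.
Lemma emb_ge0 w : (forall n, 0 < w n) -> nonneg (emb w).
Proof. by move=> w0 k; rewrite lee_fin ltW. Qed.

Lemma snorm_above E n x : nonneg x ->
  snorm E (above n x) = snorm E (below (- n) (fun k => x (- k))).
Proof.
move=> x0; rewrite -snorm_opp; last exact: above_ge0.
by apply: snorm_eq => k; rewrite /above /below; congr (if _ then _ else _); lia.
Qed.

Lemma geom_series_le (A q : R) (u : nat -> \bar R) (Y : \bar R) :
  0 <= A -> 0 <= q -> q < 1 -> (0 <= Y)%E -> (forall i, 0 <= u i)%E ->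
  (forall i, (u i <= (A * q ^+ i)%:E * Y)%E) ->
  (\sum_(i <oo) u i <= (A / (1 - q))%:E * Y)%E.
Proof.
move=> A0 q0 q1 Y0 u0 uY.
apply: lime_le; first by apply: is_cvg_nneseries => i _ _; exact: u0.
apply: nearW => k; apply: (@le_trans _ _ (\sum_(0 <= i < k) ((A * q ^+ i)%:E * Y))%E).
  exact: lee_sum.
rewrite -ge0_sume_distrl => [|i _]; last by rewrite lee_fin mulr_ge0 // exprn_ge0.
rewrite sumEFin lee_wpmul2r // lee_fin -mulr_sumr ler_wpM2l //.
rewrite big_mkord -[leRHS]mul1r ler_pdivlMr ?subr_gt0 //.
have := subrX1 q k => e; have q1' : 0 < 1 - q by lra.
have -> : (\sum_(i < k) q ^+ i) * (1 - q) = 1 - q ^+ k by lra.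
by have := exprn_ge0 k q0; lra.
Qed.

(** Countable subadditivity together with a geometric series of coefficients. *)
Lemma snorm_geom E (A q : R) (u : nat -> int -> \bar R) z (Y : \bar R) :
  0 <= A -> 0 <= q -> q < 1 -> (forall i, nonneg (u i)) -> nonneg z ->
  (forall n, (z n <= \sum_(i <oo) (A * q ^+ i)%:E * u i n)%E) ->
  (forall i, (snorm E (u i) <= Y)%E) -> (0 <= Y)%E ->
  (snorm E z <= (A / (1 - q))%:E * Y)%E.
Proof.
move=> A0 q0 q1 u0 z0 zu uY Y0.
have Aq i : 0 <= A * q ^+ i by rewrite mulr_ge0 // exprn_ge0.
have U0 i : nonneg (fun n => (A * q ^+ i)%:E * u i n)%E.
  by move=> n; rewrite mule_ge0 // ?lee_fin //; exact: u0.
apply: (le_trans (snorm_le E z0 zu)).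
apply: (le_trans (snorm_series E U0)).
apply: geom_series_le => // i; first exact: snorm_ge0.
by rewrite snormZr // lee_wpmul2l // lee_fin.
Qed.

Lemma nneseries_term (u : nat -> \bar R) (i : nat) : (forall i, 0 <= u i)%E ->
  (u i <= \sum_(j <oo) u j)%E.
Proof.
move=> u0; apply: (@le_trans _ _ (\sum_(0 <= j < i.+1) u j)%E).
  by rewrite big_nat_recr //= leeDr // sume_ge0.
by apply: nneseries_lim_ge => j _ _.
Qed.

(** A sequence is the sum of its entries, and all unit entries have norm phi F. *)
Lemma snorm_below_series F n x : nonneg x ->
  (snorm F (below n x) <= \sum_(i <oo) (phi F)%:E * x (n - i.+1%:Z)%R)%E.
Proof.
move=> x0.
have D0 i : nonneg (fun k => x (n - i.+1%:Z)%R * delta (n - i.+1%:Z)%R k)%E.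
  by move=> k; rewrite mule_ge0 // delta_ge0.
apply: (@le_trans _ _ (snorm F (fun k => \sum_(i <oo) x (n - i.+1%:Z)%R%R * delta (n - i.+1%:Z)%R k)%E)).
  apply: snorm_le => [|k]; first exact: below_ge0.
  rewrite /below; case: ifP => kn; last by apply: nneseries_ge0 => i _ _; exact: D0.
  apply: (@le_trans _ _ (x (n - (`|n - k|%N.-1).+1%:Z)%R * delta (n - (`|n - k|%N.-1).+1%:Z)%R k)%E).
    have -> : n - (`|n - k|%N.-1).+1%:Z = k by lia.
    by rewrite /delta eqxx mule1.
  by apply: (@nneseries_term (fun i => x (n - i.+1%:Z)%R * delta (n - i.+1%:Z)%R k)%E) => i; exact: D0.
apply: (le_trans (snorm_series F D0)).
by apply: lee_nneseries => [i _|i _]; rewrite ?snorm_ge0 // snormZ ?phiE 1?muleC //; exact: delta_ge0.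
Qed.

(** The entries below n decay geometrically away from n. *)
Lemma snorm_below_rvseq F al w : rvseq al w -> 0 < al ->
  exists2 C : R, 0 < C & forall n, (snorm F (below n (emb w)) <= (C * w n)%:E)%E.
Proof.
move=> hw al0; have [A [q [A0 q0 q1 Hq]]] := rvseq_decay hw al0.
have [w0 _] := hw; have p0 := phi_gt0 F.
exists (phi F * A * q / (1 - q)) => [|n].
  by rewrite divr_gt0 ?mulr_gt0 // subr_gt0.
apply: (le_trans (snorm_below_series F n (emb_ge0 w0))).
rewrite EFinM; apply: geom_series_le => //.
- by rewrite ltW // !mulr_gt0.
- exact: ltW.
- by rewrite lee_fin ltW.
- by move=> i; rewrite mule_ge0 // lee_fin ltW.
move=> i; rewrite -!EFinM lee_fin; have h := Hq n i.+1; rewrite -(ler_pM2l p0) in h.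
apply: (le_trans h); rewrite exprS.
by apply: ler_eq; ring.
Qed.

Lemma snorm_above_rvseq F al w : rvseq al w -> al < 0 ->
  exists2 C : R, 0 < C & forall n, (snorm F (above n (emb w)) <= (C * w n)%:E)%E.
Proof.
move=> hw al0; have al0' : 0 < - al by lra.
have [C C0 H] := snorm_below_rvseq F (rvseq_opp hw) al0'.
exists C => // n; rewrite snorm_above; last by apply: emb_ge0; case: hw.
by apply: (le_trans (H (- n))); rewrite opprK.
Qed.

(** Weighted by w, the i-th term of the series in [snorm_below_series] is at
    most C q^i times the shift by i of w x, whose norm does not depend on i. *)
Lemma hardy E F al w : rvseq al w -> al < 0 ->
  exists2 C : R, 0 < C & forall x, nonneg x ->
   (snorm E (smul w (fun n => snorm F (below n x))) <= C%:E * snorm E (smul w x))%E.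
Proof.
move=> hw al0; have al0' : 0 < - al by lra.
have [A [q [A0 q0 q1 Hq]]] := rvseq_decay (rvseq_inv hw) al0'.
have [w0 _] := hw; have p0 := phi_gt0 F.
exists (phi F * A * q / (1 - q)) => [|x x0].
  by rewrite divr_gt0 ?mulr_gt0 // subr_gt0.
have wx0 := smul_ge0 w0 x0.
pose u i n := smul w x (n - i.+1%:Z)%R.
pose z := smul w (fun n => snorm F (below n x)).
pose Y := snorm E (smul w x).
have Y0 : (0 <= Y)%E by exact: snorm_ge0.
have c0 : 0 <= phi F * A * q by rewrite ltW // !mulr_gt0.
have uY i : (snorm E (u i) <= Y)%E by rewrite (@snorm_shift R E (- i.+1%:Z)).
apply: (@snorm_geom E (phi F * A * q) q u z Y c0 (ltW q0) q1 _ _ _ uY Y0).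
- by move=> i n; exact: wx0.
- by apply: (smul_ge0 w0) => n; exact: snorm_ge0.
- move=> n; rewrite /z /u /smul.
  apply: (le_trans (lee_wpmul2l _ (snorm_below_series F n x0))); first by rewrite lee_fin ltW.
  rewrite -nneseriesZl; last by move=> i _; rewrite mule_ge0 // lee_fin ltW.
  apply: lee_nneseries => [i _|i _]; first by rewrite !mule_ge0 ?lee_fin ?(ltW (w0 _)) ?(ltW p0) //; exact: x0.
  rewrite !muleA -!EFinM lee_wpmul2r // lee_fin.
  have := Hq n i.+1; rewrite ler_pdivlMr // mulrC ler_pdivrMr // => h.
  apply: (@le_trans _ _ (phi F * (A * q ^+ i.+1 * w (n - i.+1%:Z)%R))).
    by rewrite mulrC ler_pM2l.
  by rewrite exprS le_eqVlt; apply/orP; left; apply/eqP; ring.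
Qed.

End Weights.

(** * The half of the Holmstedt functional attached to Y0 *)

Section Discrete.
Context {R : realType}.
Implicit Types (E F : ri_space R) (x y z g : int -> \bar R) (w v b r : int -> R).

Lemma snorm_le_scale E (c : R) x y : 0 < c -> nonneg x -> nonneg y ->
  (forall n, (x n <= c%:E * y n)%E) -> (snorm E x <= c%:E * snorm E y)%E.
Proof. by move=> c0 x0 y0 xy; rewrite -snormZr ?(ltW c0) //; exact: snorm_le. Qed.

Lemma snorm_below_le E n x v (c : \bar R) : (forall n, 0 < v n) -> nonneg x -> (0 <= c)%E ->
  (forall k, (x k <= (v k)%:E * c)%E) ->
  (snorm E (below n x) <= c * snorm E (below n (emb v)))%E.
Proof.
move=> v0 x0 c0 xv; rewrite -snormZ //; last exact/below_ge0/emb_ge0.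
apply: snorm_le => [|k]; first exact: below_ge0.
by rewrite /below; case: ifP => _; rewrite ?mule0 // muleC; exact: xv.
Qed.

(** The sequence form of the norm of b over (t, oo). *)
Definition tail_norm E b n : R := fine (snorm E (above n (emb b))).

Section Tail.
Variables (E : ri_space R) (b : int -> R).
Hypotheses (hb : rvseq 0 b) (fin0 : (snorm E (above 0 (emb b)) < +oo)%E).

Let b0 n : 0 < b n. Proof. by case: hb. Qed.
Let ab0 n : nonneg (above n (emb b)). Proof. exact/above_ge0/emb_ge0. Qed.

(** Shifting the half-line k > n to k > m multiplies b by at most
    C e^(eps |m - n|). *)
Lemma snorm_above_shift (e : R) : 0 < e -> exists2 C : R, 0 < C & forall m n : int,
  (snorm E (above m (emb b)) <=
   (C * expR (0 * (m - n)%:~R + e * `|(m - n)%:~R|))%:E * snorm E (above n (emb b)))%E.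
Proof.
move=> e0; have [_ hw] := hb; have [C C0 HC] := hw _ e0.
exists C => // m n; rewrite -(snorm_shift E (m - n)) //.
apply: snorm_le_scale; first by rewrite mulr_gt0 // expR_gt0.
- by move=> k; exact: ab0.
- exact: ab0.
move=> k; rewrite /above.
have -> : (m < k + (m - n))%R = (n < k)%R by lia.
case: ifP => _; last by rewrite mule0.
rewrite -EFinM lee_fin; apply: (le_trans (HC _ k)).
by have -> : k + (m - n) - k = m - n by lia.
Qed.

Lemma tailE n : snorm E (above n (emb b)) = (tail_norm E b n)%:E.
Proof.
rewrite fineK // ge0_fin_numE; last exact: snorm_ge0.
have [C C0 H] := snorm_above_shift ltr01.
apply: (le_lt_trans (H n 0)); move: fin0.
by case: (snorm E (above 0 (emb b))) (snorm_ge0 E (above 0 (emb b))) => // r _ _; rewrite -EFinM ltry.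
Qed.

Lemma tail_ge n : phi E * b (n + 1) <= tail_norm E b n.
Proof.
rewrite -lee_fin -tailE EFinM.
have -> : (b (n + 1))%:E = above n (emb b) (n + 1) by rewrite /above ltrDl ltr01.
exact: snorm_entry.
Qed.

Lemma tail_gt0 n : 0 < tail_norm E b n.
Proof. by apply: lt_le_trans (tail_ge n); rewrite mulr_gt0 // phi_gt0. Qed.

(** Norms over half-lines of slowly varying sequences are slowly varying. *)
Lemma rvseq_tail : rvseq 0 (tail_norm E b).
Proof.
split => [n|e e0]; first exact: tail_gt0.
have [C C0 H] := snorm_above_shift e0; exists C => // m n.
by have := H m n; rewrite !tailE -EFinM lee_fin.
Qed.

Lemma le_tail : exists2 C : R, 0 < C & forall n, b n <= C * tail_norm E b n.
Proof.
have [C C0 H] := rvseq_near hb; exists (C / phi E) => [|n].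
  by rewrite divr_gt0 // phi_gt0.
apply: (le_trans (H n (n + 1) _)); first lia.
rewrite -mulrA ler_pM2l // mulrC ler_pdivlMr ?phi_gt0 // mulrC; exact: tail_ge.
Qed.

End Tail.

(** Sequence forms of the functionals in the Holmstedt formula, with g standing
    for t^(-theta) a(t) K(t, f): [NL] and [NR] are the norms defining the two
    spaces of the couple, and [PL], [QL] are the parts of [NL] at the point n,
    namely the outer norm up to n, and the inner norm up to n times the norm of
    b beyond n. *)
Definition NL E F b g := snorm E (smul b (fun j => snorm F (below j g))).
Definition PL E F b n g := snorm E (below n (smul b (fun j => snorm F (below j g)))).
Definition QL E F b n g := ((tail_norm E b n)%:E * snorm F (below n g))%E.
Definition NR E F b g := snorm E (smul b (fun j => snorm F (above j g))).

Lemma smul_snorm_ge0 b F (h : int -> int -> \bar R) : (forall n, 0 < b n) ->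
  nonneg (smul b (fun j => snorm F (h j))).
Proof. by move=> b0; apply: smul_ge0 => // n; exact: snorm_ge0. Qed.

Lemma below_mono F m n g : nonneg g -> (m <= n)%R ->
  (snorm F (below m g) <= snorm F (below n g))%E.
Proof.
move=> g0 mn; apply: snorm_le => [|k]; first exact: below_ge0.
rewrite /below; case: ifP => km; case: ifP => kn //; lia.
Qed.

Section LeftPart.
Variables (E0 F0 : ri_space R) (b0 : int -> R).
Hypotheses (hb0 : rvseq 0 b0) (fin0 : (snorm E0 (above 0 (emb b0)) < +oo)%E).
Let b0_gt0 n : 0 < b0 n. Proof. by case: hb0. Qed.
Let be := tail_norm E0 b0.
Let s g n := snorm F0 (below n g).
Let bs0 g : nonneg (smul b0 (s g)). Proof. exact: smul_snorm_ge0. Qed.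
Let be_gt0 n : 0 < be n. Proof. exact: (tail_gt0 hb0 fin0). Qed.

Lemma PL_le_NL n g : (PL E0 F0 b0 n g <= NL E0 F0 b0 g)%E.
Proof.
apply: snorm_le => [|k]; first exact/below_ge0/bs0.
by rewrite /below; case: ifP => // _; exact: bs0.
Qed.

(** Beyond n the inner norm is at least its value at n. *)
Lemma QL_le_NL n g : nonneg g -> (QL E0 F0 b0 n g <= NL E0 F0 b0 g)%E.
Proof.
move=> g0; have ab0 := above_ge0 n (emb_ge0 b0_gt0).
rewrite /QL -(tailE hb0 fin0) muleC -(snormZ E0 (snorm_ge0 F0 _) ab0).
apply: snorm_le => k; first by rewrite mule_ge0 ?snorm_ge0 //; exact: ab0.
rewrite /above; case: ifP => nk; last by rewrite mule0; exact: bs0.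
rewrite muleC /smul; apply: lee_wpmul2l; first by rewrite lee_fin ltW.
by apply: below_mono => //; exact: ltW.
Qed.

(** Cross estimates: the left parts at n of r g are at most C rho n times the
    right-hand norm of g.  Here r is the quotient of the weights of the two
    spaces, and [rhoE] is the definition of rho. *)
Section Cross.
Variables (E1 F1 : ri_space R) (b1 r : int -> R) (be1 rho : int -> R) (de : R).
Hypotheses (b1_gt0 : forall n, 0 < b1 n) (be1_gt0 : forall n, 0 < be1 n).
Hypothesis be1E : forall n, snorm E1 (below n (emb b1)) = (be1 n)%:E.
Hypotheses (hrho : rvseq de rho) (de0 : 0 < de).
Hypothesis rhoE : forall n, rho n * be1 n = r n * be n.
Let p1 : 0 < phi F1. Proof. exact: phi_gt0. Qed.
Let rho0 n : 0 < rho n. Proof. by case: hrho. Qed.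

(** For j < k the inner norm of g above j is at least phi F1 times g k; take the
    outer norm over these j. *)
Lemma entry_le_NR k g : nonneg g ->
  ((phi F1 * be1 k)%:E * g k <= NR E1 F1 b1 g)%E.
Proof.
move=> g0; have bb0 := below_ge0 k (emb_ge0 b1_gt0).
have pg0 : (0 <= (phi F1)%:E * g k)%E by rewrite mule_ge0 // lee_fin ltW.
rewrite mulrC EFinM -muleA -be1E muleC -snormZ //.
have ag0 j : nonneg (above j g) by exact: above_ge0.
apply: snorm_le => j; first by rewrite mule_ge0 //; exact: bb0.
rewrite /below; case: ifP => jk; last by rewrite mule0; exact: smul_snorm_ge0.
rewrite muleC /smul; apply: lee_wpmul2l; first by rewrite lee_fin ltW.
have -> : g k = above j g k by rewrite /above jk.
exact: snorm_entry.
Qed.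

Let v n := (phi F1)^-1 * (rho n / be n).
Let v_gt0 n : 0 < v n.
Proof. by rewrite mulr_gt0 ?invr_gt0 // divr_gt0. Qed.

Lemma smul_le_NR k g : nonneg g ->
  (smul r g k <= (v k)%:E * NR E1 F1 b1 g)%E.
Proof.
move=> g0.
have rE : r k = v k * (phi F1 * be1 k).
  apply: (mulIf (lt0r_neq0 (be_gt0 k))); rewrite -rhoE /v.
  by field; rewrite !lt0r_neq0.
rewrite /smul rE EFinM -muleA; apply: lee_wpmul2l; first by rewrite lee_fin ltW.
exact: entry_le_NR.
Qed.

Lemma NR_ge0 E F b g : (0 <= NR E F b g)%E. Proof. exact: snorm_ge0. Qed.

(** Each entry of r g is at most v k times the norm of g, and v is regularly
    varying of positive index, so its norm below n is comparable to v n. *)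
Lemma snorm_below_NR : exists2 C : R, 0 < C & forall n g, nonneg g ->
  (snorm F0 (below n (smul r g)) <= (C * v n)%:E * NR E1 F1 b1 g)%E.
Proof.
have hv : rvseq de v.
  apply: rvseq_scale; first by rewrite invr_gt0.
  by apply: (rvseq_eq (rvseq_mul hrho (rvseq_inv (rvseq_tail hb0 fin0)))) => //; rewrite oppr0 addr0.
have [C C0 H] := snorm_below_rvseq F0 hv de0; exists C => // n g g0.
have r0 m : 0 < r m.
  have := mulr_gt0 (rho0 m) (be1_gt0 m); rewrite rhoE pmulr_lgt0 //; exact: be_gt0.
apply: (@le_trans _ _ (NR E1 F1 b1 g * snorm F0 (below n (emb v)))%E).
  apply: snorm_below_le => //; [exact: smul_ge0|exact: NR_ge0|].
  by move=> k; exact: smul_le_NR.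
by rewrite muleC; apply: lee_wpmul2r => //; exact: NR_ge0.
Qed.

Lemma QL_le_NR : exists2 C : R, 0 < C & forall n g, nonneg g ->
  (QL E0 F0 b0 n (smul r g) <= (C * rho n)%:E * NR E1 F1 b1 g)%E.
Proof.
have [C C0 H] := snorm_below_NR; exists (C / phi F1) => [|n g g0].
  by rewrite divr_gt0.
have -> : C / phi F1 * rho n = be n * (C * v n).
  by rewrite /v; field; rewrite !lt0r_neq0.
rewrite EFinM -muleA; apply: lee_wpmul2l; first by rewrite lee_fin ltW // be_gt0.
exact: H.
Qed.

(** The inner norms are at most C rho k / be k by [snorm_below_NR], and
    b0 k <= D be k, so the outer norm below n is that of the sequence rho, again
    comparable to its value at n. *)
Lemma PL_le_NR : exists2 C : R, 0 < C & forall n g, nonneg g ->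
  (PL E0 F0 b0 n (smul r g) <= (C * rho n)%:E * NR E1 F1 b1 g)%E.
Proof.
have [C C0 H] := snorm_below_NR.
have [D D0 HD] := le_tail hb0 fin0.
have [G G0 HG] := snorm_below_rvseq E0 hrho de0.
pose c := D * (C / phi F1).
have c0 : 0 < c by rewrite mulr_gt0 // divr_gt0.
exists (c * G) => [|n g g0]; first exact: mulr_gt0.
apply: (@le_trans _ _ ((c%:E * NR E1 F1 b1 g) * snorm E0 (below n (emb rho)))%E).
  apply: snorm_below_le => //; first exact: bs0.
    by rewrite mule_ge0 ?NR_ge0 // lee_fin ltW.
  move=> k; rewrite /smul muleA -EFinM.
  apply: (@le_trans _ _ ((b0 k)%:E * ((C * v k)%:E * NR E1 F1 b1 g))%E).
    by apply: lee_wpmul2l; [rewrite lee_fin ltW|exact: H].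
  rewrite muleA -EFinM; apply: lee_wpmul2r; first exact: NR_ge0.
  rewrite lee_fin; apply: (@le_trans _ _ (D * be k * (C * v k))).
    by rewrite ler_pM2r // mulr_gt0.
  by rewrite /v /c; apply: ler_eq; field; rewrite !lt0r_neq0.
apply: (@le_trans _ _ ((c%:E * NR E1 F1 b1 g) * (G * rho n)%:E)%E).
  by apply: lee_wpmul2l => //; rewrite mule_ge0 ?NR_ge0 // lee_fin ltW.
by rewrite muleAC -EFinM mulrA.
Qed.

End Cross.

Section Truncation.
Variables (w : int -> R) (th : R).
Hypotheses (hw : rvseq th w) (th0 : th < 0).
Let w_gt0 n : 0 < w n. Proof. by case: hw. Qed.

(** Truncating K at n.  Below n nothing changes, which gives [PL].  At j > n the
    inner norm is at most that of w K below n plus K n times the norm of w from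
    n on; as w has negative index the latter is comparable to w n K n, hence to
    one entry of the former.  So the inner norm stays constant up to a factor
    beyond n, and the outer norm gives [QL]. *)
Lemma NL_min : exists2 C : R, 0 < C & forall (n : int) K, nonneg K ->
  (forall k, (K k <= K (k + 1)%R)%E) -> (forall k, (K (k + 1)%R <= (expR 1)%:E * K k)%E) ->
  (NL E0 F0 b0 (smul w (fun k => K (Order.min k n))) <=
     C%:E * (PL E0 F0 b0 n (smul w K) + QL E0 F0 b0 n (smul w K)))%E.
Proof.
have [A A0 HA] := snorm_above_rvseq F0 hw th0.
have [D D0 HD] := le_tail hb0 fin0.
have p0 := phi_gt0 F0.
pose c := 1 + A * expR 1 / phi F0.
have c0 : 0 < c by rewrite ltr_wpDr // divr_ge0 ?mulr_ge0 ?expR_ge0 ?ltW.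
exists (1 + phi E0 * D + c) => [|n K K0 K1 K2].
  by rewrite ltr_wpDr ?(ltW c0) // ltr_wpDr // mulr_ge0 ?ltW // phi_gt0.
pose g := smul w K; pose h := smul w (fun k => K (Order.min k n)).
have g0 : nonneg g by exact: smul_ge0.
have h0 : nonneg h by apply: smul_ge0.
pose q := snorm F0 (below n g); have q0 : (0 <= q)%E by exact: snorm_ge0.
have hle j : (j <= n)%R -> snorm F0 (below j h) = s g j.
  move=> jn; apply: snorm_eq => k; rewrite /below; case: ifP => // kj.
  by rewrite /h /g /smul min_l //; lia.
(* The entry at n itself is not below n, so it is compared with the entry at
   n - 1. *)
have qK : (K n <= (expR 1 / (phi F0 * w (n - 1)))%:E * q)%E.
  have e : ((phi F0 * w (n - 1))%:E * K (n - 1)%R = (phi F0)%:E * below n g (n - 1)%R)%E.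
    by rewrite /below ltrBlDr ltrDl ltr01 /g /smul EFinM muleA.
  have := snorm_entry F0 (n - 1) (below_ge0 n g0); rewrite -e => hq.
  have pw0 : 0 < phi F0 * w (n - 1) by rewrite mulr_gt0.
  apply: (@le_trans _ _ ((expR 1)%:E * K (n - 1)%R)%E); first by have := K2 (n - 1); rewrite subrK.
  rewrite EFinM -muleA; apply: lee_wpmul2l; first by rewrite lee_fin expR_ge0.
  rewrite -[leLHS]mul1e -(mulVf (lt0r_neq0 pw0)) EFinM -muleA.
  by apply: lee_wpmul2l; [rewrite lee_fin invr_ge0 ltW|].
have hgt j : (n < j)%R -> (snorm F0 (below j h) <= c%:E * q)%E.
  move=> nj.
  apply: (@le_trans _ _ (q + K n * snorm F0 (above (n - 1) (emb w)))%E).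
    rewrite -snormZ; [|exact: K0|exact/above_ge0/emb_ge0].
    apply: le_trans (snormD F0 _ _); last 2 first.
    - exact: below_ge0.
    - by move=> k; rewrite mule_ge0 //; exact/above_ge0/emb_ge0.
    apply: snorm_le => k; first exact: below_ge0.
    rewrite /below /above; case: (ltP k n) => kn.
      have -> : (k < j)%R by lia.
      have -> : (n - 1 < k)%R = false by lia.
      by rewrite mule0 adde0 /h /g /smul min_l // ltW.
    have -> : (n - 1 < k)%R by lia.
    rewrite add0e /h /smul min_r // muleC; case: ifP => // _.
    by rewrite mule_ge0 // lee_fin ltW.
  rewrite /c EFinD ge0_muleDl // ?lee_fin ?divr_ge0 ?mulr_ge0 ?expR_ge0 ?(ltW A0) ?(ltW p0) //.
  rewrite mul1e; apply: leeD => //.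
  apply: (@le_trans _ _ (K n * (A * w (n - 1))%:E)%E); first exact: lee_wpmul2l.
  rewrite muleC; apply: (@le_trans _ _ ((A * w (n - 1))%:E * ((expR 1 / (phi F0 * w (n - 1)))%:E * q))%E).
    by apply: lee_wpmul2l => //; rewrite lee_fin mulr_ge0 ?ltW.
  rewrite muleA -EFinM; apply: lee_wpmul2r => //; rewrite lee_fin; apply: ler_eq.
  by field; rewrite !lt0r_neq0.
have tE := tailE hb0 fin0.
have ab0 := above_ge0 n (emb_ge0 b0_gt0).
pose P := below n (smul b0 (s g)).
have P0 : nonneg P by exact/below_ge0/bs0.
(* Three ranges of the outer index: k < n, k = n and k > n. *)
apply: (@le_trans _ _ (PL E0 F0 b0 n g + (((phi E0 * b0 n)%:E * q) + (c%:E * q) * snorm E0 (above n (emb b0))))%E).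
  have d0 : nonneg (fun k => (b0 n)%:E * q * delta n k)%E.
    by move=> k; rewrite !mule_ge0 // ?lee_fin ?(ltW (b0_gt0 _)) ?delta_ge0.
  have cq0 : (0 <= c%:E * q)%E by rewrite mule_ge0 // lee_fin ltW.
  have a0 : nonneg (fun k => (c%:E * q) * above n (emb b0) k)%E.
    by move=> k; rewrite mule_ge0 //; exact: ab0.
  rewrite -snormZ //.
  have -> : ((phi E0 * b0 n)%:E * q)%E = snorm E0 (fun k => (b0 n)%:E * q * delta n k)%E.
    rewrite snormZ ?phiE; [|by rewrite mule_ge0 // lee_fin ltW|exact: delta_ge0].
    by rewrite [RHS]muleC muleA -EFinM.
  apply: le_trans (leeD (lexx _) (snormD E0 d0 a0)).
  apply: le_trans (snormD E0 P0 _); last by move=> k; rewrite adde_ge0 ?d0 ?a0.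
  apply: snorm_le => k; first exact: smul_snorm_ge0.
  have -> : smul b0 (fun j => snorm F0 (below j h)) k = ((b0 k)%:E * snorm F0 (below k h))%E by [].
  have -> : P k = if (k < n)%R then ((b0 k)%:E * s g k)%E else 0%E by [].
  have -> : above n (emb b0) k = if (n < k)%R then (b0 k)%:E else 0%E by [].
  rewrite /delta; case: (ltgtP k n) => kn.
  - rewrite (hle _ (ltW kn)) 2!mule0 2!adde0; exact: lexx.
  - rewrite mule0 !add0e muleC; apply: lee_wpmul2r; first by rewrite lee_fin ltW.
    exact: hgt.
  - rewrite mule0 adde0 mule1 add0e kn (hle _ (lexx n)); exact: lexx.
rewrite tE.
have PL0 : (0 <= PL E0 F0 b0 n g)%E by exact: snorm_ge0.
have QL0 : (0 <= QL E0 F0 b0 n g)%E by rewrite mule_ge0 ?snorm_ge0 // lee_fin ltW // be_gt0.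
have h1 : ((phi E0 * b0 n)%:E * q <= (phi E0 * D)%:E * QL E0 F0 b0 n g)%E.
  rewrite /QL muleA -EFinM; apply: lee_wpmul2r => //.
  by rewrite lee_fin -mulrA ler_pM2l ?phi_gt0.
have h2 : (c%:E * q * (be n)%:E = c%:E * QL E0 F0 b0 n g)%E.
  by rewrite /QL -muleA [(q * _)%E]muleC.
have pD0 : 0 <= phi E0 * D by rewrite mulr_ge0 ?(ltW D0) // ltW // phi_gt0.
rewrite h2; apply: le_trans (leeD (lexx _) (leeD h1 (lexx _))) _.
rewrite -ge0_muleDl ?lee_fin ?(ltW c0) // -EFinD ge0_muleDr //.
apply: leeD; last by apply: lee_wpmul2r => //; rewrite lee_fin; lra.
by rewrite -[leLHS]mul1e; apply: lee_wpmul2r => //; rewrite lee_fin; lra.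
Qed.

End Truncation.

Section HardyPart.
Variables (E : ri_space R) (om : int -> R) (al : R).
Hypothesis hom : rvseq al om.
Let om_gt0 n : 0 < om n. Proof. by case: hom. Qed.

Lemma QL_hardy : al < 0 -> exists2 C : R, 0 < C & forall g, nonneg g ->
  (snorm E (smul om (fun n => QL E0 F0 b0 n g)) <=
     C%:E * snorm E (smul (fun n => om n * be n)%R g))%E.
Proof.
move=> al0.
have hw : rvseq al (fun n => om n * be n).
  by apply: (rvseq_eq (rvseq_mul hom (rvseq_tail hb0 fin0))) => //; rewrite addr0.
have [C C0 H] := hardy E F0 hw al0; exists C => // g g0.
rewrite (@snorm_eq _ _ _ (smul (fun n => om n * be n) (s g))); first exact: H.
by move=> n; rewrite /smul /QL muleA -EFinM.
Qed.

(** A first Hardy inequality removes the outer norm; as b0 n <= D be n, what is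
    left is [QL]. *)
Lemma PL_hardy : al < 0 -> exists2 C : R, 0 < C & forall g, nonneg g ->
  (snorm E (smul om (fun n => PL E0 F0 b0 n g)) <=
     C%:E * snorm E (smul (fun n => om n * be n)%R g))%E.
Proof.
move=> al0; have [C C0 H] := hardy E E0 hom al0.
have [D D0 HD] := le_tail hb0 fin0; have [G G0 HG] := QL_hardy al0.
exists (C * D * G) => [|g g0]; first by rewrite !mulr_gt0.
apply: (le_trans (H _ (bs0 g))).
rewrite -mulrA EFinM -muleA; apply: lee_wpmul2l; first by rewrite lee_fin ltW.
apply: (@le_trans _ _ (D%:E * snorm E (smul om (fun n => QL E0 F0 b0 n g)))%E).
  have Q0 : nonneg (fun n => QL E0 F0 b0 n g).
    by move=> n; rewrite mule_ge0 ?snorm_ge0 // lee_fin ltW // be_gt0.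
  apply: snorm_le_scale => // [||n]; [exact/smul_ge0/bs0|exact: smul_ge0|].
  rewrite /smul [leRHS]muleCA; apply: lee_wpmul2l; first by rewrite lee_fin ltW.
  rewrite /QL muleA -EFinM; apply: lee_wpmul2r; first exact: snorm_ge0.
  by rewrite lee_fin.
by rewrite EFinM -muleA; apply: lee_wpmul2l; [rewrite lee_fin ltW|exact: HG].
Qed.

(** The inner norm below n dominates the entry at n - 1, which is comparable to
    g n. *)
Lemma le_QL (c : R) g : 0 < c -> nonneg g ->
  (forall n, (g n <= c%:E * g (n - 1)%R)%E) ->
  (snorm E (smul (fun n => om n * be n)%R g) <=
     (c / phi F0)%:E * snorm E (smul om (fun n => QL E0 F0 b0 n g)))%E.
Proof.
move=> c0 g0 hg; have p0 := phi_gt0 F0.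
have Q0 : nonneg (fun n => QL E0 F0 b0 n g).
  by move=> n; rewrite mule_ge0 ?snorm_ge0 // lee_fin ltW // be_gt0.
have ob0 n : 0 < om n * be n by rewrite mulr_gt0.
have hs n : (g n <= (c / phi F0)%:E * s g n)%E.
  have h := snorm_entry F0 (n - 1) (below_ge0 n g0).
  have e : below n g (n - 1) = g (n - 1) by rewrite /below ltrBlDr ltrDl ltr01.
  rewrite e in h; apply: (le_trans (hg n)); rewrite EFinM -muleA.
  apply: lee_wpmul2l; first by rewrite lee_fin ltW.
  apply: (@le_trans _ _ ((phi F0)^-1%:E * ((phi F0)%:E * g (n - 1)%R))%E).
    by rewrite muleA -EFinM mulVf ?mul1e // lt0r_neq0.
  by apply: lee_wpmul2l; [rewrite lee_fin invr_ge0 ltW|exact: h].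
have cp0 : 0 < c / phi F0 by exact: divr_gt0.
apply: (snorm_le_scale E cp0 (smul_ge0 ob0 g0) (smul_ge0 om_gt0 Q0)) => n.
rewrite /smul [leRHS]muleCA /QL -/be.
have := hs n; rewrite /s.
set y := snorm F0 _; set z := g n; set cp := c / _ => h.
have -> : ((om n)%:E * (cp%:E * ((be n)%:E * y)) = (om n * be n)%:E * (cp%:E * y))%E.
  by rewrite (EFinM (om n)) -!muleA; congr (_ * _)%E; exact: muleCA.
by apply: lee_wpmul2l; [rewrite lee_fin ltW|exact: h].
Qed.

End HardyPart.

End LeftPart.
End Discrete.

(** * From functions to sequences *)

Section Transfer.
Context {R : realType}.
Implicit Types (E F : ri_space R) (x y z : int -> \bar R) (w v : int -> R).
Implicit Types (g h : R -> \bar R) (a : R -> R).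

Definition expz (n : int) : R := expR n%:~R.
Definition cell_of (t : R) : int := Num.floor (ln t).

Lemma cell_of_itv (t : R) : 0 < t -> expz (cell_of t) <= t < expz (cell_of t + 1).
Proof.
move=> t0; have := @cellE R (cell_of t) => e.
have : cell (cell_of t) t by split => //; rewrite /posline /= in_itv /= andbT.
by rewrite e /= in_itv.
Qed.

Lemma cell_of_expz n : cell_of (expz n) = n.
Proof. by rewrite /cell_of expRK; apply: floor_def; rewrite lexx ltr_int; lia. Qed.

Lemma expz_gt0 n : 0 < expz n. Proof. exact: expR_gt0. Qed.

Lemma cell_of_lt (s t : R) : 0 < s -> 0 < t -> (cell_of s < cell_of t)%R -> s < t.
Proof.
move=> s0 t0 st; have /andP[_ h1] := cell_of_itv s0; have /andP[h2 _] := cell_of_itv t0.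
apply: lt_le_trans h1 _; apply: le_trans h2.
by rewrite /expz ler_expR ler_int; lia.
Qed.

Lemma ln_cell_of (t : R) : `|ln t - (cell_of t)%:~R| <= 1.
Proof.
have /andP[h1 h2] := floor_itv (ln t); rewrite -/(cell_of t) in h1 h2.
rewrite intrD in h2; rewrite ger0_norm; lra.
Qed.

(** The link between functions and sequences: this comparability is inherited by
    products with weights and by norms over half-lines, and it makes the norms
    comparable in the end. *)
Definition sampled (c : R) g x := forall t, 0 < t ->
  (g t <= c%:E * x (cell_of t))%E /\ (x (cell_of t) <= c%:E * g t)%E.

Lemma le_inv_scale (c : R) (u v : \bar R) : 0 < c -> (u <= c%:E * v)%E ->
  (c^-1%:E * u <= v)%E.
Proof.
move=> c0 h; apply: (@le_trans _ _ (c^-1%:E * (c%:E * v))%E).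
  by apply: lee_wpmul2l; [rewrite lee_fin invr_ge0 ltW|exact: h].
by rewrite muleA -EFinM mulVf ?mul1e // lt0r_neq0.
Qed.

Lemma le_inv_scaleV (c : R) (u v : \bar R) : 0 < c -> (c^-1%:E * u <= v)%E ->
  (u <= c%:E * v)%E.
Proof.
move=> c0 h; apply: (@le_trans _ _ (c%:E * (c^-1%:E * u))%E).
  by rewrite muleA -EFinM mulfV ?mul1e // lt0r_neq0.
by apply: lee_wpmul2l; [rewrite lee_fin ltW|exact: h].
Qed.

Lemma tnorm_le_step E (c : R) g x : 0 < c -> nonneg x ->
  (forall t, 0 < t -> (0 <= g t)%E) ->
  (forall t, 0 < t -> (g t <= c%:E * x (cell_of t))%E) ->
  (tnorm E g <= c%:E * snorm E x)%E.
Proof.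
move=> c0 x0 g0 gx; rewrite -(snormZr E (ltW c0) x0).
Transparent snorm.
apply: tnorm_le => t t0.
Opaque snorm.
have cx : (0 <= c%:E * x (cell_of t))%E by apply: mule_ge0; [rewrite lee_fin ltW|exact: x0].
rewrite (gee0_abs (g0 _ t0)) (gee0_abs cx); exact: gx.
Qed.

Lemma step_le_tnorm E (c : R) g x : 0 < c -> nonneg x ->
  (forall t, 0 < t -> (x (cell_of t) <= c%:E * g t)%E) ->
  (snorm E x <= c%:E * tnorm E g)%E.
Proof.
move=> c0 x0 xg; apply: le_inv_scaleV => //.
have ci : 0 <= c^-1 by rewrite invr_ge0 ltW.
rewrite -(snormZr E ci x0).
Transparent snorm.
apply: tnorm_le => t t0.
Opaque snorm.
have h := le_inv_scale c0 (xg t t0).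
have p0 : (0 <= c^-1%:E * x (cell_of t))%E by apply: mule_ge0; [rewrite lee_fin|exact: x0].
rewrite (gee0_abs p0) (gee0_abs (le_trans p0 h)); exact: h.
Qed.

Lemma tnorm_sampled E (c : R) g x : 0 < c -> nonneg x ->
  (forall t, 0 < t -> (0 <= g t)%E) -> sampled c g x ->
  (tnorm E g <= c%:E * snorm E x)%E /\ (snorm E x <= c%:E * tnorm E g)%E.
Proof.
move=> c0 x0 g0 s; split.
  by apply: tnorm_le_step => // t t0; have [] := s t t0.
by apply: step_le_tnorm => // t t0; have [] := s t t0.
Qed.

(** One-sided forms of slow variation on consecutive terms.  They make up for
    the fact that a half-line in t starts in the middle of a cell. *)
Definition upreg (d : R) x := forall n, (x (n + 1)%R <= d%:E * x n)%E.
Definition dnreg (d : R) x := forall n, (x n <= d%:E * x (n + 1)%R)%E.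

Lemma patch_in (A : set R) g t : A t -> (g \_ A) t = g t.
Proof. by move=> At; rewrite /patch mem_set. Qed.
Lemma patch_out (A : set R) g t : ~ A t -> (g \_ A) t = 0%E.
Proof. by move=> At; rewrite /patch memNset. Qed.
Lemma patch_ge0 (A : set R) g t : (0 <= g t)%E -> (0 <= (g \_ A) t)%E.
Proof. by rewrite /patch; case: ifP. Qed.

(** The interval (0, t) meets the cell of t, which the sequence form leaves out.
    Shifting x by one step covers this cell too, and since x grows by at most a
    factor d from one term to the next, the shift costs a factor d. *)
Lemma sampled_below F (c d : R) g x : 0 < c -> 1 <= d -> nonneg x ->
  (forall t, 0 < t -> (0 <= g t)%E) -> sampled c g x -> upreg d x ->
  sampled (c * d) (fun t => tnorm_on F `]0, t[ g) (fun n => snorm F (below n x)).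
Proof.
move=> c0 d1 x0 g0 s u t t0; have d0 : 0 < d by lra.
have cd0 : 0 < c * d by exact: mulr_gt0.
have b0 := below_ge0 (cell_of t) x0.
split.
  have b0' : nonneg (fun k => below (cell_of t) x (k + -1)) by move=> k; exact: b0.
  rewrite -(snorm_shift F (-1) b0); apply: tnorm_le_step => // r r0.
    by apply: patch_ge0; exact: g0.
  have [rt|rt] := pselect (`]0, t[%classic r); last first.
    rewrite patch_out //; apply: mule_ge0; [by rewrite lee_fin ltW|exact: b0'].
  rewrite patch_in //; have [h _] := s r r0; apply: (le_trans h).
  rewrite EFinM -muleA; apply: lee_wpmul2l; first by rewrite lee_fin ltW.
  have -> : below (cell_of t) x (cell_of r + -1) = x (cell_of r - 1).
    rewrite /below; case: ltP => // h'; exfalso.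
    have : t < r by apply: cell_of_lt => //; lia.
    by move: rt; rewrite /= in_itv /= => /andP[_]; lra.
  by have := u (cell_of r - 1); rewrite subrK.
apply: (@le_trans _ _ (c%:E * tnorm_on F `]0%R, t[ g)%E); last first.
  apply: lee_wpmul2r; first exact: tnorm_ge0.
  by rewrite lee_fin ler_peMr // ltW.
apply: step_le_tnorm => // r r0; rewrite /below; case: ltP => rt; last first.
  by apply: mule_ge0; [rewrite lee_fin ltW|apply: patch_ge0; exact: g0].
rewrite patch_in; first by have [] := s r r0.
by rewrite /= in_itv /= r0 cell_of_lt.
Qed.

Lemma sampled_above F (c d : R) g x : 0 < c -> 1 <= d -> nonneg x ->
  (forall t, 0 < t -> (0 <= g t)%E) -> sampled c g x -> dnreg d x ->
  sampled (c * d) (fun t => tnorm_on F `]t, +oo[ g) (fun n => snorm F (above n x)).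
Proof.
move=> c0 d1 x0 g0 s u t t0; have d0 : 0 < d by lra.
have cd0 : 0 < c * d by exact: mulr_gt0.
have b0 := above_ge0 (cell_of t) x0.
split.
  have b0' : nonneg (fun k => above (cell_of t) x (k + 1)) by move=> k; exact: b0.
  rewrite -(snorm_shift F 1 b0); apply: tnorm_le_step => // r r0.
    by apply: patch_ge0; exact: g0.
  have [rt|rt] := pselect (`]t, +oo[%classic r); last first.
    rewrite patch_out //; apply: mule_ge0; [by rewrite lee_fin ltW|exact: b0'].
  rewrite patch_in //; have [h _] := s r r0; apply: (le_trans h).
  rewrite EFinM -muleA; apply: lee_wpmul2l; first by rewrite lee_fin ltW.
  have -> : above (cell_of t) x (cell_of r + 1) = x (cell_of r + 1).
    rewrite /above; case: ltP => // h'; exfalso.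
    have : r < t by apply: cell_of_lt => //; lia.
    by move: rt; rewrite /= in_itv /= andbT; lra.
  exact: u.
apply: (@le_trans _ _ (c%:E * tnorm_on F `]t, +oo[ g)%E); last first.
  apply: lee_wpmul2r; first exact: tnorm_ge0.
  by rewrite lee_fin ler_peMr // ltW.
apply: step_le_tnorm => // r r0; rewrite /above; case: ltP => rt; last first.
  by apply: mule_ge0; [rewrite lee_fin ltW|apply: patch_ge0; exact: g0].
rewrite patch_in; first by have [] := s r r0.
by rewrite /= in_itv /= andbT cell_of_lt.
Qed.

Lemma upreg_below F (d : R) x : 0 < d -> nonneg x -> upreg d x ->
  upreg d (fun n => snorm F (below n x)).
Proof.
move=> d0 x0 u n; have b0 := below_ge0 n x0.
rewrite -(snorm_shift F (-1) b0); apply: snorm_le_scale => //.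
  exact: below_ge0.
move=> k; rewrite /below.
have -> : (k < n + 1)%R = (k + -1 < n)%R by lia.
case: ifP => _; last by rewrite mule0.
by have := u (k - 1); rewrite subrK.
Qed.

Lemma dnreg_above F (d : R) x : 0 < d -> nonneg x -> dnreg d x ->
  dnreg d (fun n => snorm F (above n x)).
Proof.
move=> d0 x0 u n; have b0 := above_ge0 (n + 1) x0.
rewrite -(snorm_shift F 1 b0); apply: snorm_le_scale => //.
  exact: above_ge0.
move=> k; rewrite /above.
have -> : (n < k)%R = (n + 1 < k + 1)%R by lia.
case: ifP => _; last by rewrite mule0.
exact: u.
Qed.

Lemma upreg_smul (D d : R) v x : (forall n, 0 < v n) -> nonneg x -> 0 <= d ->
  (forall n, v (n + 1) <= D * v n) -> upreg d x -> upreg (D * d) (smul v x).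
Proof.
move=> v0 x0 d0 hv u n; rewrite /smul.
apply: (@le_trans _ _ ((v (n + 1)%R)%:E * (d%:E * x n))%E).
  by apply: lee_wpmul2l; [rewrite lee_fin ltW|exact: u].
rewrite muleA -EFinM [leRHS]muleA -EFinM; apply: lee_wpmul2r; first exact: x0.
rewrite lee_fin mulrAC; apply: ler_wpM2r => //; exact: hv.
Qed.

Lemma dnreg_smul (D d : R) v x : (forall n, 0 < v n) -> nonneg x -> 0 <= d ->
  (forall n, v n <= D * v (n + 1)) -> dnreg d x -> dnreg (D * d) (smul v x).
Proof.
move=> v0 x0 d0 hv u n; rewrite /smul.
apply: (@le_trans _ _ ((v n)%:E * (d%:E * x (n + 1)%R))%E).
  by apply: lee_wpmul2l; [rewrite lee_fin ltW|exact: u].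
rewrite muleA -EFinM [leRHS]muleA -EFinM; apply: lee_wpmul2r; first exact: x0.
rewrite lee_fin mulrAC; apply: ler_wpM2r => //; exact: hv.
Qed.

(** The same for positive real-valued weights. *)
Definition rsampled a v := [/\ forall t, 0 < t -> 0 < a t, forall n, 0 < v n &
  exists2 c : R, 0 < c & forall t, 0 < t -> a t <= c * v (cell_of t) /\ v (cell_of t) <= c * a t].

Lemma rsampled_mul a v a' v' : rsampled a v -> rsampled a' v' ->
  rsampled (fun t => a t * a' t) (fun n => v n * v' n).
Proof.
move=> [a0 v0 [c c0 H]] [a0' v0' [c' c0' H']]; split.
- by move=> t t0; rewrite mulr_gt0 ?a0 ?a0'.
- by move=> n; rewrite mulr_gt0.
exists (c * c') => [|t t0]; first exact: mulr_gt0.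
have [h1 h2] := H t t0; have [h1' h2'] := H' t t0.
have [q q'] := (ltW (a0 t t0), ltW (a0' t t0)).
have [r r'] := (ltW (v0 (cell_of t)), ltW (v0' (cell_of t))).
by split; rewrite mulrACA; apply: ler_pM.
Qed.

Lemma rsampled_inv a v : rsampled a v -> rsampled (fun t => (a t)^-1) (fun n => (v n)^-1).
Proof.
move=> [a0 v0 [c c0 H]]; split.
- by move=> t t0; rewrite invr_gt0 a0.
- by move=> n; rewrite invr_gt0.
exists c => // t t0; have [h1 h2] := H t t0; have q := a0 t t0; have r := v0 (cell_of t).
by split; rewrite ler_pdivlMr // mulrC ler_pdivrMr.
Qed.

Lemma rsampled_powR a v (p : R) : rsampled a v -> rsampled (fun t => a t `^ p) (fun n => v n `^ p).
Proof.
have pos b u (q : R) : 0 <= q -> rsampled b u -> rsampled (fun t => b t `^ q) (fun n => u n `^ q).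
  move=> q0 [b0 u0 [c c0 H]]; split.
  - by move=> t t0; rewrite powR_gt0 ?b0.
  - by move=> n; rewrite powR_gt0.
  exists (c `^ q) => [|t t0]; first exact: powR_gt0.
  have [h1 h2] := H t t0; have r := ltW (b0 t t0); have r' := ltW (u0 (cell_of t)).
  by split; rewrite -powRM ?(ltW c0) //; apply: ge0_ler_powR;
    rewrite ?nnegrE // mulr_ge0 // ltW.
have [p0|p0] := leP 0 p; first exact: pos.
move=> h; have p0' : 0 <= - p by lra.
have [a0 v0 _] := h.
have [A V [c c0 H]] := pos _ _ _ p0' (rsampled_inv h).
have e (y : R) : 0 < y -> y^-1 `^ (- p) = y `^ p.
  by move=> y0; rewrite -powR_inv1 ?(ltW y0) // -powRrM mulN1r opprK.
split.
- by move=> t t0; rewrite powR_gt0 ?a0.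
- by move=> n; rewrite powR_gt0.
exists c => // t t0; have := H t t0; rewrite !e //; exact: a0.
Qed.

Lemma sampled_wmul a v : rsampled a v -> exists2 c : R, 0 < c & forall (d : R) g x,
  0 < d -> nonneg x -> (forall t, 0 < t -> (0 <= g t)%E) -> sampled d g x ->
  sampled (c * d) (wmul a g) (smul v x).
Proof.
move=> [a0 v0 [c c0 H]]; exists c => // d g x d0 x0 g0 s t t0.
have [h1 h2] := H t t0; have [k1 k2] := s t t0; rewrite /wmul /smul.
split; rewrite EFinM muleACA; apply: lee_pmul;
  rewrite -?EFinM ?lee_fin ?(ltW (a0 _ t0)) ?(ltW (v0 _)) //; exact: g0.
Qed.

(** Regularly varying functions of index al: [rvseq] in the variable ln t. *)
Definition rvfun (al : R) a := (forall t, 0 < t -> 0 < a t) /\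
  forall e : R, 0 < e -> exists2 C : R, 0 < C & forall s t, 0 < s -> 0 < t ->
    a t <= C * expR (al * (ln t - ln s) + e * `|ln t - ln s|) * a s.

(** Use the monotone equivalent of t^eps a(t) if t <= s, and that of
    t^(-eps) a(t) if s <= t. *)
Lemma rvfun_sv a : slowly_varying a -> rvfun 0 a.
Proof.
move=> [_ apos H].
have pp (t : R) : 0 < t -> posline t by move=> t0; rewrite /posline /= in_itv /= andbT.
split => [t /pp|e e0]; first exact: apos.
have [[g gnd [c [C [c0 C0 Hg]]]] [h hni [c' [C' [c0' C0' Hh]]]]] := H e e0.
exists (C / c + C' / c') => [|s t s0 t0]; first by rewrite addr_gt0 // divr_gt0.
have pE r (p : R) : 0 < r -> r `^ p = expR (p * ln r) by move=> r0; rewrite /powR gt_eqF.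
rewrite mul0r add0r.
have as0 := apos s (pp _ s0); have at0 := apos t (pp _ t0).
have D0 : 0 < C / c by exact: divr_gt0.
have D0' : 0 < C' / c' by exact: divr_gt0.
have [ts|st] := leP t s.
  have [_ u1] := Hg t (pp _ t0); have [u2 _] := Hg s (pp _ s0).
  have m := gnd t s (pp _ t0) (pp _ s0) ts.
  have l1 : expR (e * ln t) * a t <= C / c * (expR (e * ln s) * a s).
    rewrite -!pE //; apply: (le_trans u1); rewrite -mulrA ler_pM2l // mulrC ler_pdivlMr // mulrC.
    by apply: le_trans u2; rewrite ler_pM2l.
  have lts : ln t <= ln s by rewrite ler_ln ?posrE.
  rewrite ler0_norm ?subr_le0 // opprB mulrBr expRB.
  rewrite -(ler_pM2l (expR_gt0 (e * ln t))); apply: (le_trans l1).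
  have -> : expR (e * ln t) * ((C / c + C' / c') * (expR (e * ln s) / expR (e * ln t)) * a s) =
      (C / c + C' / c') * (expR (e * ln s) * a s).
    have n0 := lt0r_neq0 (expR_gt0 (e * ln t)).
    by set q := expR (e * ln t) in n0 *; set p := C / c + _; field.
  by apply: ler_wpM2r; [rewrite mulr_ge0 ?expR_ge0 // ltW|lra].
have [_ u1] := Hh t (pp _ t0); have [u2 _] := Hh s (pp _ s0).
have m := hni s t (pp _ s0) (pp _ t0) (ltW st).
have l1 : expR (- e * ln t) * a t <= C' / c' * (expR (- e * ln s) * a s).
  rewrite -!pE //; apply: (le_trans u1); rewrite -mulrA ler_pM2l // mulrC ler_pdivlMr // mulrC.
  by apply: le_trans u2; rewrite ler_pM2l.
have lts : ln s <= ln t by rewrite ler_ln ?posrE // ltW.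
rewrite ger0_norm ?subr_ge0 // mulrBr expRB.
rewrite -(ler_pM2l (expR_gt0 (- e * ln t))); apply: (le_trans l1).
rewrite !mulNr !expRN.
have -> : (expR (e * ln t))^-1 * ((C / c + C' / c') * (expR (e * ln t) / expR (e * ln s)) * a s) =
    (C / c + C' / c') * ((expR (e * ln s))^-1 * a s).
  have n0 := lt0r_neq0 (expR_gt0 (e * ln t)); have n1 := lt0r_neq0 (expR_gt0 (e * ln s)).
  set q := expR (e * ln t) in n0 *; set q' := expR (e * ln s) in n1 *.
  by set p := C / c + _; field; rewrite n0 n1.
by apply: ler_wpM2r; [rewrite mulr_ge0 ?invr_ge0 ?expR_ge0 // ltW|lra].
Qed.

Lemma rvfun_pow (al : R) : rvfun al (fun t => t `^ al).
Proof.
split => [t t0|e e0]; first exact: powR_gt0.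
exists 1 => // s t s0 t0; rewrite mul1r /powR !gt_eqF // -expRD ler_expR.
have : 0 <= e * `|ln t - ln s| by rewrite mulr_ge0 // ltW.
set q := e * _; lra.
Qed.

Lemma rvfun_mul al be a a' : rvfun al a -> rvfun be a' -> rvfun (al + be) (fun t => a t * a' t).
Proof.
move=> [w0 hw] [v0 hv]; split => [t t0|e e0]; first by rewrite mulr_gt0 ?w0 ?v0.
have e2 : 0 < e / 2 by lra.
have [C C0 HC] := hw _ e2; have [D D0 HD] := hv _ e2.
exists (C * D) => [|s t s0 t0]; first exact: mulr_gt0.
apply: (le_trans (ler_pM (ltW (w0 t t0)) (ltW (v0 t t0)) (HC s t s0 t0) (HD s t s0 t0))).
set r := ln t - ln s; set q := `|r|.
have -> : (al + be) * r + e * q = (al * r + e / 2 * q) + (be * r + e / 2 * q) by field.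
rewrite [expR (_ + (be * _ + _))]expRD; apply: ler_eq.
set p1 := expR _; set p2 := expR _; ring.
Qed.

Lemma rvfun_near al a : rvfun al a -> forall L : R, exists2 C : R, 0 < C & forall s t,
  0 < s -> 0 < t -> `|ln t - ln s| <= L -> a t <= C * a s.
Proof.
move=> [a0 ha] L; have [C C0 HC] := ha _ ltr01.
exists (C * expR ((`|al| + 1) * L)) => [|s t s0 t0 ts]; first by rewrite mulr_gt0 // expR_gt0.
apply: (le_trans (HC s t s0 t0)); rewrite ler_pM2r ?a0 // ler_pM2l // ler_expR.
set r := ln t - ln s in ts *.
have h : al * r <= `|al| * `|r| by rewrite -normrM; exact: ler_norm.
apply: (@le_trans _ _ ((`|al| + 1) * `|r|)); first by rewrite mulrDl mul1r; lra.
by apply: ler_wpM2l => //; rewrite addr_ge0.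
Qed.

Lemma rvfun_sampled al a : rvfun al a -> rsampled a (fun n => a (expz n)).
Proof.
move=> h; have [a0 _] := h; split => // [n|]; first exact/a0/expz_gt0.
have [C C0 HC] := rvfun_near h 1; exists C => // t t0; have := ln_cell_of t => lb.
split; apply: HC; rewrite ?expz_gt0 // /expz expRK //.
by rewrite distrC.
Qed.

Lemma rvfun_rvseq al a : rvfun al a -> rvseq al (fun n => a (expz n)).
Proof.
move=> [a0 ha]; split => [n|e e0]; first exact/a0/expz_gt0.
have [C C0 HC] := ha _ e0; exists C => // m n.
by have := HC (expz n) (expz m) (expz_gt0 _) (expz_gt0 _); rewrite /expz !expRK -intrB.
Qed.

Lemma ln_ratio (c s t : R) : 0 < s -> 0 < t -> 0 < c -> s <= c * t -> t <= c * s ->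
  `|ln t - ln s| <= ln c.
Proof.
move=> s0 t0 c0 st ts.
rewrite ler_norml; apply/andP; split.
  rewrite lerBrDl lerBlDl -lnM ?posrE // ler_ln ?posrE ?mulr_gt0 //.
by rewrite lerBlDr -lnM ?posrE // ler_ln ?posrE ?mulr_gt0.
Qed.

Lemma rsampled_comp a v (h : R -> R) : rvfun 0 h -> rsampled a v ->
  rsampled (fun t => h (a t)) (fun n => h (v n)).
Proof.
move=> hh [a0 v0 [c c0 H]]; have [h0 _] := hh; split => [t /a0|n|].
- exact: h0.
- exact/h0/v0.
have [C C0 HC] := rvfun_near hh (ln c); exists C => // t t0.
have [h1 h2] := H t t0; have q := a0 t t0; have r := v0 (cell_of t).
by split; apply: HC => //; apply: ln_ratio.
Qed.

Lemma rvseq_ln al v : rvseq al v -> exists2 C : R, 0 <= C & forall m n : int,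
  `|ln (v m) - ln (v n)| <= C + (`|al| + 1) * `|(m - n)%:~R|.
Proof.
move=> [v0 hv]; have [C C0 HC] := hv _ ltr01.
exists `|ln C| => // m n.
have key k l : ln (v k) - ln (v l) <= `|ln C| + (`|al| + 1) * `|(k - l)%:~R|.
  have := HC k l; rewrite -ler_ln ?posrE ?mulr_gt0 ?expR_gt0 //.
  rewrite !lnM ?posrE ?mulr_gt0 ?expR_gt0 // expRK.
  set r := (k - l)%:~R => h.
  have q : al * r <= `|al| * `|r| by rewrite -normrM; exact: ler_norm.
  have q' := ler_norm (ln C); rewrite mulrDl; lra.
rewrite ler_norml; apply/andP; split; last exact: key.
have := key n m; have -> : (n - m)%:~R = - (m - n)%:~R :> R by rewrite -mulrNz opprB.
rewrite normrN; lra.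
Qed.

Lemma rvseq_comp al v (h : R -> R) : rvfun 0 h -> rvseq al v -> rvseq 0 (fun n => h (v n)).
Proof.
move=> [h0 hh] hv; have [v0 _] := hv; split => [n|e e0]; first exact/h0/v0.
have [L L0 HL] := rvseq_ln hv.
have k0 : 0 < `|al| + 1 by rewrite ltr_wpDl.
have e0' : 0 < e / (`|al| + 1) by exact: divr_gt0.
have [C C0 HC] := hh _ e0'.
exists (C * expR (e / (`|al| + 1) * L)) => [|m n]; first by rewrite mulr_gt0 // expR_gt0.
apply: (le_trans (HC _ _ (v0 n) (v0 m))).
rewrite ler_pM2r; last exact/h0/v0.
rewrite -[leRHS]mulrA ler_pM2l // -expRD ler_expR !mul0r !add0r.
have -> : e / (`|al| + 1) * L + e * `|(m - n)%:~R| =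
   e / (`|al| + 1) * (L + (`|al| + 1) * `|(m - n)%:~R|) by field; exact: lt0r_neq0.
by rewrite ler_pM2l.
Qed.

(** The inequality of [rvseq] from k to l with eps = al / 2, in logarithms. *)
Lemma rvseq_growth al v : 0 < al -> rvseq al v -> exists2 A : R, 0 <= A & forall k l : int,
  (l <= k)%R -> al / 2 * (k - l)%:~R - A <= ln (v k) - ln (v l).
Proof.
move=> al0 [v0 hv]; have e0 : 0 < al / 2 by lra.
have [C C0 HC] := hv _ e0; exists `|ln C| => // k l lk.
have := HC l k; rewrite -ler_ln ?posrE ?mulr_gt0 ?expR_gt0 //.
rewrite !lnM ?posrE ?mulr_gt0 ?expR_gt0 // expRK.
have -> : (l - k)%:~R = - (k - l)%:~R :> R by rewrite -mulrNz opprB.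
rewrite normrN (ger0_norm (_ : 0 <= (k - l)%:~R)); last by rewrite ler0z subr_ge0.
have := ler_norm (ln C); set r := (k - l)%:~R; lra.
Qed.

Lemma intr_absz (k : int) : (`|k|%N)%:R = `|k%:~R| :> R.
Proof. by rewrite -intr_norm -abszE. Qed.

Lemma subz_succ (k : int) (i : nat) : k + i.+1%:Z - (k + i%:Z) = 1.
Proof. lia. Qed.

(** The sequence ln (v n) tends to -oo and +oo, and its steps are bounded; take
    the n just before it first passes m. *)
Lemma rvseq_cover al v : 0 < al -> rvseq al v -> exists D : R, forall m : R, exists n : int,
  ln (v n) <= m <= ln (v n) + D.
Proof.
move=> al0 hv; have [A A0 HA] := rvseq_growth al0 hv; have [B B0 HB] := rvseq_ln hv.
exists (B + (`|al| + 1)) => m.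
have e0 : 0 < al / 2 by lra.
have [N hN] : exists N : nat, `|m| + `|ln (v 0)| + A < al / 2 * N%:R.
  exists (Num.truncn ((`|m| + `|ln (v 0)| + A) / (al / 2))).+1.
  by rewrite mulrC -ltr_pdivrMr // truncnS_gt.
have normN (y : R) : - y <= `|y| by rewrite -normrN; exact: ler_norm.
have m1 := ler_norm m; have m2 := normN m.
have v1 := ler_norm (ln (v 0)); have v2 := normN (ln (v 0)).
have lo : ln (v (- N%:Z)) <= m.
  have := HA 0 (- N%:Z); rewrite oppr_le0 => /(_ erefl); rewrite sub0r opprK => h.
  have {}h : al / 2 * N%:R - A <= ln (v 0) - ln (v (- N%:Z)) by exact: h.
  move: h hN; set q := al / 2 * _; lra.
have hi : m < ln (v N%:Z).
  have := HA N%:Z 0; rewrite lez_nat => /(_ erefl); rewrite subr0 => h.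
  have {}h : al / 2 * N%:R - A <= ln (v N%:Z) - ln (v 0) by exact: h.
  move: h hN; set q := al / 2 * _; lra.
have ex : exists i, m < ln (v (- N%:Z + i%:Z)).
  by exists (N + N)%N; rewrite PoszD addKr.
case: (ex_minnP ex) => i him mini.
case: i him mini => [|i] him mini.
  by move: him; rewrite addr0 ltNge lo.
exists (- N%:Z + i%:Z); apply/andP; split.
  by rewrite leNgt; apply/negP => /mini; rewrite ltnn.
have := HB (- N%:Z + i.+1%:Z) (- N%:Z + i%:Z).
rewrite subz_succ normr1 mulr1 => h; have := ler_norm (ln (v (- N%:Z + i.+1%:Z)) - ln (v (- N%:Z + i%:Z))).
lra.
Qed.

(** The exponential growth of v makes n and n' close whenever v n and v n' lie
    in one cell, and by [rvseq_cover] each cell is within bounded distance of some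
    v n.  Both substitutions n |-> cell of v n and m |-> s m have bounded
    multiplicity, so [snorm_comp] applies to them, and the growth condition on g
    pays for the bounded distances. *)
Lemma change_of_variable E (al : R) v : 0 < al -> rvseq al v -> forall c p : R, 0 < c -> 0 <= p ->
  exists2 C : R, 0 < C & forall g, (forall t, 0 < t -> (0 <= g t)%E) ->
   (forall s t, 0 < s -> 0 < t -> (g t <= (c * expR (p * `|ln t - ln s|))%:E * g s)%E) ->
   (snorm E (fun n => g (expz n)) <= C%:E * snorm E (fun n => g (v n)))%E /\
   (snorm E (fun n => g (v n)) <= C%:E * snorm E (fun n => g (expz n)))%E.
Proof.
move=> al0 hv c p c0 p0; have [v0 _] := hv.
have [A A0 HA] := rvseq_growth al0 hv; have [D HD] := rvseq_cover al0 hv.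
have [s Hs] := choice (fun m : int => HD m%:~R).
have e0 : 0 < al / 2 by lra.
have [L1 [L10 hL1]] : exists L : nat, (0 < L)%N /\ 1 + A < al / 2 * L%:R.
  exists (Num.truncn ((1 + A) / (al / 2))).+1; split => //.
  by rewrite mulrC -ltr_pdivrMr // truncnS_gt.
have [L2 [L20 hL2]] : exists L : nat, (0 < L)%N /\ D < L%:R.
  by exists (Num.truncn D).+1; split => //; exact: truncnS_gt.
have inj1 i j : cell_of (v i) = cell_of (v j) -> (`|i - j| < L1)%N.
  move=> e; rewrite ltnNge; apply/negP => hij.
  have dist : `|ln (v i) - ln (v j)| < 1.
    have /andP[p1 p2] := floor_itv (ln (v i)); have /andP[p3 p4] := floor_itv (ln (v j)).
    rewrite -/(cell_of (v i)) in p1 p2; rewrite -/(cell_of (v j)) -e in p3 p4; rewrite !intrD in p2 p4.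
    by rewrite ltr_norml; lra.
  wlog ij : i j e hij dist / (j <= i)%R.
    move=> W; have [ij|/ltW ij] := leP j i; first exact: (W i j).
    by apply: (W j i) => //; [lia|rewrite distrC].
  have := HA i j ij; have : L1%:R <= (i - j)%:~R :> R.
    by rewrite -[leLHS]/((L1%:Z)%:~R) ler_int; lia.
  rewrite -(ler_pM2l e0); have := ler_norm (ln (v i) - ln (v j)); lra.
have inj2 i j : s i = s j -> (`|i - j| < L2)%N.
  move=> e; rewrite -(ltr_nat R) intr_absz; apply: le_lt_trans hL2.
  have /andP[p1 p2] := Hs i; have /andP[p3 p4] := Hs j; rewrite -e in p3 p4.
  by rewrite intrB ler_norml; lra.
pose D' := `|D|; have D0 : 0 <= D' by exact: normr_ge0.
exists (c * expR (p * D') * L2%:R + c * expR p * L1%:R) => [|g g0 hg].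
  by rewrite addr_gt0 // !mulr_gt0 ?expR_gt0 ?ltr0n.
have ge0 : nonneg (fun n => g (expz n)) by move=> n; exact/g0/expz_gt0.
have gv0 : nonneg (fun n => g (v n)) by move=> n; exact/g0.
have cD : 0 < c * expR (p * D') by rewrite mulr_gt0 // expR_gt0.
have cp : 0 < c * expR p by rewrite mulr_gt0 // expR_gt0.
split.
  apply: (@le_trans _ _ ((c * expR (p * D'))%:E * snorm E (fun m => g (v (s m))))%E).
    apply: snorm_le_scale => // m.
    apply: (le_trans (hg _ _ (v0 (s m)) (expz_gt0 m))).
    apply: lee_wpmul2r; first exact: gv0.
    rewrite lee_fin ler_pM2l // ler_expR; apply: ler_wpM2l => //.
    have /andP[p1 p2] := Hs m; rewrite /expz expRK.
    have := ler_norm D; rewrite -/D' ger0_norm; lra.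
  apply: (@le_trans _ _ ((c * expR (p * D'))%:E * (L2%:R%:E * snorm E (fun n => g (v n))))%E).
    by apply: lee_wpmul2l; [rewrite lee_fin ltW|exact: (snorm_comp E gv0 inj2)].
  rewrite muleA -EFinM; apply: lee_wpmul2r; first exact: snorm_ge0.
  by rewrite lee_fin lerDl mulr_ge0 // ltW.
apply: (@le_trans _ _ ((c * expR p)%:E * snorm E (fun n => g (expz (cell_of (v n)))))%E).
  apply: snorm_le_scale => // m.
  apply: (le_trans (hg _ _ (expz_gt0 (cell_of (v m))) (v0 m))).
  apply: lee_wpmul2r; first exact: ge0.
  rewrite lee_fin ler_pM2l // ler_expR -[leRHS]mulr1; apply: ler_wpM2l => //.
  by rewrite /expz expRK; exact: ln_cell_of.
apply: (@le_trans _ _ ((c * expR p)%:E * (L1%:R%:E * snorm E (fun n => g (expz n))))%E).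
  apply: lee_wpmul2l; first by rewrite lee_fin ltW.
  exact: (@snorm_comp _ E L1 (fun n => cell_of (v n)) (fun n => g (expz n)) ge0 inj1).
rewrite muleA -EFinM; apply: lee_wpmul2r; first exact: snorm_ge0.
by rewrite lee_fin lerDr mulr_ge0 // ltW.
Qed.

End Transfer.

(** * K-functionals of quasi-Banach couples *)

Section KFunctional.
Context {R : realType} {V : lmodType R}.
Implicit Types (X Y : nspace V) (f g : V).

Definition normed_ge0 X := forall f, X f -> (0 <= nnorm X f)%E.

Section General.
Variables (X0 X1 : nspace V).
Hypotheses (h0 : normed_ge0 X0) (h1 : normed_ge0 X1).

Lemma K_le f0 f1 (t : R) : X0 f0 -> X1 f1 ->
  (Kfun X0 X1 (f0 + f1) t <= nnorm X0 f0 + t%:E * nnorm X1 f1)%E.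
Proof. by move=> x0 x1; apply: ereal_inf_lbound; exists (f0, f1). Qed.

Lemma le_K f (t : R) (k : \bar R) :
  (forall f0 f1, X0 f0 -> X1 f1 -> f = f0 + f1 ->
    (k <= nnorm X0 f0 + t%:E * nnorm X1 f1)%E) ->
  (k <= Kfun X0 X1 f t)%E.
Proof. by move=> h; apply: le_ereal_inf_tmp => _ [[f0 f1] /= [x0 x1 e] <-]; exact: h. Qed.

Lemma K_ge0 f (t : R) : 0 < t -> (0 <= Kfun X0 X1 f t)%E.
Proof.
move=> t0; apply: le_K => f0 f1 x0 x1 _; apply: adde_ge0; first exact: h0.
by apply: mule_ge0; [rewrite lee_fin ltW|exact: h1].
Qed.

Lemma K_mono f (s t : R) : s <= t -> (Kfun X0 X1 f s <= Kfun X0 X1 f t)%E.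
Proof.
move=> st; apply: le_K => f0 f1 x0 x1 ->; apply: (le_trans (K_le s x0 x1)).
apply: leeD; first exact: lexx.
by apply: lee_wpmul2r; [exact: h1|rewrite lee_fin].
Qed.

Lemma K_scale f (s t : R) : 0 < s -> s <= t ->
  (Kfun X0 X1 f t <= (t / s)%:E * Kfun X0 X1 f s)%E.
Proof.
move=> s0 st; have t0 : 0 < t by lra.
have ts : 0 < t / s by exact: divr_gt0.
have ts1 : 1 <= t / s by rewrite ler_pdivlMr // mul1r.
apply: le_inv_scaleV => //; apply: le_K => f0 f1 x0 x1 e.
apply: le_inv_scale => //; rewrite e; apply: (le_trans (K_le t x0 x1)).
rewrite ge0_muleDr; [|exact: h0|by apply: mule_ge0; [rewrite lee_fin ltW|exact: h1]].
apply: leeD.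
  rewrite -[leLHS]mul1e; apply: lee_wpmul2r; [exact: h0|by rewrite lee_fin].
by rewrite muleA -EFinM divfK ?lt0r_neq0 //; exact: lexx.
Qed.

(** The two monotonicity properties, K increasing and K(t) / t decreasing, in
    one formula. *)
Lemma K_ln f (s t : R) : 0 < s -> 0 < t ->
  (Kfun X0 X1 f t <= (expR `|ln t - ln s|)%:E * Kfun X0 X1 f s)%E.
Proof.
move=> s0 t0; have k0 := K_ge0 f s0; have [ts|st] := leP t s.
  apply: (le_trans (K_mono f ts)); rewrite -[leLHS]mul1e.
  by apply: lee_wpmul2r => //; rewrite lee_fin -expR0 ler_expR.
apply: (le_trans (K_scale f s0 (ltW st))); apply: lee_wpmul2r => //.
rewrite lee_fin ger0_norm ?subr_ge0 ?ler_ln ?posrE //; last exact: ltW.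
by rewrite expRB !lnK ?posrE.
Qed.

Definition Kseq f (n : int) := Kfun X0 X1 f (expz n).

Lemma Kseq_ge0 f : nonneg (Kseq f).
Proof. by move=> n; exact/K_ge0/expz_gt0. Qed.

Lemma Kseq_up f n : (Kseq f n <= Kseq f (n + 1))%E.
Proof. by apply: K_mono; rewrite /expz ler_expR ler_int; lia. Qed.

Lemma Kseq_upreg f : upreg (expR 1) (Kseq f).
Proof.
move=> n; apply: (le_trans (K_ln f (expz_gt0 n) (expz_gt0 _))).
by rewrite /expz !expRK intrD addrAC subrr add0r normr1; exact: lexx.
Qed.

Lemma K_sampled f : sampled (expR 1) (Kfun X0 X1 f) (Kseq f).
Proof.
move=> t t0; have := ln_cell_of t; have e0 := expz_gt0 (R := R) (cell_of t) => h.
split.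
  apply: (le_trans (K_ln f e0 t0)); apply: lee_wpmul2r; first exact: Kseq_ge0.
  by rewrite lee_fin ler_expR /expz expRK.
apply: (le_trans (K_ln f t0 e0)); apply: lee_wpmul2r; first exact: K_ge0.
by rewrite lee_fin ler_expR /expz expRK distrC.
Qed.

Lemma K_eq0 f (s t : R) : 0 < s -> 0 < t -> Kfun X0 X1 f s = 0%E -> Kfun X0 X1 f t = 0%E.
Proof.
move=> s0 t0 e; apply/eqP; rewrite eq_le K_ge0 // andbT.
by apply: (le_trans (K_ln f s0 t0)); rewrite e mule0.
Qed.

(** If K vanishes then the infimum need not be nearly attained, whence the
    strict positivity. *)
Lemma K_near_min f (t : R) : 0 < t -> (0 < Kfun X0 X1 f t)%E -> (Kfun X0 X1 f t < +oo)%E ->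
  exists f0 f1, [/\ X0 f0, X1 f1, f = f0 + f1 &
    (nnorm X0 f0 + t%:E * nnorm X1 f1 <= 2%:E * Kfun X0 X1 f t)%E].
Proof.
move=> t0; case E: (Kfun X0 X1 f t) => [k| |] //; rewrite lte_fin => k0 _.
have : (Kfun X0 X1 f t < 2%:E * k%:E)%E by rewrite E -EFinM lte_fin; lra.
move=> /ereal_inf_lt[_ [[f0 f1] /= [x0 x1 e] <-] lt].
by exists f0, f1; split => //; exact: ltW.
Qed.

End General.

Section QuasiBanach.
Variables (X0 X1 : nspace V).
Hypotheses (q0 : quasi_banach X0) (q1 : quasi_banach X1).

Lemma qb_ge0 X : quasi_banach X -> normed_ge0 X.
Proof. by move=> [_ [h _ _ _] _] f /h /andP[]. Qed.

Lemma qb_fin X f : quasi_banach X -> X f -> nnorm X f \is a fin_num.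
Proof. by move=> [_ [h _ _ _] _] /h /andP[p q]; rewrite ge0_fin_numE. Qed.

Lemma qb_add X f g : quasi_banach X -> X f -> X g -> X (f + g).
Proof. by move=> [[_ h] _ _] xf xg; have := h 1 f g xf xg; rewrite scale1r. Qed.

Lemma qb_opp X f : quasi_banach X -> X f -> X (- f) /\ nnorm X (- f) = nnorm X f.
Proof.
move=> [[x0 h] [_ _ hs _] _] xf; split.
  by have := h (-1) f 0 xf x0; rewrite scaleN1r addr0.
by have := hs (-1) f xf; rewrite scaleN1r normrN normr1 mul1e.
Qed.

Lemma qb_0 X : quasi_banach X -> X 0.
Proof. by move=> [[]]. Qed.

Lemma qb_norm0 X : quasi_banach X -> nnorm X 0 = 0%E.
Proof.
by move=> [[x0 _] [_ _ hs _] _]; have := hs 0 0 x0; rewrite scale0r normr0 mul0e.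
Qed.

Lemma sum_spaceD f g : sum_space X0 X1 f -> sum_space X0 X1 g -> sum_space X0 X1 (f + g).
Proof.
move=> [f0 [f1 [xf0 xf1 ->]]] [g0 [g1 [xg0 xg1 ->]]].
exists (f0 + g0), (f1 + g1); split; [exact: qb_add|exact: qb_add|].
by rewrite addrACA.
Qed.

Lemma sum_space_l f : X0 f -> sum_space X0 X1 f.
Proof. by move=> xf; exists f, 0; split => //; [exact: qb_0|rewrite addr0]. Qed.

Lemma sum_space_r f : X1 f -> sum_space X0 X1 f.
Proof. by move=> xf; exists 0, f; split => //; [exact: qb_0|rewrite add0r]. Qed.

Lemma K_opp f (t : R) : Kfun X0 X1 (- f) t = Kfun X0 X1 f t.
Proof.
have key g : (Kfun X0 X1 (- g) t <= Kfun X0 X1 g t)%E.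
  apply: le_K => g0 g1 x0 x1 ->; rewrite opprD.
  have [y0 <-] := qb_opp q0 x0; have [y1 <-] := qb_opp q1 x1; exact: K_le.
by apply/eqP; rewrite eq_le key -{1}[f]opprK key.
Qed.

Lemma K_fin f (t : R) : 0 < t -> sum_space X0 X1 f -> (Kfun X0 X1 f t < +oo)%E.
Proof.
move=> t0 [f0 [f1 [x0 x1 ->]]]; apply: (le_lt_trans (K_le t x0 x1)).
by rewrite -(fineK (qb_fin q0 x0)) -(fineK (qb_fin q1 x1)) -EFinM -EFinD ltry.
Qed.

(** Add two decompositions; the two infima are taken one after the other, which
    requires setting aside an infinite value of K. *)
Lemma K_add : exists2 C : R, 1 <= C & forall f g (t : R), 0 < t ->
  (Kfun X0 X1 (f + g) t <= C%:E * (Kfun X0 X1 f t + Kfun X0 X1 g t))%E.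
Proof.
have [_ [_ _ _ [C0 C01 H0]] _] := q0; have [_ [_ _ _ [C1 C11 H1]] _] := q1.
have g0 := qb_ge0 q0; have g1 := qb_ge0 q1.
pose C := C0 + C1; have C_gt0 : 0 < C by rewrite /C; lra.
exists C => [|f g t t0]; first by rewrite /C; lra.
have key f0 f1 k0 k1 : X0 f0 -> X1 f1 -> X0 k0 -> X1 k1 -> f = f0 + f1 -> g = k0 + k1 ->
    (C^-1%:E * Kfun X0 X1 (f + g) t <=
      (nnorm X0 f0 + t%:E * nnorm X1 f1) + (nnorm X0 k0 + t%:E * nnorm X1 k1))%E.
  move=> x0 x1 y0 y1 -> ->; apply: le_inv_scale => //; rewrite addrACA.
  apply: (le_trans (K_le t (qb_add q0 x0 y0) (qb_add q1 x1 y1))).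
  apply: (le_trans (leeD (H0 _ _ x0 y0) (lee_wpmul2l _ (H1 _ _ x1 y1)))).
    by rewrite lee_fin ltW.
  rewrite -(fineK (qb_fin q0 x0)) -(fineK (qb_fin q1 x1)).
  rewrite -(fineK (qb_fin q0 y0)) -(fineK (qb_fin q1 y1)).
  have a0 : 0 <= fine (nnorm X0 f0) by apply: fine_ge0; exact: g0.
  have a1 : 0 <= fine (nnorm X1 f1) by apply: fine_ge0; exact: g1.
  have b0 : 0 <= fine (nnorm X0 k0) by apply: fine_ge0; exact: g0.
  have b1 : 0 <= fine (nnorm X1 k1) by apply: fine_ge0; exact: g1.
  move: (fine (nnorm X0 f0)) (fine (nnorm X1 f1)) (fine (nnorm X0 k0)) (fine (nnorm X1 k1)) a0 a1 b0 b1.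
  move=> a b c d a0 b0 c0 d0.
  rewrite -?EFinD -?EFinM -?EFinD -?EFinM -?EFinD -?EFinM lee_fin /C.
  have p1 : 0 <= C0 * (t * b + t * d).
    by rewrite mulr_ge0 ?addr_ge0 ?mulr_ge0 ?(ltW t0) //; lra.
  have p2 : 0 <= C1 * (a + c) by rewrite mulr_ge0 ?addr_ge0 //; lra.
  lra.
apply: le_inv_scaleV => //.
have fin (Z : nspace V) (h : V) : quasi_banach Z -> Z h -> (t%:E * nnorm Z h)%E \is a fin_num.
  by move=> q z; apply: fin_numM => //; exact: (qb_fin q z).
rewrite addeC; have [|nfin] := boolP (Kfun X0 X1 g t \is a fin_num); last first.
  have -> : Kfun X0 X1 g t = +oo%E.
    by have := K_ge0 g0 g1 g t0; move: nfin; case: (Kfun X0 X1 g t).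
  by rewrite addye ?leey //; have := K_ge0 g0 g1 f t0; case: (Kfun X0 X1 f t).
move=> Kg; rewrite -leeBlDl //; apply: le_K => f0 f1 x0 x1 e.
rewrite leeBlDl //; have vf : (nnorm X0 f0 + t%:E * nnorm X1 f1)%E \is a fin_num.
  by rewrite fin_numD (qb_fin q0 x0) fin.
rewrite -leeBlDr //; apply: le_K => k0 k1 y0 y1 e'.
by rewrite leeBlDr // addeC; exact: key.
Qed.

End QuasiBanach.

End KFunctional.

(** * Reflection, and the half attached to Y1 *)

(** The reflection t -> 1/t, which exchanges (0, t) with (t, oo). *)
Definition flip {T : Type} (x : int -> T) (n : int) : T := x (- n).

Lemma flipK (T : Type) (x : int -> T) : flip (flip x) = x.
Proof. by apply/funext => n; rewrite /flip opprK. Qed.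

Section Reversal.
Context {R : realType}.
Implicit Types (E F : ri_space R) (g : int -> \bar R) (b w : int -> R).

Lemma flip_ge0 g : nonneg g -> nonneg (flip g).
Proof. by move=> g0 n; exact: g0. Qed.

Lemma flip_above n g : above (- n) (flip g) = flip (below n g).
Proof. by apply/funext => k; rewrite /above /below /flip; congr (if _ then _ else _); lia. Qed.

Lemma flip_below n g : below (- n) (flip g) = flip (above n g).
Proof. by apply/funext => k; rewrite /above /below /flip; congr (if _ then _ else _); lia. Qed.

Lemma snorm_flip E g : nonneg g -> snorm E (flip g) = snorm E g.
Proof. exact: snorm_opp. Qed.

Lemma snorm_above_flip E n g : nonneg g -> snorm E (above n g) = snorm E (below (- n) (flip g)).
Proof. by move=> g0; rewrite flip_below snorm_flip //; exact: above_ge0. Qed.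

Lemma snorm_below_flip E n g : nonneg g -> snorm E (below n g) = snorm E (above (- n) (flip g)).
Proof. by move=> g0; rewrite flip_above snorm_flip //; exact: below_ge0. Qed.

Lemma NR_flip E F b g : (forall n, 0 < b n) -> nonneg g ->
  NR E F b g = NL E F (flip b) (flip g).
Proof.
move=> b0 g0; rewrite /NR -snorm_flip; last exact: smul_snorm_ge0.
by apply: snorm_eq => n; rewrite /smul /flip snorm_above_flip ?opprK.
Qed.

Lemma NL_flip E F b g : (forall n, 0 < b n) -> nonneg g ->
  NL E F b g = NR E F (flip b) (flip g).
Proof.
move=> b0 g0; rewrite (@NR_flip E F (flip b) (flip g) (fun n => b0 (- n)) (flip_ge0 g0)).
by rewrite !flipK.
Qed.

(** Mirror images of [PL] and [QL]. *)
Definition PR E F b n g := PL E F (flip b) (- n) (flip g).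
Definition QR E F b n g := QL E F (flip b) (- n) (flip g).

Lemma PRE E F b n g : (forall n, 0 < b n) -> nonneg g ->
  PR E F b n g = snorm E (above n (smul b (fun j => snorm F (above j g)))).
Proof.
move=> b0 g0; rewrite snorm_above_flip; last exact: smul_snorm_ge0.
apply: snorm_eq => k; rewrite /below; case: ifP => _; last by [].
by rewrite /smul /flip snorm_above_flip ?opprK.
Qed.

Lemma QRE E F b n g : nonneg g ->
  QR E F b n g = ((tail_norm E (flip b) (- n))%:E * snorm F (above n g))%E.
Proof. by move=> g0; rewrite /QR /QL snorm_above_flip. Qed.

Lemma snorm_sub E (c : R) (x y z : int -> \bar R) : 0 < c ->
  nonneg x -> nonneg y -> nonneg z -> (forall n, (x n <= c%:E * (y n + z n))%E) ->
  (snorm E x <= c%:E * (snorm E y + snorm E z))%E.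
Proof.
move=> c0 x0 y0 z0 h; have yz0 : nonneg (fun n => y n + z n)%E.
  by move=> n; apply: adde_ge0; [exact: y0|exact: z0].
apply: (le_trans (snorm_le_scale E c0 x0 yz0 h)).
by apply: lee_wpmul2l; [rewrite lee_fin ltW|exact: snormD].
Qed.

Lemma below_sub (c : R) n (x y z : int -> \bar R) :
  (forall n, (x n <= c%:E * (y n + z n))%E) ->
  forall k, (below n x k <= c%:E * (below n y k + below n z k))%E.
Proof. by move=> h k; rewrite /below; case: ifP => _; rewrite ?adde0 ?mule0. Qed.

Lemma smul_sub (c : R) w (x y z : int -> \bar R) : (forall n, 0 < w n) ->
  nonneg y -> nonneg z -> (forall n, (x n <= c%:E * (y n + z n))%E) ->
  forall k, (smul w x k <= c%:E * (smul w y k + smul w z k))%E.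
Proof.
move=> w0 y0 z0 h k; rewrite /smul.
rewrite -(ge0_muleDr _ (y0 k) (z0 k)) [leRHS]muleCA.
by apply: lee_wpmul2l; [rewrite lee_fin ltW|exact: h].
Qed.

Section Sub.
Variables (E F : ri_space R) (b : int -> R) (b0 : forall n, 0 < b n).
Variables (c : R) (x y z : int -> \bar R).
Hypotheses (c0 : 0 < c) (x0 : nonneg x) (y0 : nonneg y) (z0 : nonneg z).
Hypothesis h : forall n, (x n <= c%:E * (y n + z n))%E.

Lemma snorm_below_sub n :
  (snorm F (below n x) <= c%:E * (snorm F (below n y) + snorm F (below n z)))%E.
Proof. by apply: snorm_sub => //; try exact: below_ge0; exact: below_sub. Qed.

Lemma PL_sub n : (PL E F b n x <= c%:E * (PL E F b n y + PL E F b n z))%E.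
Proof.
apply: snorm_sub => //; try (apply: below_ge0; exact: smul_snorm_ge0).
by apply: below_sub => k; apply: smul_sub => // j; try exact: snorm_ge0; exact: snorm_below_sub.
Qed.

Lemma QL_sub n : 0 <= tail_norm E b n -> (QL E F b n x <= c%:E * (QL E F b n y + QL E F b n z))%E.
Proof.
move=> t0; rewrite /QL -(ge0_muleDr _ (snorm_ge0 _ _) (snorm_ge0 _ _)) [leRHS]muleCA.
by apply: lee_wpmul2l; [rewrite lee_fin|exact: snorm_below_sub].
Qed.

End Sub.

End Reversal.

Section Halves.
Context {R : realType}.
Variables (E0 F0 E1 F1 : ri_space R) (b0 b1 w0 w1 : int -> R) (th0 th1 : R).
Implicit Types (K g : int -> \bar R).
Hypotheses (hb0 : rvseq 0 b0) (hb1 : rvseq 0 b1).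
Hypotheses (hw0 : rvseq (- th0) w0) (hw1 : rvseq (- th1) w1).
Hypotheses (th0_gt0 : 0 < th0) (th01 : th0 < th1).
Hypothesis fin0 : (snorm E0 (above 0 (emb b0)) < +oo)%E.
Hypothesis fin1 : (snorm E1 (below 0 (emb b1)) < +oo)%E.

(** Sequence forms of the norm of b0 over (u, oo), of b1 over (0, u), and of
    rho(u). *)
Definition be0 n := tail_norm E0 b0 n.
Definition be1 n := tail_norm E1 (flip b1) (- n).
Definition rho n := (w0 n * be0 n) / (w1 n * be1 n).

Let b0_gt0 n : 0 < b0 n. Proof. by case: hb0. Qed.
Let b1_gt0 n : 0 < b1 n. Proof. by case: hb1. Qed.
Let w0_gt0 n : 0 < w0 n. Proof. by case: hw0. Qed.
Let w1_gt0 n : 0 < w1 n. Proof. by case: hw1. Qed.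

Let hrb1 : rvseq 0 (flip b1).
Proof. by apply: (rvseq_eq (rvseq_opp hb1)) => //; rewrite oppr0. Qed.

Let fin1' : (snorm E1 (above 0 (emb (flip b1))) < +oo)%E.
Proof.
by have := fin1; rewrite snorm_below_flip ?oppr0 //; exact: emb_ge0.
Qed.

Lemma rvseq_be0 : rvseq 0 be0. Proof. exact: rvseq_tail. Qed.

Lemma rvseq_be1 : rvseq 0 be1.
Proof. by apply: (rvseq_eq (rvseq_opp (rvseq_tail hrb1 fin1'))) => //; rewrite oppr0. Qed.

Lemma be0_gt0 n : 0 < be0 n. Proof. by case: rvseq_be0. Qed.
Lemma be1_gt0 n : 0 < be1 n. Proof. by case: rvseq_be1. Qed.

Lemma be0E n : snorm E0 (above n (emb b0)) = (be0 n)%:E.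
Proof. exact: tailE. Qed.

Lemma be1E n : snorm E1 (below n (emb b1)) = (be1 n)%:E.
Proof. by rewrite snorm_below_flip; [exact: tailE|exact: emb_ge0]. Qed.

Lemma rvseq_rho : rvseq (th1 - th0) rho.
Proof.
apply: (rvseq_eq (rvseq_mul (rvseq_mul hw0 rvseq_be0) (rvseq_inv (rvseq_mul hw1 rvseq_be1)))) => //; lra.
Qed.

Lemma rho_gt0 n : 0 < rho n. Proof. by case: rvseq_rho. Qed.

Let de0 : 0 < th1 - th0. Proof. by rewrite subr_gt0. Qed.

(** Sequence forms of the norms of Y0 and Y1 and of the four terms of the
    Holmstedt functional, as functions of the sampled K-functional. *)
Definition N0 K := NL E0 F0 b0 (smul w0 K).
Definition N1 K := NR E1 F1 b1 (smul w1 K).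
Definition P0 n K := PL E0 F0 b0 n (smul w0 K).
Definition Q0 n K := QL E0 F0 b0 n (smul w0 K).
Definition P1 n K := PR E1 F1 b1 n (smul w1 K).
Definition Q1 n K := QR E1 F1 b1 n (smul w1 K).

Lemma P0_ge0 n K : (0 <= P0 n K)%E. Proof. exact: snorm_ge0. Qed.
Lemma P1_ge0 n K : (0 <= P1 n K)%E. Proof. exact: snorm_ge0. Qed.
Lemma Q0_ge0 n K : (0 <= Q0 n K)%E.
Proof. by apply: mule_ge0; [rewrite lee_fin ltW // be0_gt0|exact: snorm_ge0]. Qed.
Lemma Q1_ge0 n K : (0 <= Q1 n K)%E.
Proof. by apply: mule_ge0; [rewrite lee_fin ltW // be1_gt0|exact: snorm_ge0]. Qed.
Lemma N0_ge0 K : (0 <= N0 K)%E. Proof. exact: snorm_ge0. Qed.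
Lemma N1_ge0 K : (0 <= N1 K)%E. Proof. exact: snorm_ge0. Qed.

Definition Lo n K := (P0 n K + Q0 n K)%E.
Definition Up n K := (P1 n K + Q1 n K)%E.

Lemma Lo_ge0 n K : (0 <= Lo n K)%E.
Proof. by apply: adde_ge0; [exact: P0_ge0|exact: Q0_ge0]. Qed.
Lemma Up_ge0 n K : (0 <= Up n K)%E.
Proof. by apply: adde_ge0; [exact: P1_ge0|exact: Q1_ge0]. Qed.

Let w0K K : nonneg K -> nonneg (smul w0 K). Proof. exact: smul_ge0. Qed.
Let w1K K : nonneg K -> nonneg (smul w1 K). Proof. exact: smul_ge0. Qed.

Lemma add_le2 (x y z : \bar R) : (0 <= z)%E -> (x <= z)%E -> (y <= z)%E -> (x + y <= 2%:E * z)%E.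
Proof.
move=> z0 xz yz; have -> : (2%:E * z = z + z)%E.
  by rewrite -{2 3}[z]mul1e -ge0_muleDl ?lee_fin // -EFinD; congr ((_)%:E * _)%E; lra.
exact: leeD.
Qed.

Lemma add_le_const (c d : R) (x y z : \bar R) : (0 <= z)%E -> 0 <= c -> 0 <= d ->
  (x <= c%:E * z)%E -> (y <= d%:E * z)%E -> (x + y <= (c + d)%:E * z)%E.
Proof.
by move=> z0 c0 d0 xz yz; rewrite EFinD ge0_muleDl ?lee_fin //; exact: leeD.
Qed.

Lemma Lo_le_N0 n K : nonneg K -> (Lo n K <= 2%:E * N0 K)%E.
Proof.
move=> K0; apply: add_le2; first exact: N0_ge0.
  by apply: PL_le_NL.
by apply: QL_le_NL => //; exact: w0K.
Qed.

Lemma N1E K : nonneg K -> N1 K = NL E1 F1 (flip b1) (flip (smul w1 K)).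
Proof. by move=> K0; rewrite /N1 NR_flip //; exact: w1K. Qed.

Lemma Up_le_N1 n K : nonneg K -> (Up n K <= 2%:E * N1 K)%E.
Proof.
move=> K0; apply: add_le2; first exact: N1_ge0.
  by rewrite N1E //; apply: PL_le_NL; case: hrb1.
by rewrite N1E //; apply: QL_le_NL => //; exact/flip_ge0/w1K.
Qed.

(** The cross estimate with r = w0 / w1. *)
Lemma Lo_le_N1 : exists2 C : R, 0 < C & forall n K, nonneg K ->
  (Lo n K <= (C * rho n)%:E * N1 K)%E.
Proof.
pose r n := w0 n / w1 n.
have rE n : rho n * be1 n = r n * tail_norm E0 b0 n.
  have := lt0r_neq0 (be1_gt0 n); have := lt0r_neq0 (w1_gt0 n).
  by rewrite /rho /r -/(be0 n) => h1 h2; field; rewrite h1 h2.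
have [C C0 HC] := PL_le_NR F0 hb0 fin0 F1 b1_gt0 be1_gt0 be1E rvseq_rho de0 rE.
have [D D0 HD] := QL_le_NR F0 hb0 fin0 F1 b1_gt0 be1_gt0 be1E rvseq_rho de0 rE.
exists (C + D) => [|n K K0]; first exact: addr_gt0.
have e : smul w0 K = smul r (smul w1 K).
  by apply/funext => k; rewrite /smul muleA -EFinM /r divfK // lt0r_neq0.
rewrite /Lo /P0 /Q0 e mulrDl; apply: add_le_const; first exact: N1_ge0.
- by rewrite mulr_ge0 // ltW // rho_gt0.
- by rewrite mulr_ge0 // ltW // rho_gt0.
- by apply: HC; exact: w1K.
- by apply: HD; exact: w1K.
Qed.

(** The cross estimate for the reflected sequences, where w1 / w0 and 1 / rho
    take the places of w0 / w1 and rho; 1 / rho reflected has again index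
    th1 - th0. *)
Lemma Up_le_N0 : exists2 C : R, 0 < C & forall n K, nonneg K ->
  (Up n K <= (C / rho n)%:E * N0 K)%E.
Proof.
pose r := flip (fun n => w1 n / w0 n).
pose rh := flip (fun n => (rho n)^-1).
have prh : rvseq (th1 - th0) rh.
  by apply: (rvseq_eq (rvseq_opp (rvseq_inv rvseq_rho))) => //; rewrite opprK.
have rE n : rh n * flip be0 n = r n * tail_norm E1 (flip b1) n.
  have := lt0r_neq0 (be1_gt0 (- n)); have := lt0r_neq0 (w1_gt0 (- n)).
  have := lt0r_neq0 (be0_gt0 (- n)); have := lt0r_neq0 (w0_gt0 (- n)).
  rewrite /rh /r /rho /flip /be1 opprK -/(flip b1) => h1 h2 h3 h4.
  by field; rewrite h1 h2 h3 h4.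
have c0 n : 0 < flip b0 n by exact: b0_gt0.
have d0 n : 0 < flip be0 n by exact: be0_gt0.
have dE n : snorm E0 (below n (emb (flip b0))) = (flip be0 n)%:E.
  rewrite -be0E snorm_above_flip; last exact: emb_ge0.
  by rewrite opprK.
have [C C0 HC] := PL_le_NR F1 hrb1 fin1' F0 c0 d0 dE prh de0 rE.
have [D D0 HD] := QL_le_NR F1 hrb1 fin1' F0 c0 d0 dE prh de0 rE.
exists (C + D) => [|n K K0]; first exact: addr_gt0.
have e : flip (smul w1 K) = smul r (flip (smul w0 K)).
  apply/funext => k; rewrite /smul /r /flip muleA -EFinM.
  by rewrite divfK // lt0r_neq0.
have NE : N0 K = NR E0 F0 (flip b0) (flip (smul w0 K)).
  by rewrite /N0 NL_flip //; exact: w0K.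
have rn : rh (- n) = (rho n)^-1 by rewrite /rh /flip opprK.
have rn0 : 0 <= (rho n)^-1 by rewrite invr_ge0; exact/ltW/rho_gt0.
rewrite /Up /P1 /Q1 /PR /QR e mulrDl NE; apply: add_le_const; first exact: snorm_ge0.
- exact: mulr_ge0 (ltW C0) rn0.
- exact: mulr_ge0 (ltW D0) rn0.
- by rewrite -rn; apply: HC; exact/flip_ge0/w0K.
- by rewrite -rn; apply: HD; exact/flip_ge0/w0K.
Qed.

Lemma N0_min : exists2 C : R, 0 < C & forall (n : int) K, nonneg K ->
  (forall k, (K k <= K (k + 1)%R)%E) -> upreg (expR 1) K ->
  (N0 (fun k => K (Order.min k n)) <= C%:E * Lo n K)%E.
Proof.
have t0 : - th0 < 0 by rewrite oppr_lt0.
by have [C C0 H] := NL_min F0 hb0 fin0 hw0 t0; exists C => // n K K0 K1 K2; exact: H.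
Qed.

Hypothesis th1_lt1 : th1 < 1.

(** The sequence form of min(1, t / e^n) K(max(t, e^n)), which dominates the
    K-functional of the second component of a nearly optimal decomposition. *)
Definition Kmax (n : int) K (k : int) := ((expR (k - Order.max k n)%:~R)%:E * K (Order.max k n))%E.

(** Reflected, and multiplied by e^k, the sequence K becomes an increasing
    sequence L that grows at most by a factor e (K increasing and K(t) / t
    decreasing exchange their roles), and [Kmax] becomes the truncation of L.
    The factor e^(-k) goes to the weight, whose index becomes th1 - 1 < 0, so
    [NL_min] applies. *)
Lemma N1_max : exists2 C : R, 0 < C & forall (n : int) K, nonneg K ->
  (forall k, (K k <= K (k + 1)%R)%E) -> upreg (expR 1) K ->
  (N1 (Kmax n K) <= C%:E * Up n K)%E.
Proof.
pose w n := expR (- 1 * n%:~R) * flip w1 n.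
have hw : rvseq (th1 - 1) w.
  by apply: (rvseq_eq (rvseq_mul (rvseq_exp (- 1)) (rvseq_opp hw1))) => //; ring.
have t0 : th1 - 1 < 0 by rewrite subr_lt0.
have [C C0 H] := NL_min F1 hrb1 fin1' hw t0.
exists C => [|n K K0 K1 K2]; first exact: C0.
pose L k := ((expR k%:~R)%:E * K (- k)%R)%E.
have L0 : nonneg L by move=> k; apply: mule_ge0; rewrite ?lee_fin ?expR_ge0.
have L1 k : (L k <= L (k + 1)%R)%E.
  rewrite /L intrD expRD EFinM -muleA; apply: lee_wpmul2l; first by rewrite lee_fin expR_ge0.
  by have := K2 (- (k + 1)); rewrite opprD subrK.
have L2 k : (L (k + 1)%R <= (expR 1)%:E * L k)%E.
  rewrite /L muleA -EFinM -expRD addrC intrD; apply: lee_wpmul2l; first by rewrite lee_fin expR_ge0.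
  by have := K1 (- (1 + k)); rewrite opprD addrAC addNr add0r.
have M0 : nonneg (Kmax n K).
  by move=> k; apply: mule_ge0; rewrite ?lee_fin ?expR_ge0.
rewrite N1E //.
have e1 : flip (smul w1 (Kmax n K)) = smul w (fun k => L (Order.min k (- n))).
  apply/funext => k; rewrite /flip /smul /Kmax /L /w !muleA -!EFinM.
  have -> : Order.max (- k) n = - Order.min k (- n).
    by rewrite oppr_min opprK.
  congr (_%:E * _)%E; rewrite [RHS]mulrAC -expRD [LHS]mulrC /flip.
  congr (expR _ * _); rewrite mulN1r -mulrNz -intrD; congr (_%:~R).
  by rewrite opprK.
have e2 : flip (smul w1 K) = smul w L.
  apply/funext => k; rewrite /flip /smul /L /w !muleA -!EFinM mulrAC -expRD.
  by rewrite mulN1r addNr expR0 mul1r.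
rewrite e1 /Up /P1 /Q1 /PR /QR e2; exact: H.
Qed.

End Halves.

Section Scaling.
Context {R : realType}.

Lemma lee_scale_trans (a b : R) (x y z : \bar R) : 0 <= a -> (x <= a%:E * y)%E -> (y <= b%:E * z)%E ->
  (x <= (a * b)%:E * z)%E.
Proof.
move=> a0 xy yz; apply: (le_trans xy); rewrite EFinM -muleA.
by apply: lee_wpmul2l; rewrite ?lee_fin.
Qed.

Lemma lee_combine (C c d : R) (p q x y : \bar R) : 0 <= C -> 0 <= c -> 0 <= d ->
  (0 <= x)%E -> (0 <= y)%E -> (p <= c%:E * x)%E -> (q <= d%:E * y)%E ->
  (C%:E * (p + q) <= (C * (c + d))%:E * (x + y))%E.
Proof.
move=> C0 c0 d0 x0 y0 px qy; rewrite EFinM -muleA; apply: lee_wpmul2l; first by rewrite lee_fin.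
apply: (le_trans (leeD px qy)); rewrite ge0_muleDr //.
by apply: leeD; apply: lee_wpmul2r => //; rewrite lee_fin; lra.
Qed.

Lemma lee_tripled (C : R) (x y : \bar R) : 0 <= C -> (0 <= y)%E -> (x <= 2%:E * y)%E ->
  (C%:E * (y + x) <= (3 * C)%:E * y)%E.
Proof.
move=> C0 y0 xy; have -> : 3 * C = C * (1 + 2) by ring.
rewrite EFinM -muleA; apply: lee_wpmul2l; first by rewrite lee_fin.
by apply: add_le_const => //; rewrite mul1e.
Qed.

Lemma lty_scale (c : R) (x : \bar R) : 0 < c -> (c%:E * x < +oo)%E = (x < +oo)%E.
Proof.
move=> c0; case: x => [x| |]; first by rewrite -EFinM !ltry.
  by rewrite gt0_muley ?lte_fin.
by rewrite gt0_muleNy ?lte_fin.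
Qed.

End Scaling.

(** * The Holmstedt formula *)

Section Holmstedt.
Context {R : realType} {V : lmodType R}.
Variables (X0 X1 : nspace V) (E0 F0 E1 F1 : ri_space R).
Variables (b0 b1 w0 w1 : int -> R) (th0 th1 : R).
Hypotheses (q0 : quasi_banach X0) (q1 : quasi_banach X1).
Hypotheses (hb0 : rvseq 0 b0) (hb1 : rvseq 0 b1).
Hypotheses (hw0 : rvseq (- th0) w0) (hw1 : rvseq (- th1) w1).
Hypotheses (th0_gt0 : 0 < th0) (th01 : th0 < th1) (th1_lt1 : th1 < 1).
Hypothesis fin0 : (snorm E0 (above 0 (emb b0)) < +oo)%E.
Hypothesis fin1 : (snorm E1 (below 0 (emb b1)) < +oo)%E.

Let K := Kseq X0 X1.
Let N0' f := N0 E0 F0 b0 w0 (K f).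
Let N1' f := N1 E1 F1 b1 w1 (K f).
Let r := rho E0 E1 b0 b1 w0 w1.
Let lo n f := Lo E0 F0 b0 w0 n (K f).
Let up n f := Up E1 F1 b1 w1 n (K f).

Variables (Y0 Y1 : nspace V).
(** Only the equivalence of the norms of Y0 and Y1 with the sequence forms
    matters, so the formula is stated for any such pair of spaces. *)
Hypothesis cY0 : forall f, Y0 f <-> sum_space X0 X1 f /\ (nnorm Y0 f < +oo)%E.
Hypothesis cY1 : forall f, Y1 f <-> sum_space X0 X1 f /\ (nnorm Y1 f < +oo)%E.
Hypothesis nY0 : exists2 C : R, 0 < C & forall f,
  (nnorm Y0 f <= C%:E * N0' f)%E /\ (N0' f <= C%:E * nnorm Y0 f)%E.
Hypothesis nY1 : exists2 C : R, 0 < C & forall f,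
  (nnorm Y1 f <= C%:E * N1' f)%E /\ (N1' f <= C%:E * nnorm Y1 f)%E.
Hypotheses (pY0 : forall f, (0 <= nnorm Y0 f)%E) (pY1 : forall f, (0 <= nnorm Y1 f)%E).

Let g0 : normed_ge0 X0. Proof. exact: qb_ge0. Qed.
Let g1 : normed_ge0 X1. Proof. exact: qb_ge0. Qed.
Let K0 f : nonneg (K f). Proof. exact: Kseq_ge0. Qed.
Let r_gt0 n : 0 < r n. Proof. exact: (rho_gt0 hb0 hb1 hw0 hw1 fin0 fin1). Qed.
Let b0_gt0 n : 0 < b0 n. Proof. by case: hb0. Qed.
Let b1_gt0 n : 0 < b1 n. Proof. by case: hb1. Qed.
Let w0_gt0 n : 0 < w0 n. Proof. by case: hw0. Qed.
Let w1_gt0 n : 0 < w1 n. Proof. by case: hw1. Qed.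
Let lo_ge0 n f : (0 <= lo n f)%E. Proof. exact: (Lo_ge0 F0 w0 hb0 fin0). Qed.
Let up_ge0 n f : (0 <= up n f)%E. Proof. exact: (Up_ge0 F1 w1 hb1 fin1). Qed.

Definition holmstedt n f := (lo n f + (r n)%:E * up n f)%E.

Lemma holmstedt_ge0 n f : (0 <= holmstedt n f)%E.
Proof. by apply: adde_ge0; [exact: lo_ge0|apply: mule_ge0; [rewrite lee_fin ltW|exact: up_ge0]]. Qed.

Lemma lo_sub : exists2 C : R, 0 < C & forall n f f',
  (lo n (f + f') <= C%:E * (lo n f + lo n f'))%E /\
  (up n (f + f') <= C%:E * (up n f + up n f'))%E.
Proof.
have [C C1 HC] := K_add q0 q1; have C0 : 0 < C by lra.
exists C => // n f f'.
have h k : (K (f + f') k <= C%:E * (K f k + K f' k))%E by apply: HC; exact: expz_gt0.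
have s0 x : nonneg (smul w0 (K x)) by exact: smul_ge0.
have s1 x : nonneg (flip (smul w1 (K x))) by apply: flip_ge0; exact: smul_ge0.
have h0 := smul_sub w0_gt0 (K0 f) (K0 f') h.
have h1 k : (flip (smul w1 (K (f + f'))) k <=
    C%:E * (flip (smul w1 (K f)) k + flip (smul w1 (K f')) k))%E.
  exact: (smul_sub w1_gt0 (K0 f) (K0 f') h).
have rb1 k : 0 < flip b1 k by exact: b1_gt0.
split.
  rewrite /lo /Lo /P0 /Q0 addeACA ge0_muleDr; first last.
  - by apply: adde_ge0; exact: (Q0_ge0 F0 w0 hb0 fin0).
  - by apply: adde_ge0; exact: snorm_ge0.
  apply: leeD; first exact: (PL_sub E0 F0 b0_gt0 C0 (s0 _) (s0 _) (s0 _) h0).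
  apply: (QL_sub F0 C0 (s0 _) (s0 _) (s0 _) h0).
  exact: ltW (be0_gt0 hb0 fin0 n).
rewrite /up /Up /P1 /Q1 addeACA ge0_muleDr; first last.
- by apply: adde_ge0; exact: (Q1_ge0 F1 w1 hb1 fin1).
- by apply: adde_ge0; exact: snorm_ge0.
apply: leeD; first exact: (PL_sub E1 F1 rb1 C0 (s1 _) (s1 _) (s1 _) h1).
apply: (QL_sub F1 C0 (s1 _) (s1 _) (s1 _) h1).
exact: ltW (be1_gt0 hb1 fin1 n).
Qed.

(** Estimate Lo + rho Up on each component of an arbitrary decomposition in
    Y0 + Y1: the direct estimates are used for lo of f0 and up of f1, and the
    cross estimates for the other two. *)
Lemma holmstedt_le_K : exists2 C : R, 0 < C & forall n f, (holmstedt n f <= C%:E * Kfun Y0 Y1 f (r n))%E.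
Proof.
have [C C0 HC] := lo_sub; have [D0 D0p HD0] := nY0; have [D1 D1p HD1] := nY1.
have [A A0 HA] := Lo_le_N1 F0 F1 hb0 hb1 hw0 hw1 th01 fin0 fin1.
have [B B0 HB] := Up_le_N0 F0 F1 hb0 hb1 hw0 hw1 th01 fin0 fin1.
pose c0 := (2 + B) * D0; pose c1 := (A + 2) * D1.
have c0p : 0 < c0 by rewrite mulr_gt0 // addr_gt0.
have c1p : 0 < c1 by rewrite mulr_gt0 // addr_gt0.
exists (C * (c0 + c1)) => [|n f]; first by rewrite mulr_gt0 // addr_gt0.
have rn := r_gt0 n; have rn' := ltW rn; have rN := lt0r_neq0 rn.
apply: le_inv_scaleV; first by rewrite mulr_gt0 // addr_gt0.
apply: le_K => f0 f1 y0 y1 ->; apply: le_inv_scale; first by rewrite mulr_gt0 // addr_gt0.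
have [l u] := HC n f0 f1.
have l0 : (lo n f0 <= (2 * D0)%:E * nnorm Y0 f0)%E.
  apply: lee_scale_trans (proj2 (HD0 f0)); first by [].
  by apply: (Lo_le_N0 F0 hb0 hw0 fin0 n); exact: K0.
have l1 : (lo n f1 <= (A * D1)%:E * ((r n)%:E * nnorm Y1 f1))%E.
  have h := HA n _ (K0 f1); rewrite muleA -EFinM mulrAC.
  apply: (@lee_scale_trans R (A * r n) D1 _ (N1' f1)); [by rewrite mulr_ge0 // ltW|exact: h|].
  exact: (proj2 (HD1 f1)).
have u0 : ((r n)%:E * up n f0 <= (B * D0)%:E * nnorm Y0 f0)%E.
  have h := HB n _ (K0 f0).
  apply: (@lee_scale_trans R B D0 _ (N0' f0)); [exact: ltW| |exact: (proj2 (HD0 f0))].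
  apply: (le_trans (lee_wpmul2l _ h)); first by rewrite lee_fin.
  by rewrite muleA -EFinM mulrCA mulfV // mulr1; exact: lexx.
have u1 : ((r n)%:E * up n f1 <= (2 * D1)%:E * ((r n)%:E * nnorm Y1 f1))%E.
  rewrite [leRHS]muleCA; apply: lee_wpmul2l; first by rewrite lee_fin.
  apply: lee_scale_trans (proj2 (HD1 f1)); first by [].
  by apply: (Up_le_N1 F1 hb1 hw1 fin1 n); exact: K0.
set x := nnorm Y0 f0 in l0 u0 *; set y := ((r n)%:E * nnorm Y1 f1)%E in l1 u1 *.
have x0 : (0 <= x)%E by exact: pY0.
have yp : (0 <= y)%E by apply: mule_ge0; [rewrite lee_fin|exact: pY1].
have rup z : (0 <= (r n)%:E * up n z)%E by apply: mule_ge0; [rewrite lee_fin|exact: up_ge0].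
apply: (@le_trans _ _ (C%:E * ((lo n f0 + (r n)%:E * up n f0) + (lo n f1 + (r n)%:E * up n f1)))%E).
  rewrite addeACA ge0_muleDr; first last.
  - by apply: adde_ge0; exact: rup.
  - by apply: adde_ge0; exact: lo_ge0.
  apply: leeD; first exact: l.
  rewrite -ge0_muleDr ?up_ge0 // [leRHS]muleCA; apply: lee_wpmul2l; first by rewrite lee_fin.
  exact: u.
have h0 : (lo n f0 + (r n)%:E * up n f0 <= c0%:E * x)%E.
  by rewrite /c0 mulrDl; apply: add_le_const => //; rewrite mulr_ge0 // ltW.
have h1 : (lo n f1 + (r n)%:E * up n f1 <= c1%:E * y)%E.
  by rewrite /c1 mulrDl; apply: add_le_const => //; rewrite mulr_ge0 // ltW.
exact: (lee_combine (ltW C0) (ltW c0p) (ltW c1p) x0 yp h0 h1).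
Qed.

Lemma Kseq_min_l f (n k : int) : (k <= n)%R ->
  ((expR (k - n)%:~R)%:E * K f n <= K f k)%E.
Proof.
move=> kn; have h := K_scale g0 g1 f (expz_gt0 k) (_ : expz k <= expz n).
have kn' : expz k <= expz n :> R by rewrite /expz ler_expR ler_int.
have e : (expR (k - n)%:~R : R) = (expz n / expz k)^-1 by rewrite /expz -expRB -intrB -expRN -mulrNz opprB.
rewrite e; apply: le_inv_scale; first by rewrite divr_gt0 // expz_gt0.
exact: h.
Qed.

(** Decompose f nearly optimally for K(e^n, f; X0, X1).  The bounds K_f0 and
    K_f1 hold by this choice on one side of n, and on the other side because
    f0 = f - f1 and f1 = f - f0. *)
Lemma K_le_holmstedt : exists2 C : R, 0 < C & forall n f, sum_space X0 X1 f ->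
  (holmstedt n f < +oo)%E ->
  sum_space Y0 Y1 f /\ (Kfun Y0 Y1 f (r n) <= C%:E * holmstedt n f)%E.
Proof.
have [D0 D0p HD0] := nY0; have [D1 D1p HD1] := nY1.
have [A A0 HA] := N0_min F0 hb0 hw0 th0_gt0 fin0.
have [B B0 HB] := N1_max F1 hb1 hw1 fin1 th1_lt1.
have [C C1 HC] := K_add q0 q1; have C0 : 0 < C by lra.
have zeroY1 : Y1 0 /\ nnorm Y1 0 = 0%E.
  have z : nnorm Y1 0 = 0%E.
    apply/eqP; rewrite eq_le pY1 andbT; apply: (le_trans (proj1 (HD1 0))).
    have K00 k : K 0 k = 0%E.
      apply/eqP; rewrite eq_le K0 andbT; have := K_le (expz k) (qb_0 q0) (qb_0 q1).
      by rewrite addr0 qb_norm0 // qb_norm0 // mule0 adde0.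
    rewrite /N1' /N1 /NR (@snorm_eq _ _ _ (fun=> 0%E)) ?snorm0 ?mule0 // => k.
    rewrite /smul (@snorm_eq _ _ _ (fun=> 0%E)) ?snorm0 ?mule0 // => j.
    by rewrite /above K00 mule0 if_same.
  split => //; apply/cY1; rewrite z; split => //.
  by apply: sum_space_l => //; exact: qb_0.
have c3 : 0 < 3 * C by rewrite mulr_gt0.
pose M := 3 * C * (A * D0 + B * D1).
have AD : 0 < A * D0 by exact: mulr_gt0.
have BD : 0 < B * D1 by exact: mulr_gt0.
have M0 : 0 < M by rewrite mulr_gt0 // addr_gt0.
exists M => // n f xf holf.
have rn := r_gt0 n; have rn' := ltW rn.
(* If K vanishes there may be no nearly optimal decomposition, but then the norm
   of f in Y0 is 0 and f = f + 0 will do. *)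
have [Kn0|Knp] := eqVneq (K f n) 0%E.
  have Kz k : K f k = 0%E by apply: (K_eq0 g0 g1 _ _ Kn0); exact: expz_gt0.
  have z : nnorm Y0 f = 0%E.
    apply/eqP; rewrite eq_le pY0 andbT; apply: (le_trans (proj1 (HD0 f))).
    rewrite /N0' /N0 /NL (@snorm_eq _ _ _ (fun=> 0%E)) ?snorm0 ?mule0 // => k.
    rewrite /smul (@snorm_eq _ _ _ (fun=> 0%E)) ?snorm0 ?mule0 // => j.
    by rewrite /below Kz mule0 if_same.
  have Yf : Y0 f by apply/cY0; rewrite z.
  have [Y10 N10] := zeroY1; split; first by exists f, 0; rewrite addr0.
  have := K_le (r n) Yf Y10; rewrite addr0 z N10 mule0 adde0 => h.
  apply: (le_trans h); apply: mule_ge0; [by rewrite lee_fin ltW|exact: holmstedt_ge0].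
have Kpos : (0 < K f n)%E by rewrite lt0e Knp; exact: K0.
have [f0 [f1 [x0 x1 ef01 near]]] := K_near_min (expz_gt0 n) Kpos (K_fin q0 q1 (expz_gt0 n) xf).
rewrite -/(K f n) in near.
have p0 : (0 <= nnorm X0 f0)%E by exact: g0.
have p1 : (0 <= (expz n)%:E * nnorm X1 f1)%E.
  by apply: mule_ge0; [rewrite lee_fin ltW // expz_gt0|exact: g1].
have n0 : (nnorm X0 f0 <= 2%:E * K f n)%E by apply: le_trans near; exact: leeDl.
have n1 : ((expz n)%:E * nnorm X1 f1 <= 2%:E * K f n)%E by apply: le_trans near; exact: leeDr.
have k0 k : (K f0 k <= 2%:E * K f n)%E.
  apply: le_trans n0; have := K_le (expz k) x0 (qb_0 q1).
  by rewrite addr0 qb_norm0 // mule0 adde0.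
have k1 k : (K f1 k <= 2%:E * ((expR (k - n)%:~R)%:E * K f n))%E.
  have h := K_le (expz k) (qb_0 q0) x1; rewrite add0r qb_norm0 // add0e in h.
  apply: (le_trans h); rewrite [leRHS]muleCA.
  have e : (expz k)%:E = ((expR (k - n)%:~R)%:E * (expz n)%:E)%E :> \bar R.
    by rewrite -EFinM /expz -expRD -intrD subrK.
  by rewrite e -muleA; apply: lee_wpmul2l => //; rewrite lee_fin expR_ge0.
have e0 : f0 = f + (- f1) by rewrite ef01 addrK.
have e1 : f1 = f + (- f0) by rewrite ef01 addrAC subrr add0r.
have Kf k := K0 f k.
have three (x y : \bar R) := @lee_tripled R C x y (ltW C0).
have two3 (y : \bar R) : (0 <= y)%E -> (2%:E * y <= (3 * C)%:E * y)%E.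
  by move=> y0; apply: lee_wpmul2r => //; rewrite lee_fin; lra.
have K_f0 k : (K f0 k <= (3 * C)%:E * K f (Order.min k n))%E.
  case: (leP k n) => kn; last exact: (le_trans (k0 k) (two3 _ (Kf n))).
  rewrite {1}e0; apply: (le_trans (HC f (- f1) _ (expz_gt0 k))).
  rewrite (K_opp q0 q1); apply: three; first exact: Kf.
  apply: (le_trans (k1 k)); apply: lee_wpmul2l; first by rewrite lee_fin.
  exact: Kseq_min_l.
have K_f1 k : (K f1 k <= (3 * C)%:E * Kmax n (K f) k)%E.
  rewrite /Kmax; case: (leP k n) => kn.
    apply: (le_trans (k1 k)); apply: two3; apply: mule_ge0; [by rewrite lee_fin expR_ge0|exact: Kf].
  rewrite subrr expR0 mul1e {1}e1; apply: (le_trans (HC f (- f0) _ (expz_gt0 k))).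
  rewrite (K_opp q0 q1); apply: three; first exact: Kf.
  apply: (le_trans (k0 k)); apply: lee_wpmul2l; first by rewrite lee_fin.
  have kn' : expz n <= expz k :> R by rewrite /expz ler_expR ler_int ltW.
  exact: (@K_mono _ _ X0 X1 g1 f (expz n) (expz k) kn').
have up1 k : (K f k <= K f (k + 1)%R)%E by apply: Kseq_up.
have up2 : upreg (expR 1) (K f) by apply: Kseq_upreg.
have N0f : (N0' f0 <= (3 * C)%:E * N0 E0 F0 b0 w0 (fun k => K f (Order.min k n)))%E.
  have m0 : nonneg (fun k => K f (Order.min k n)) by move=> k; exact: Kf.
  apply: snorm_le_scale => //; try exact: smul_snorm_ge0.
  move=> j; rewrite /smul [leRHS]muleCA; apply: lee_wpmul2l; first by rewrite lee_fin ltW.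
  apply: snorm_le_scale => //; try (apply: below_ge0; exact: smul_ge0).
  move=> k; rewrite /below; case: ifP => _; last by rewrite mule0.
  by rewrite [leRHS]muleCA; apply: lee_wpmul2l; [rewrite lee_fin ltW|exact: K_f0].
have N1f : (N1' f1 <= (3 * C)%:E * N1 E1 F1 b1 w1 (Kmax n (K f)))%E.
  have m0 : nonneg (Kmax n (K f)).
    by move=> k; apply: mule_ge0; [rewrite lee_fin expR_ge0|exact: Kf].
  apply: snorm_le_scale => //; try exact: smul_snorm_ge0.
  move=> j; rewrite /smul [leRHS]muleCA; apply: lee_wpmul2l; first by rewrite lee_fin ltW.
  apply: snorm_le_scale => //; try (apply: above_ge0; exact: smul_ge0).
  move=> k; rewrite /above; case: ifP => _; last by rewrite mule0.
  by rewrite [leRHS]muleCA; apply: lee_wpmul2l; [rewrite lee_fin ltW|exact: K_f1].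
have y0 : (nnorm Y0 f0 <= (3 * C * (A * D0))%:E * lo n f)%E.
  have -> : 3 * C * (A * D0) = D0 * (3 * C * A) by ring.
  apply: lee_scale_trans (proj1 (HD0 f0)) _; first exact: ltW.
  apply: lee_scale_trans N0f _; first exact: ltW.
  exact: HA.
have y1 : (nnorm Y1 f1 <= (3 * C * (B * D1))%:E * up n f)%E.
  have -> : 3 * C * (B * D1) = D1 * (3 * C * B) by ring.
  apply: lee_scale_trans (proj1 (HD1 f1)) _; first exact: ltW.
  apply: lee_scale_trans N1f _; first exact: ltW.
  exact: HB.
have rup : (0 <= (r n)%:E * up n f)%E by apply: mule_ge0; [rewrite lee_fin|exact: up_ge0].
have lofin : (lo n f < +oo)%E.
  by apply: le_lt_trans holf; rewrite /holmstedt leeDl.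
have rupfin : ((r n)%:E * up n f < +oo)%E.
  by apply: le_lt_trans holf; rewrite /holmstedt leeDr.
have upfin : (up n f < +oo)%E.
  by move: rupfin; rewrite (lty_scale _ rn).
have Yf0 : Y0 f0.
  apply/cY0; split; first exact: sum_space_l.
  by apply: le_lt_trans y0 _; rewrite lty_scale // mulr_gt0.
have Yf1 : Y1 f1.
  apply/cY1; split; first exact: sum_space_r.
  by apply: le_lt_trans y1 _; rewrite lty_scale // mulr_gt0.
split; first by exists f0, f1.
rewrite {1}ef01; apply: (le_trans (K_le (r n) Yf0 Yf1)).
rewrite /holmstedt ge0_muleDr //; apply: leeD.
  apply: (le_trans y0); apply: lee_wpmul2r => //.
  by rewrite lee_fin /M mulrDr lerDl mulr_ge0 // ltW.
rewrite [leRHS]muleCA; apply: lee_wpmul2l; first by rewrite lee_fin.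
apply: (le_trans y1); apply: lee_wpmul2r => //.
by rewrite lee_fin /M mulrDr lerDr mulr_ge0 // ltW.
Qed.

End Holmstedt.

(** * Hardy inequalities for both halves *)

Section HardyHalves.
Context {R : realType}.
Variables (E E0 F0 E1 F1 : ri_space R) (b0 b1 w0 w1 : int -> R) (th0 th1 : R).
Hypotheses (hb0 : rvseq 0 b0) (hb1 : rvseq 0 b1).
Hypotheses (hw0 : rvseq (- th0) w0) (hw1 : rvseq (- th1) w1).
Hypothesis fin0 : (snorm E0 (above 0 (emb b0)) < +oo)%E.
Hypothesis fin1 : (snorm E1 (below 0 (emb b1)) < +oo)%E.

Let b1_gt0 n : 0 < b1 n. Proof. by case: hb1. Qed.
Let w0_gt0 n : 0 < w0 n. Proof. by case: hw0. Qed.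
Let w1_gt0 n : 0 < w1 n. Proof. by case: hw1. Qed.
Let be1_pos n : 0 < be1 E1 b1 n. Proof. exact: be1_gt0. Qed.

Let hrb1 : rvseq 0 (flip b1).
Proof. by apply: (rvseq_eq (rvseq_opp hb1)) => //; rewrite oppr0. Qed.

Let fin1' : (snorm E1 (above 0 (emb (flip b1))) < +oo)%E.
Proof.
by have := fin1; rewrite snorm_below_flip ?oppr0 //; exact: emb_ge0.
Qed.

Lemma snorm_smulD (om : int -> R) (x y : int -> \bar R) : (forall n, 0 < om n) ->
  nonneg x -> nonneg y ->
  (snorm E (smul om (fun n => x n + y n)) <= snorm E (smul om x) + snorm E (smul om y))%E.
Proof.
move=> om0 x0 y0; apply: le_trans (snormD E (smul_ge0 om0 x0) (smul_ge0 om0 y0)).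
apply: snorm_le => n; first by apply: smul_ge0 => // k; exact: adde_ge0.
by rewrite /smul ge0_muleDr //; exact: lexx.
Qed.

Lemma smulM (v w : int -> R) (x : int -> \bar R) :
  smul v (smul w x) = smul (fun n => v n * w n)%R x.
Proof. by apply/funext => n; rewrite /smul muleA -EFinM. Qed.

Lemma Lo_hardy (al : R) (om : int -> R) : rvseq al om -> al < 0 ->
  exists2 C : R, 0 < C & forall K, nonneg K ->
   (snorm E (smul om (fun n => Lo E0 F0 b0 w0 n K)) <=
     C%:E * snorm E (smul (fun n => om n * be0 E0 b0 n * w0 n)%R K))%E.
Proof.
move=> hom al0; have [om0 _] := hom.
have [C C0 HC] := PL_hardy F0 hb0 fin0 E hom al0.
have [D D0 HD] := QL_hardy F0 hb0 fin0 E hom al0.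
exists (C + D) => [|K K0]; first exact: addr_gt0.
have wK : nonneg (smul w0 K) by exact: smul_ge0.
rewrite -smulM.
apply: (le_trans (snorm_smulD om0 _ _)).
- by move=> n; exact: P0_ge0.
- by move=> n; exact: (Q0_ge0 F0 w0 hb0 fin0).
apply: add_le_const; [exact: snorm_ge0|exact: ltW|exact: ltW| |].
  exact: (HC _ wK).
exact: (HD _ wK).
Qed.

Lemma Up_hardy (al : R) (om : int -> R) : rvseq al om -> 0 < al ->
  exists2 C : R, 0 < C & forall K, nonneg K ->
   (snorm E (smul om (fun n => Up E1 F1 b1 w1 n K)) <=
     C%:E * snorm E (smul (fun n => om n * be1 E1 b1 n * w1 n)%R K))%E.
Proof.
move=> hom al0; have [om0 _] := hom.
have al0' : - al < 0 by rewrite oppr_lt0.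
have hrom : rvseq (- al) (flip om) by exact: rvseq_opp.
have [C C0 HC] := PL_hardy F1 hrb1 fin1' E hrom al0'.
have [D D0 HD] := QL_hardy F1 hrb1 fin1' E hrom al0'.
exists (C + D) => [|K K0]; first exact: addr_gt0.
have wK : nonneg (flip (smul w1 K)) by exact/flip_ge0/smul_ge0.
have P0 : nonneg (fun n => P1 E1 F1 b1 w1 n K) by move=> n; exact: P1_ge0.
have Q0 : nonneg (fun n => Q1 E1 F1 b1 w1 n K) by move=> n; exact: (Q1_ge0 F1 w1 hb1 fin1).
have e : snorm E (smul (fun n => om n * be1 E1 b1 n * w1 n)%R K) =
    snorm E (smul (fun n => flip om n * tail_norm E1 (flip b1) n)%R (flip (smul w1 K))).
  rewrite -snorm_flip; last by apply: smul_ge0 => // n; rewrite !mulr_gt0.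
  by apply: snorm_eq => n; rewrite /flip /smul /be1 opprK muleA -EFinM.
have e1 : snorm E (smul om (fun n => P1 E1 F1 b1 w1 n K)) =
    snorm E (smul (flip om) (fun n => PL E1 F1 (flip b1) n (flip (smul w1 K)))).
  rewrite -[LHS](snorm_flip E (smul_ge0 om0 P0)).
  by apply: snorm_eq => n; rewrite {1}/flip /smul /P1 /PR opprK.
have e2 : snorm E (smul om (fun n => Q1 E1 F1 b1 w1 n K)) =
    snorm E (smul (flip om) (fun n => QL E1 F1 (flip b1) n (flip (smul w1 K)))).
  rewrite -[LHS](snorm_flip E (smul_ge0 om0 Q0)).
  by apply: snorm_eq => n; rewrite {1}/flip /smul /Q1 /QR opprK.
apply: (le_trans (snorm_smulD om0 P0 Q0)).
rewrite e e1 e2; apply: add_le_const; [exact: snorm_ge0|exact: ltW|exact: ltW| |].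
  exact: (HC _ wK).
exact: (HD _ wK).
Qed.

Lemma le_Q0 (al : R) (om : int -> R) : rvseq al om ->
  exists2 C : R, 0 < C & forall K, nonneg K -> upreg (expR 1) K ->
   (snorm E (smul (fun n => om n * be0 E0 b0 n * w0 n)%R K) <=
      C%:E * snorm E (smul om (fun n => Q0 E0 F0 b0 w0 n K)))%E.
Proof.
move=> hom; have [D D0 HD] := rvseq_near hw0.
have c0 : 0 < D * expR 1 by rewrite mulr_gt0 // expR_gt0.
exists (D * expR 1 / phi F0) => [|K K0 K1]; first by rewrite divr_gt0 // phi_gt0.
have wK : nonneg (smul w0 K) by exact: smul_ge0.
rewrite -smulM; apply: (le_QL F0 hb0 fin0 E hom c0 wK) => n.
have u : upreg (D * expR 1) (smul w0 K).
  apply: (@upreg_smul R D (expR 1) w0 K w0_gt0 K0 (expR_ge0 _) _ K1) => k.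
  by apply: HD; rewrite addrAC subrr add0r.
by have := u (n - 1); rewrite subrK.
Qed.

Lemma le_Q1 (al : R) (om : int -> R) : rvseq al om ->
  exists2 C : R, 0 < C & forall K, nonneg K -> dnreg 1 K ->
   (snorm E (smul (fun n => om n * be1 E1 b1 n * w1 n)%R K) <=
      C%:E * snorm E (smul om (fun n => Q1 E1 F1 b1 w1 n K)))%E.
Proof.
move=> hom; have [D D0 HD] := rvseq_near hw1; have [om0 _] := hom.
have c0 : 0 < D * 1 by rewrite mulr1.
have hrom : rvseq (- al) (flip om) by exact: rvseq_opp.
exists (D * 1 / phi F1) => [|K K0 K1]; first by rewrite divr_gt0 // phi_gt0.
have wK : nonneg (flip (smul w1 K)) by exact/flip_ge0/smul_ge0.
have Q0 : nonneg (fun n => Q1 E1 F1 b1 w1 n K) by move=> n; exact: (Q1_ge0 F1 w1 hb1 fin1).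
have e : snorm E (smul (fun n => om n * be1 E1 b1 n * w1 n)%R K) =
    snorm E (smul (fun n => flip om n * tail_norm E1 (flip b1) n)%R (flip (smul w1 K))).
  rewrite -snorm_flip; last by apply: smul_ge0 => // n; rewrite !mulr_gt0.
  by apply: snorm_eq => n; rewrite /flip /smul /be1 opprK muleA -EFinM.
have e2 : snorm E (smul om (fun n => Q1 E1 F1 b1 w1 n K)) =
    snorm E (smul (flip om) (fun n => QL E1 F1 (flip b1) n (flip (smul w1 K)))).
  rewrite -[LHS](snorm_flip E (smul_ge0 om0 Q0)).
  by apply: snorm_eq => n; rewrite {1}/flip /smul /Q1 /QR opprK.
rewrite e e2; apply: (le_QL F1 hrb1 fin1' E hrom c0 wK) => n.
have u : dnreg (D * 1) (smul w1 K).
  apply: (@dnreg_smul R D 1 w1 K w1_gt0 K0 ler01 _ K1) => k; apply: HD.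
  by rewrite opprD addrA subrr add0r.
by have := u (- n); rewrite /flip opprB addrC.
Qed.

End HardyHalves.

(** * Sampling with constants uniform in the function *)

Section Families.
Context {R : realType} {T : Type}.
Implicit Types (G : T -> R -> \bar R) (x : T -> int -> \bar R).

(** Sampling of functions that depend on a parameter f (a vector of the couple),
    with one constant for all values of the parameter, as equivalence of norms
    requires. *)
Definition fsampled G x := [/\ forall f t, 0 < t -> (0 <= G f t)%E, forall f, nonneg (x f) &
  exists2 c : R, 0 < c & forall f, sampled c (G f) (x f)].
Definition fupreg x := exists2 d : R, 1 <= d & forall f, upreg d (x f).
Definition fdnreg x := exists2 d : R, 1 <= d & forall f, dnreg d (x f).

Lemma fsampled_wmul (a : R -> R) (v : int -> R) G x : rsampled a v -> fsampled G x ->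
  fsampled (fun f => wmul a (G f)) (fun f => smul v (x f)).
Proof.
move=> h [G0 x0 [d d0 hs]]; have [c c0 hc] := sampled_wmul h; have [a0 v0 _] := h; split.
- move=> f t t0; apply: mule_ge0; [rewrite lee_fin ltW //; exact: a0|exact: G0].
- by move=> f; exact: smul_ge0.
exists (c * d) => [|f]; first exact: mulr_gt0.
apply: hc => //; exact: G0.
Qed.

Lemma fsampled_below F G x : fsampled G x -> fupreg x ->
  fsampled (fun f t => tnorm_on F `]0, t[ (G f)) (fun f n => snorm F (below n (x f))).
Proof.
move=> [G0 x0 [c c0 hs]] [d d1 hd]; split.
- by move=> f t _; exact: tnorm_ge0.
- by move=> f n; exact: snorm_ge0.
exists (c * d) => [|f]; first by rewrite mulr_gt0 //; lra.
by apply: sampled_below => //; exact: G0.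
Qed.

Lemma fsampled_above F G x : fsampled G x -> fdnreg x ->
  fsampled (fun f t => tnorm_on F `]t, +oo[ (G f)) (fun f n => snorm F (above n (x f))).
Proof.
move=> [G0 x0 [c c0 hs]] [d d1 hd]; split.
- by move=> f t _; exact: tnorm_ge0.
- by move=> f n; exact: snorm_ge0.
exists (c * d) => [|f]; first by rewrite mulr_gt0 //; lra.
by apply: sampled_above => //; exact: G0.
Qed.

Lemma fupreg_smul al (v : int -> R) x : rvseq al v -> (forall f, nonneg (x f)) -> fupreg x ->
  fupreg (fun f => smul v (x f)).
Proof.
move=> hv x0 [d d1 hd]; have [v0 _] := hv; have [D D0 HD] := rvseq_near hv.
have d0 : 0 <= d by lra.
exists ((1 + D) * d) => [|f].
  have q : 0 <= D * d by rewrite mulr_ge0 // ltW.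
  by rewrite mulrDl mul1r; lra.
apply: upreg_smul => // n; apply: (le_trans (HD (n + 1) n _)).
  by rewrite addrAC subrr add0r.
by rewrite ler_pM2r //; lra.
Qed.

Lemma fdnreg_smul al (v : int -> R) x : rvseq al v -> (forall f, nonneg (x f)) -> fdnreg x ->
  fdnreg (fun f => smul v (x f)).
Proof.
move=> hv x0 [d d1 hd]; have [v0 _] := hv; have [D D0 HD] := rvseq_near hv.
have d0 : 0 <= d by lra.
exists ((1 + D) * d) => [|f].
  have q : 0 <= D * d by rewrite mulr_ge0 // ltW.
  by rewrite mulrDl mul1r; lra.
apply: dnreg_smul => // n; apply: (le_trans (HD n (n + 1) _)).
  by rewrite opprD addrA subrr add0r.
by rewrite ler_pM2r //; lra.
Qed.

Lemma fupreg_below F x : (forall f, nonneg (x f)) -> fupreg x ->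
  fupreg (fun f n => snorm F (below n (x f))).
Proof. by move=> x0 [d d1 hd]; exists d => // f; apply: upreg_below => //; lra. Qed.

Lemma fdnreg_above F x : (forall f, nonneg (x f)) -> fdnreg x ->
  fdnreg (fun f n => snorm F (above n (x f))).
Proof. by move=> x0 [d d1 hd]; exists d => // f; apply: dnreg_above => //; lra. Qed.

Lemma fsampled_tnorm E G x : fsampled G x -> exists2 C : R, 0 < C & forall f,
  (tnorm E (G f) <= C%:E * snorm E (x f))%E /\ (snorm E (x f) <= C%:E * tnorm E (G f))%E.
Proof.
by move=> [G0 x0 [c c0 hs]]; exists c => // f; apply: tnorm_sampled => //; exact: G0.
Qed.

End Families.

Section Auxiliary.
Context {R : realType}.
Implicit Types (E F : ri_space R).

Lemma rvfun_eq (al be : R) (a : R -> R) : rvfun al a -> al = be -> rvfun be a.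
Proof. by move=> h <-. Qed.

Lemma rvfun_weight (th : R) (a : R -> R) : slowly_varying a ->
  rvfun (- th) (fun s => s `^ (- th) * a s).
Proof. by move=> /rvfun_sv ha; apply: rvfun_eq (rvfun_mul (rvfun_pow (- th)) ha) _; rewrite addr0. Qed.

Lemma rsampled_eq (a : R -> R) (v v' : int -> R) : rsampled a v -> v =1 v' -> rsampled a v'.
Proof. by move=> h e; have <- : v = v' by apply/funext. Qed.

(** The real-valued weights of the theorem are finite parts of extended norms.
    Finiteness is automatic here, as the norms are comparable to a positive real
    sequence. *)
Lemma rsampled_fine (g : R -> \bar R) (v : int -> R) (c : R) : 0 < c -> (forall n, 0 < v n) ->
  (forall t, 0 < t -> (0 <= g t)%E) -> sampled c g (emb v) -> rsampled (fun t => fine (g t)) v.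
Proof.
move=> c0 v0 g0 s.
have fin t : 0 < t -> g t = (fine (g t))%:E.
  move=> t0; rewrite fineK // ge0_fin_numE; last exact: g0.
  by have [h _] := s t t0; apply: (le_lt_trans h); rewrite /emb -EFinM ltry.
have key t : 0 < t -> fine (g t) <= c * v (cell_of t) /\ v (cell_of t) <= c * fine (g t).
  by move=> t0; have := s t t0; rewrite (fin t t0) /emb -!EFinM !lee_fin.
split => //; last by exists c.
move=> t t0; have [_ h] := key t t0.
by have := lt_le_trans (v0 (cell_of t)) h; rewrite pmulr_rgt0.
Qed.

Lemma fsampled_emb (T : Type) (a : R -> R) (v : int -> R) : rsampled a v ->
  fsampled (fun (_ : T) t => (a t)%:E) (fun=> emb v).
Proof.
move=> [a0 v0 [c c0 h]]; split.
- by move=> _ t t0; rewrite lee_fin ltW // a0.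
- by move=> _; exact: emb_ge0.
by exists c.
Qed.

Lemma fdnreg_emb (T : Type) al (v : int -> R) : rvseq al v -> fdnreg (fun (_ : T) => emb v).
Proof.
move=> hv; have [v0 _] := hv; have [D D0 HD] := rvseq_near hv.
exists (1 + D) => [|_ n]; first lra.
rewrite /emb -EFinM lee_fin; apply: (le_trans (HD n (n + 1) _)).
  by rewrite opprD addrA subrr add0r.
by rewrite ler_pM2r //; lra.
Qed.

Lemma fupreg_emb (T : Type) al (v : int -> R) : rvseq al v -> fupreg (fun (_ : T) => emb v).
Proof.
move=> hv; have [v0 _] := hv; have [D D0 HD] := rvseq_near hv.
exists (1 + D) => [|_ n]; first lra.
rewrite /emb -EFinM lee_fin; apply: (le_trans (HD (n + 1) n _)).
  by rewrite addrAC subrr add0r.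
by rewrite ler_pM2r //; lra.
Qed.

(** rho^(-th) e^(-th0) A, where rho = e^(th1 - th0) A / B, is the weight
    e^(-th~) A^(1-th) B^th of the space in part (a). *)
Lemma weight_identity (e A B th0 th1 th : R) : 0 < e -> 0 < A -> 0 < B ->
  (e `^ (th1 - th0) * (A / B)) `^ (- th) * (e `^ (- th0) * A) =
  e `^ (- ((1 - th) * th0 + th * th1)) * (A `^ (1 - th) * B `^ th).
Proof.
move=> e0 A0 B0.
have log (x : R) : 0 < x -> exists y, x = expR y by move=> x0; exists (ln x); rewrite lnK.
have [l ->] := log _ e0; have [x ->] := log _ A0; have [y ->] := log _ B0.
rewrite -!expRM -expRB -!expRD -expRM -!expRD; congr expR; ring.
Qed.

End Auxiliary.

(** * Reiteration *)

Section Reiteration.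
Context {R : realType} {V : lmodType R}.
Variables (X0 X1 : nspace V) (theta0 theta1 : R).
Variables (E E0 E1 F0 F1 : ri_space R) (a0 a1 b b0 b1 : R -> R).
Hypotheses (q0 : quasi_banach X0) (q1 : quasi_banach X1).
Hypotheses (htheta0 : 0 < theta0) (htheta01 : theta0 < theta1) (htheta1 : theta1 < 1).
Hypotheses (ha0 : slowly_varying a0) (ha1 : slowly_varying a1) (hb : slowly_varying b).
Hypotheses (hb0 : slowly_varying b0) (hb1 : slowly_varying b1).
Hypothesis hb0E0 : (wnorm_on E0 `]1%R, +oo[ b0 < +oo)%E.
Hypothesis hb1E1 : (wnorm_on E1 `]0%R, 1%R[ b1 < +oo)%E.

Let beta0 u : R := fine (wnorm_on E0 `]u, +oo[ b0).
Let beta1 u : R := fine (wnorm_on E1 `]0, u[ b1).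
Let rhof u : R := u `^ (theta1 - theta0) * ((a0 u * beta0 u) / (a1 u * beta1 u)).
Let Y0 := spaceL X0 X1 theta0 b0 E0 a0 F0.
Let Y1 := spaceR X0 X1 theta1 b1 E1 a1 F1.

Let v0 n := b0 (expz n).
Let v1 n := b1 (expz n).
Let w0 n := expz n `^ (- theta0) * a0 (expz n).
Let w1 n := expz n `^ (- theta1) * a1 (expz n).
Let K := Kseq X0 X1.

Let sv0 : rsampled b0 v0. Proof. exact: rvfun_sampled (rvfun_sv hb0). Qed.
Let sv1 : rsampled b1 v1. Proof. exact: rvfun_sampled (rvfun_sv hb1). Qed.
Let pv0 : rvseq 0 v0. Proof. exact: rvfun_rvseq (rvfun_sv hb0). Qed.
Let pv1 : rvseq 0 v1. Proof. exact: rvfun_rvseq (rvfun_sv hb1). Qed.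
Let sw0 : rsampled (fun s => s `^ (- theta0) * a0 s) w0. Proof. exact: rvfun_sampled (rvfun_weight theta0 ha0). Qed.
Let sw1 : rsampled (fun s => s `^ (- theta1) * a1 s) w1. Proof. exact: rvfun_sampled (rvfun_weight theta1 ha1). Qed.
Let pw0 : rvseq (- theta0) w0. Proof. exact: rvfun_rvseq (rvfun_weight theta0 ha0). Qed.
Let pw1 : rvseq (- theta1) w1. Proof. exact: rvfun_rvseq (rvfun_weight theta1 ha1). Qed.

Let g0 : normed_ge0 X0. Proof. exact: qb_ge0. Qed.
Let g1 : normed_ge0 X1. Proof. exact: qb_ge0. Qed.

Lemma fsampled_K (Z0 Z1 : nspace V) : normed_ge0 Z0 -> normed_ge0 Z1 ->
  fsampled (Kfun Z0 Z1) (Kseq Z0 Z1).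
Proof.
move=> h0 h1; split.
- by move=> f t t0; exact: K_ge0.
- by move=> f; exact: Kseq_ge0.
exists (expR 1) => [|f]; first exact: expR_gt0.
exact: K_sampled.
Qed.

Let K0 f : nonneg (K f). Proof. exact: Kseq_ge0. Qed.
Let Kup f : upreg (expR 1) (K f). Proof. exact: Kseq_upreg. Qed.
Let Kdn f : dnreg 1 (K f).
Proof. by move=> n; rewrite mul1e; exact: Kseq_up. Qed.
Let fK : fsampled (Kfun X0 X1) K. Proof. exact: fsampled_K. Qed.
Let fupK : fupreg K.
Proof. by exists (expR 1) => //; rewrite -[leLHS]expR0 ler_expR. Qed.
Let fdnK : fdnreg K. Proof. by exists 1. Qed.

Let w0_gt0 n : 0 < w0 n. Proof. by case: pw0. Qed.
Let w1_gt0 n : 0 < w1 n. Proof. by case: pw1. Qed.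
Let v1_gt0 n : 0 < v1 n. Proof. by case: pv1. Qed.

(* The inner norms in the definitions of Y0 and Y1, as functions and as
   sequences. *)
Let inL f t := tnorm_on F0 `]0, t[ (weighted theta0 a0 (Kfun X0 X1 f)).
Let inR f t := tnorm_on F1 `]t, +oo[ (weighted theta1 a1 (Kfun X0 X1 f)).
Let dL f n := snorm F0 (below n (smul w0 (K f))).
Let dR f n := snorm F1 (above n (smul w1 (K f))).

Let wK0 f : nonneg (smul w0 (K f)). Proof. exact: smul_ge0. Qed.
Let wK1 f : nonneg (smul w1 (K f)). Proof. exact: smul_ge0. Qed.

Let fL : fsampled inL dL.
Proof. exact: fsampled_below (fsampled_wmul sw0 fK) (fupreg_smul pw0 K0 fupK). Qed.
Let fR : fsampled inR dR.
Proof. exact: fsampled_above (fsampled_wmul sw1 fK) (fdnreg_smul pw1 K0 fdnK). Qed.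
Let fupL : fupreg dL. Proof. exact: fupreg_below wK0 (fupreg_smul pw0 K0 fupK). Qed.
Let fdnR : fdnreg dR. Proof. exact: fdnreg_above wK1 (fdnreg_smul pw1 K0 fdnK). Qed.
Let dL0 f : nonneg (dL f). Proof. by move=> n; exact: snorm_ge0. Qed.
Let dR0 f : nonneg (dR f). Proof. by move=> n; exact: snorm_ge0. Qed.

Let sb0 : exists2 c : R, 0 < c & sampled c (fun t => wnorm_on E0 `]t, +oo[ b0)
  (fun n => snorm E0 (above n (emb v0))).
Proof.
have [_ _ [c c0 h]] := fsampled_above E0 (fsampled_emb unit sv0) (fdnreg_emb unit pv0).
by exists c => //; exact: (h tt).
Qed.

Let sb1 : exists2 c : R, 0 < c & sampled c (fun t => wnorm_on E1 `]0, t[ b1)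
  (fun n => snorm E1 (below n (emb v1))).
Proof.
have [_ _ [c c0 h]] := fsampled_below E1 (fsampled_emb unit sv1) (fupreg_emb unit pv1).
by exists c => //; exact: (h tt).
Qed.

Let cell_of1 : cell_of (1 : R) = 0.
Proof. by have := @cell_of_expz R 0; rewrite /expz expR0. Qed.

Let fin0 : (snorm E0 (above 0 (emb v0)) < +oo)%E.
Proof.
have [c c0 s] := sb0; have [_] := s 1 ltr01; rewrite cell_of1 => h.
by apply: (le_lt_trans h); rewrite lty_scale.
Qed.

Let fin1 : (snorm E1 (below 0 (emb v1)) < +oo)%E.
Proof.
have [c c0 s] := sb1; have [_] := s 1 ltr01; rewrite cell_of1 => h.
by apply: (le_lt_trans h); rewrite lty_scale.
Qed.

Let d0 n := be0 E0 v0 n.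
Let d1 n := be1 E1 v1 n.
Let r := rho E0 E1 v0 v1 w0 w1.

Let d0_gt0 n : 0 < d0 n. Proof. exact: be0_gt0. Qed.
Let d1_gt0 n : 0 < d1 n. Proof. exact: be1_gt0. Qed.

Let sbeta0 : rsampled beta0 d0.
Proof.
have [c c0 s] := sb0; apply: (rsampled_fine c0 d0_gt0) => [t _|t t0]; first exact: tnorm_ge0.
by have := s t t0; rewrite (be0E pv0 fin0).
Qed.

Let sbeta1 : rsampled beta1 d1.
Proof.
have [c c0 s] := sb1; apply: (rsampled_fine c0 d1_gt0) => [t _|t t0]; first exact: tnorm_ge0.
by have := s t t0; rewrite (be1E pv1 fin1).
Qed.

Let sa0 : rsampled a0 (fun n => a0 (expz n)). Proof. exact: rvfun_sampled (rvfun_sv ha0). Qed.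
Let sa1 : rsampled a1 (fun n => a1 (expz n)). Proof. exact: rvfun_sampled (rvfun_sv ha1). Qed.
Let a0_gt0 n : 0 < a0 (expz n). Proof. by case: sa0. Qed.
Let a1_gt0 n : 0 < a1 (expz n). Proof. by case: sa1. Qed.

Let rE n : r n = expz n `^ (theta1 - theta0) * ((a0 (expz n) * d0 n) / (a1 (expz n) * d1 n)).
Proof.
have e0 := expz_gt0 (R := R) n.
have -> : expz n `^ (theta1 - theta0) = expz n `^ (- theta0) / expz n `^ (- theta1).
  by rewrite /expz -!expRM -expRB; congr expR; ring.
have := lt0r_neq0 (a1_gt0 n); have := lt0r_neq0 (d1_gt0 n).
have := lt0r_neq0 (powR_gt0 (- theta1) e0).
rewrite /r /rho -/(d0 n) -/(d1 n) /w0 /w1.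
by move=> h1 h2 h3; field; rewrite h1 h2 h3.
Qed.

Let srho : rsampled rhof r.
Proof.
apply: rsampled_eq (rsampled_mul (rvfun_sampled (rvfun_pow (theta1 - theta0)))
  (rsampled_mul (rsampled_mul sa0 sbeta0) (rsampled_inv (rsampled_mul sa1 sbeta1)))) _ => n.
by rewrite rE.
Qed.

Let prho : rvseq (theta1 - theta0) r.
Proof. exact: rvseq_rho pv0 pv1 pw0 pw1 fin0 fin1. Qed.
Let r_gt0 n : 0 < r n. Proof. by case: prho. Qed.
Let de0 : 0 < theta1 - theta0. Proof. by rewrite subr_gt0. Qed.

Let sbrho : rsampled (b \o rhof) (fun n => b (r n)).
Proof. exact: rsampled_comp (rvfun_sv hb) srho. Qed.
Let pbrho : rvseq 0 (fun n => b (r n)).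
Proof. exact: rvseq_comp (rvfun_sv hb) prho. Qed.

Let cY0 f : Y0 f <-> sum_space X0 X1 f /\ (nnorm Y0 f < +oo)%E. Proof. by []. Qed.
Let cY1 f : Y1 f <-> sum_space X0 X1 f /\ (nnorm Y1 f < +oo)%E. Proof. by []. Qed.
Let pY0 f : (0 <= nnorm Y0 f)%E. Proof. exact: tnorm_ge0. Qed.
Let pY1 f : (0 <= nnorm Y1 f)%E. Proof. exact: tnorm_ge0. Qed.

Let nY0 : exists2 C : R, 0 < C & forall f,
  (nnorm Y0 f <= C%:E * N0 E0 F0 v0 w0 (K f))%E /\ (N0 E0 F0 v0 w0 (K f) <= C%:E * nnorm Y0 f)%E.
Proof. exact: (fsampled_tnorm E0 (fsampled_wmul sv0 fL)). Qed.

Let nY1 : exists2 C : R, 0 < C & forall f,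
  (nnorm Y1 f <= C%:E * N1 E1 F1 v1 w1 (K f))%E /\ (N1 E1 F1 v1 w1 (K f) <= C%:E * nnorm Y1 f)%E.
Proof. exact: (fsampled_tnorm E1 (fsampled_wmul sv1 fR)). Qed.

Let H := holmstedt X0 X1 E0 F0 E1 F1 v0 v1 w0 w1.

Let H0 n f : (0 <= H n f)%E.
Proof. exact: (holmstedt_ge0 X0 X1 F0 F1 pv0 pv1 pw0 pw1 fin0 fin1). Qed.

Lemma cap_space_carrier (A B : nspace V) :
  (forall f, A f <-> sum_space X0 X1 f /\ (nnorm A f < +oo)%E) ->
  (forall f, B f <-> sum_space X0 X1 f /\ (nnorm B f < +oo)%E) ->
  forall f, cap_space A B f <-> sum_space X0 X1 f /\ (nnorm (cap_space A B) f < +oo)%E.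
Proof.
move=> hA hB f; rewrite /cap_space /= gt_max; split.
  by move=> [/hA [s a] /hB [_ c]]; rewrite a c.
by move=> [s /andP[a c]]; split; [apply/hA|apply/hB].
Qed.

(** Here S is the norm of the Holmstedt functional and S1, S2 are its two terms
    that survive in the limiting case; a Hardy inequality bounds the other two by a
    multiple of S1, whence the constant in front of S1. *)
Lemma cap_space_equiv (A B : nspace V) (S1 S2 S : V -> \bar R) :
  (forall f, (0 <= nnorm A f)%E) -> (forall f, (0 <= nnorm B f)%E) ->
  (exists2 C : R, 0 < C & forall f,
     (nnorm A f <= C%:E * S1 f)%E /\ (S1 f <= C%:E * nnorm A f)%E) ->
  (exists2 C : R, 0 < C & forall f,
     (nnorm B f <= C%:E * S2 f)%E /\ (S2 f <= C%:E * nnorm B f)%E) ->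
  (forall f, (0 <= S f)%E) -> (forall f, (S1 f <= S f)%E) -> (forall f, (S2 f <= S f)%E) ->
  (exists2 C : R, 0 < C & forall f, (S f <= C%:E * S1 f + S2 f)%E) ->
  exists2 C : R, 0 < C & forall f,
     (nnorm (cap_space A B) f <= C%:E * S f)%E /\ (S f <= C%:E * nnorm (cap_space A B) f)%E.
Proof.
move=> A0 B0 [C C0 HC] [D D0 HD] S0 S1S S2S [M M0 HM].
have MC : 0 < M * C by exact: mulr_gt0.
exists ((M * C + D) + C) => [|f]; first by rewrite !addr_gt0.
have [h1 h2] := HC f; have [k1 k2] := HD f.
set m := nnorm (cap_space A B) f.
have mA : (nnorm A f <= m)%E by rewrite /m /cap_space /= le_max lexx.
have mB : (nnorm B f <= m)%E by rewrite /m /cap_space /= le_max lexx orbT.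
have m0 : (0 <= m)%E by exact: le_trans (A0 f) mA.
split.
  rewrite /m /cap_space /= ge_max; apply/andP; split.
    apply: (le_trans h1); apply: (@le_trans _ _ (C%:E * S f)%E).
      by apply: lee_wpmul2l; [rewrite lee_fin ltW|exact: S1S].
    by apply: lee_wpmul2r => //; rewrite lee_fin; lra.
  apply: (le_trans k1); apply: (@le_trans _ _ (D%:E * S f)%E).
    by apply: lee_wpmul2l; [rewrite lee_fin ltW|exact: S2S].
  by apply: lee_wpmul2r => //; rewrite lee_fin; lra.
apply: (@le_trans _ _ ((M * C + D)%:E * m)%E); last first.
  by apply: lee_wpmul2r => //; rewrite lee_fin; lra.
apply: (le_trans (HM f)).
apply: add_le_const => //; [exact: ltW|exact: ltW| |].
  rewrite EFinM -muleA; apply: lee_wpmul2l; first by rewrite lee_fin ltW.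
  by apply: (le_trans h2); apply: lee_wpmul2l; [rewrite lee_fin ltW|].
by apply: (le_trans k2); apply: lee_wpmul2l; [rewrite lee_fin ltW|].
Qed.

Section Theta.
Variable theta : R.

(* The weight t^(-theta) b(t) at t = rho(e^n). *)
Let om n := r n `^ (- theta) * b (r n).

Let om_gt0 n : 0 < om n.
Proof. by rewrite mulr_gt0 ?powR_gt0 //; case: pbrho => h _. Qed.

(** The condition on g in [change_of_variable]: all factors vary at most like a
    power of t / s. *)
Lemma weighted_lip (Z0 Z1 : nspace V) : normed_ge0 Z0 -> normed_ge0 Z1 ->
  exists c p : R, [/\ 0 < c, 0 <= p & forall f s t, 0 < s -> 0 < t ->
    (weighted theta b (Kfun Z0 Z1 f) t <=
      (c * expR (p * `|ln t - ln s|))%:E * weighted theta b (Kfun Z0 Z1 f) s)%E].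
Proof.
move=> h0 h1; have [u0 hu] := rvfun_weight theta hb; have [C C0 HC] := hu _ ltr01.
exists C, (`|- theta| + 1 + 1); split => // f s t s0 t0.
rewrite /weighted /wmul.
have us : 0 <= s `^ (- theta) * b s by exact: ltW (u0 s s0).
have ut : 0 <= t `^ (- theta) * b t by exact: ltW (u0 t t0).
have k := K_ge0 h0 h1 f s0.
apply: (le_trans (lee_wpmul2l _ (K_ln h0 h1 f s0 t0))); first by rewrite lee_fin.
rewrite !muleA -!EFinM; apply: lee_wpmul2r => //; rewrite lee_fin.
have h := HC s t s0 t0; set q := ln t - ln s in h *.
apply: (@le_trans _ _ (C * expR (- theta * q + 1 * `|q|) * (s `^ (- theta) * b s) * expR `|q|)).
  by apply: ler_wpM2r; [exact: expR_ge0|exact: h].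
rewrite mulrAC; apply: ler_wpM2r => //.
rewrite -mulrA -expRD ler_pM2l // ler_expR !mulrDl !mul1r !lerD2r.
by rewrite -normrM; exact: ler_norm.
Qed.

(** The change of variable t = rho(u) in the norm of the left-hand side. *)
Lemma lhs_equiv : exists2 C : R, 0 < C & forall f,
  (nnorm (space Y0 Y1 theta b E) f <= C%:E * snorm E (smul om (fun n => Kfun Y0 Y1 f (r n))))%E /\
  (snorm E (smul om (fun n => Kfun Y0 Y1 f (r n))) <= C%:E * nnorm (space Y0 Y1 theta b E) f)%E.
Proof.
have h0 : normed_ge0 Y0 by move=> f _.
have h1 : normed_ge0 Y1 by move=> f _.
have [C C0 HC] := fsampled_tnorm E (fsampled_wmul (rvfun_sampled (rvfun_weight theta hb)) (fsampled_K h0 h1)).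
have [c [p [c0 p0 lip]]] := weighted_lip h0 h1.
have [D D0 HD] := change_of_variable E de0 prho c0 p0.
exists (C * D) => [|f]; first exact: mulr_gt0.
have [u1 u2] := HC f.
have w0' t : 0 < t -> (0 <= weighted theta b (Kfun Y0 Y1 f) t)%E.
  move=> t0; have [u _] := rvfun_weight theta hb.
  by apply: mule_ge0; [rewrite lee_fin ltW // u|exact: K_ge0].
have [k1 k2] := HD (weighted theta b (Kfun Y0 Y1 f)) w0' (lip f).
split.
  by apply: lee_scale_trans k1; [exact: ltW|exact: u1].
by rewrite mulrC; apply: lee_scale_trans u2; [exact: ltW|exact: k2].
Qed.

Lemma sumY_sumX f : sum_space Y0 Y1 f -> sum_space X0 X1 f.
Proof. by move=> [f0 [f1 [[x0 _] [x1 _] ->]]]; exact: sum_spaceD. Qed.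

(** It suffices to identify the norm of the Holmstedt functional.  Finiteness of
    this norm makes every entry H n f finite, which is what [K_le_holmstedt] needs
    in order to place f in Y0 + Y1. *)
Lemma reiterate (Z : nspace V) :
  (forall f, Z f <-> sum_space X0 X1 f /\ (nnorm Z f < +oo)%E) ->
  (exists2 C : R, 0 < C & forall f,
    (nnorm Z f <= C%:E * snorm E (smul om (H^~ f)))%E /\
    (snorm E (smul om (H^~ f)) <= C%:E * nnorm Z f)%E) ->
  same_space (space Y0 Y1 theta b E) Z.
Proof.
move=> cZ [C C0 HC]; have [D D0 HD] := lhs_equiv.
have [A A0 HA] := holmstedt_le_K q0 q1 pv0 pv1 pw0 pw1 htheta01 fin0 fin1 nY0 nY1 pY0 pY1.
have [B B0 HB] := K_le_holmstedt q0 q1 pv0 pv1 pw0 pw1 htheta0 htheta1 fin0 fin1 cY0 cY1 nY0 nY1 pY0 pY1.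
have H0' f : nonneg (H^~ f) by move=> n; exact: H0.
have KY0 f : nonneg (fun n => Kfun Y0 Y1 f (r n)).
  by move=> n; apply: K_ge0 => // g _.
have lo f : (snorm E (smul om (H^~ f)) <= A%:E * snorm E (smul om (fun n => Kfun Y0 Y1 f (r n))))%E.
  apply: (snorm_le_scale E A0 (smul_ge0 om_gt0 (H0' f)) (smul_ge0 om_gt0 (KY0 f))) => n.
  by rewrite /smul [leRHS]muleCA; apply: lee_wpmul2l; [rewrite lee_fin ltW|exact: HA].
have le1 f : (nnorm Z f <= (C * (A * D))%:E * nnorm (space Y0 Y1 theta b E) f)%E.
  apply: lee_scale_trans (proj1 (HC f)) _; first exact: ltW.
  by apply: lee_scale_trans (lo f) (proj2 (HD f)); exact: ltW.
have le2 f : Z f -> sum_space Y0 Y1 f /\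
    (nnorm (space Y0 Y1 theta b E) f <= (D * (B * C))%:E * nnorm Z f)%E.
  move=> /cZ [xf nf].
  have hfin : (snorm E (smul om (H^~ f)) < +oo)%E.
    by apply: le_lt_trans (proj2 (HC f)) _; rewrite lty_scale.
  have Hn n : (H n f < +oo)%E.
    have := le_lt_trans (snorm_entry E n (smul_ge0 om_gt0 (H0' f))) hfin.
    by rewrite /smul muleA -EFinM lty_scale // mulr_gt0 // phi_gt0.
  split; first by have [] := HB 0 f xf (Hn 0).
  apply: lee_scale_trans (proj1 (HD f)) _; first exact: ltW.
  apply: lee_scale_trans _ (proj2 (HC f)); first exact: ltW.
  apply: (snorm_le_scale E B0 (smul_ge0 om_gt0 (KY0 f)) (smul_ge0 om_gt0 (H0' f))) => n.
  rewrite /smul [leRHS]muleCA; apply: lee_wpmul2l; first by rewrite lee_fin ltW.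
  by have [] := HB n f xf (Hn n).
have p1 : 0 < C * (A * D) by rewrite !mulr_gt0.
have p2 : 0 < D * (B * C) by rewrite !mulr_gt0.
have LZ f : space Y0 Y1 theta b E f -> Z f.
  move=> [yf nf]; apply/cZ; split; first exact: sumY_sumX.
  by apply: le_lt_trans (le1 f) _; rewrite lty_scale.
split.
  move=> f; split; first exact: LZ.
  move=> zf; have [sf lf] := le2 f zf; split => //.
  apply: le_lt_trans lf _; rewrite lty_scale //.
  by move/cZ: zf => [].
exists (C * (A * D))^-1, (D * (B * C)); split => //; first by rewrite invr_gt0.
move=> f Lf; split; first exact: le_inv_scale.
by have [] := le2 f (LZ f Lf).
Qed.

Let Po f n := P0 E0 F0 v0 w0 n (K f).
Let Qo f n := Q0 E0 F0 v0 w0 n (K f).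
Let Pi f n := P1 E1 F1 v1 w1 n (K f).
Let Qi f n := Q1 E1 F1 v1 w1 n (K f).
Let Po0 f : nonneg (Po f). Proof. by move=> n; exact: P0_ge0. Qed.
Let Pi0 f : nonneg (Pi f). Proof. by move=> n; exact: P1_ge0. Qed.
Let Qo0 f : nonneg (Qo f). Proof. by move=> n; exact: (Q0_ge0 F0 w0 pv0 fin0). Qed.
Let Qi0 f : nonneg (Qi f). Proof. by move=> n; exact: (Q1_ge0 F1 w1 pv1 fin1). Qed.
Let omr n := om n * r n.
Let omr_gt0 n : 0 < omr n. Proof. exact: mulr_gt0. Qed.
Let pom : rvseq (- theta * (theta1 - theta0)) om.
Proof.
by apply: (rvseq_eq (rvseq_mul (rvseq_powR (- theta) prho) pbrho)) => //; rewrite addr0 mulrC.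
Qed.
Let pomr : rvseq ((1 - theta) * (theta1 - theta0)) omr.
Proof. by apply: (rvseq_eq (rvseq_mul pom prho)) => //; ring. Qed.

Let HE f n : H n f = ((Po f n + Qo f n) + (r n)%:E * (Pi f n + Qi f n))%E.
Proof. by []. Qed.

Let snorm_H_le f : (snorm E (smul om (H^~ f)) <=
  snorm E (smul om (fun n => Po f n + Qo f n)%E) + snorm E (smul omr (fun n => Pi f n + Qi f n)%E))%E.
Proof.
have h0 : nonneg (fun n => Po f n + Qo f n)%E by move=> n; apply: adde_ge0; [exact: Po0|exact: Qo0].
have h1 : nonneg (fun n => Pi f n + Qi f n)%E by move=> n; apply: adde_ge0; [exact: Pi0|exact: Qi0].
apply: le_trans (snormD E (smul_ge0 om_gt0 h0) (smul_ge0 omr_gt0 h1)).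
apply: snorm_le => n; first by apply: smul_ge0 => // k; exact: H0.
rewrite /smul HE ge0_muleDr; [|exact: h0|by apply: mule_ge0; [rewrite lee_fin ltW|exact: h1]].
by rewrite [X in (_ + X <= _)%E]muleA -EFinM; exact: lexx.
Qed.

Let le_H (u : int -> R) x f : (forall n, 0 < u n) -> nonneg x ->
  (forall n, (smul u x n <= smul om (H^~ f) n)%E) ->
  (snorm E (smul u x) <= snorm E (smul om (H^~ f)))%E.
Proof. by move=> u0 x0 h; apply: snorm_le => //; exact: smul_ge0. Qed.

Let HPo f n : (smul om (Po f) n <= smul om (H^~ f) n)%E.
Proof.
rewrite /smul; apply: lee_wpmul2l; first by rewrite lee_fin ltW.
rewrite HE -addeA; apply: leeDl; apply: adde_ge0; first exact: Qo0.
by apply: mule_ge0; [rewrite lee_fin ltW|apply: adde_ge0; [exact: Pi0|exact: Qi0]].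
Qed.

Let HQo f n : (smul om (Qo f) n <= smul om (H^~ f) n)%E.
Proof.
rewrite /smul; apply: lee_wpmul2l; first by rewrite lee_fin ltW.
rewrite HE addeAC; apply: leeDr; apply: adde_ge0; first exact: Po0.
by apply: mule_ge0; [rewrite lee_fin ltW|apply: adde_ge0; [exact: Pi0|exact: Qi0]].
Qed.

Let HPi f n : (smul omr (Pi f) n <= smul om (H^~ f) n)%E.
Proof.
rewrite /smul /omr EFinM -muleA; apply: lee_wpmul2l; first by rewrite lee_fin ltW.
rewrite HE; apply: (@le_trans _ _ ((r n)%:E * (Pi f n + Qi f n))%E).
  by apply: lee_wpmul2l; [rewrite lee_fin ltW|apply: leeDl; exact: Qi0].
by apply: leeDr; apply: adde_ge0; [exact: Po0|exact: Qo0].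
Qed.

Let HQi f n : (smul omr (Qi f) n <= smul om (H^~ f) n)%E.
Proof.
rewrite /smul /omr EFinM -muleA; apply: lee_wpmul2l; first by rewrite lee_fin ltW.
rewrite HE; apply: (@le_trans _ _ ((r n)%:E * (Pi f n + Qi f n))%E).
  by apply: lee_wpmul2l; [rewrite lee_fin ltW|apply: leeDr; exact: Pi0].
by apply: leeDr; apply: adde_ge0; [exact: Po0|exact: Qo0].
Qed.

(* The balance between the two halves, which is what defines rho. *)
Let mid n : om n * d0 n * w0 n = omr n * d1 n * w1 n.
Proof.
have := lt0r_neq0 (d1_gt0 n); have := lt0r_neq0 (w1_gt0 n).
rewrite /omr /r /rho -/(d0 n) -/(d1 n) => h1 h2.
by field; rewrite h1 h2.
Qed.

Let W f := snorm E (smul (fun n => om n * d0 n * w0 n) (K f)).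
Let WE f : W f = snorm E (smul (fun n => omr n * d1 n * w1 n) (K f)).
Proof.
rewrite /W; have -> // : (fun n => om n * d0 n * w0 n) = (fun n => omr n * d1 n * w1 n).
by apply/funext => n; exact: mid.
Qed.

Let hardy_lo : 0 < theta -> exists2 C : R, 0 < C & forall f,
  (snorm E (smul om (fun n => Po f n + Qo f n)%E) <= C%:E * W f)%E.
Proof.
move=> th0; have al : - theta * (theta1 - theta0) < 0 by rewrite mulNr oppr_lt0 mulr_gt0.
have [C C0 HC] := Lo_hardy E F0 pv0 pw0 fin0 pom al.
by exists C => // f; apply: HC; exact: K0.
Qed.

Let hardy_up : theta < 1 -> exists2 C : R, 0 < C & forall f,
  (snorm E (smul omr (fun n => Pi f n + Qi f n)%E) <= C%:E * W f)%E.
Proof.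
move=> th1; have al : 0 < (1 - theta) * (theta1 - theta0) by rewrite mulr_gt0 // subr_gt0.
have [C C0 HC] := Up_hardy E F1 pv1 pw1 fin1 pomr al.
by exists C => // f; rewrite WE; apply: HC; exact: K0.
Qed.

Let W_le_Qo : exists2 C : R, 0 < C & forall f, (W f <= C%:E * snorm E (smul om (Qo f)))%E.
Proof.
have [C C0 HC] := le_Q0 E F0 pv0 pw0 fin0 pom.
by exists C => // f; apply: HC; [exact: K0|exact: Kup].
Qed.

Let W_le_Qi : exists2 C : R, 0 < C & forall f, (W f <= C%:E * snorm E (smul omr (Qi f)))%E.
Proof.
have [C C0 HC] := le_Q1 E F1 pv1 pw1 fin1 pomr.
by exists C => // f; rewrite WE; apply: HC; [exact: K0|exact: Kdn].
Qed.

(** Both Hardy inequalities hold, and bound everything by W, which is dominated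
    by the Q0 term. *)
Lemma reiteration_interior : 0 < theta -> theta < 1 ->
  same_space (space Y0 Y1 theta b E)
    (space X0 X1 ((1 - theta) * theta0 + theta * theta1)
       (fun u => (a0 u * beta0 u) `^ (1 - theta) *
                 (a1 u * beta1 u) `^ theta * b (rhof u)) E).
Proof.
move=> th0 th1; apply: reiterate => //.
have sB : rsampled (fun s => s `^ (- ((1 - theta) * theta0 + theta * theta1)) *
    ((a0 s * beta0 s) `^ (1 - theta) * (a1 s * beta1 s) `^ theta * b (rhof s)))
    (fun n => om n * d0 n * w0 n).
  apply: rsampled_eq (rsampled_mul (rvfun_sampled (rvfun_pow _)) (rsampled_mul (rsampled_mul
    (rsampled_powR (1 - theta) (rsampled_mul sa0 sbeta0)) (rsampled_powR theta (rsampled_mul sa1 sbeta1))) sbrho)) _ => n.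
  have := weight_identity theta0 theta1 theta (expz_gt0 n)
    (mulr_gt0 (a0_gt0 n) (d0_gt0 n)) (mulr_gt0 (a1_gt0 n) (d1_gt0 n)).
  rewrite -rE => e; rewrite mulrA -e /om /w0; ring.
have [C C0 HC] := fsampled_tnorm E (fsampled_wmul sB fK).
have [A A0 HA] := hardy_lo th0; have [B B0 HB] := hardy_up th1.
have [D D0 HD] := W_le_Qo.
exists (C * D + (A + B) * C) => [|f]; first by rewrite addr_gt0 // mulr_gt0 // addr_gt0.
have [h1 h2] := HC f.
have c1 : 0 <= C * D by rewrite mulr_ge0 // ltW.
have c2 : 0 <= (A + B) * C by rewrite mulr_ge0 // ?addr_ge0 // ltW.
split.
  apply: (@le_trans _ _ ((C * D)%:E * snorm E (smul om (H^~ f)))%E); last first.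
    by apply: lee_wpmul2r; [exact: snorm_ge0|rewrite lee_fin lerDl].
  apply: lee_scale_trans h1 _; first exact: ltW.
  apply: (le_trans (HD f)); apply: lee_wpmul2l; first by rewrite lee_fin ltW.
  exact: (le_H om_gt0 (Qo0 f) (HQo f)).
apply: (@le_trans _ _ (((A + B) * C)%:E * nnorm (space X0 X1 _ _ E) f)%E); last first.
  by apply: lee_wpmul2r; [exact: tnorm_ge0|rewrite lee_fin lerDr].
apply: lee_scale_trans h2; first by rewrite addr_ge0 // ltW.
apply: (le_trans (snorm_H_le f)).
by apply: add_le_const; [exact: snorm_ge0|exact: ltW|exact: ltW|exact: HA|exact: HB].
Qed.

(** Only the Hardy inequality for the upper half holds; it bounds that half by
    W, hence by the Q0 term.  The P0 and Q0 terms are the norms of the two spaces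
    of the intersection. *)
Lemma reiteration_left : theta = 0 ->
  same_space (space Y0 Y1 theta b E)
    (cap_space (spaceL X0 X1 theta0 (fun u => beta0 u * b (rhof u)) E a0 F0)
       (spaceLL X0 X1 theta0 (b \o rhof) E b0 E0 a0 F0)).
Proof.
move=> th; have th1 : theta < 1 by rewrite th.
have omE n : om n = b (r n) by rewrite /om th oppr0 powRr0 mul1r.
apply: reiterate; first exact: cap_space_carrier.
have eQ f : smul (fun n => d0 n * b (r n)) (dL f) = smul om (Qo f).
  by apply/funext => n; rewrite /smul omE /Qo /Q0 /QL muleA -EFinM [in RHS]mulrC.
have eP f : smul (fun n => b (r n)) (fun n => snorm E0 (below n (smul v0 (dL f)))) = smul om (Po f).
  by apply/funext => n; rewrite /smul omE.
apply: (@cap_space_equiv _ _ (fun f => snorm E (smul om (Qo f))) (fun f => snorm E (smul om (Po f)))).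
- by move=> f; exact: tnorm_ge0.
- by move=> f; exact: tnorm_ge0.
- have [C C0 HC] := fsampled_tnorm E (fsampled_wmul (rsampled_mul sbeta0 sbrho) fL).
  by exists C => [|f]; [exact: C0|have h := HC f; rewrite eQ in h; exact: h].
- have [C C0 HC] := fsampled_tnorm E (fsampled_wmul sbrho
    (fsampled_below E0 (fsampled_wmul sv0 fL) (fupreg_smul pv0 dL0 fupL))).
  by exists C => [|f]; [exact: C0|have h := HC f; rewrite eP in h; exact: h].
- by move=> f; exact: snorm_ge0.
- by move=> f; exact: (le_H om_gt0 (Qo0 f) (HQo f)).
- by move=> f; exact: (le_H om_gt0 (Po0 f) (HPo f)).
have [B B0 HB] := hardy_up th1; have [D D0 HD] := W_le_Qo.
exists (B * D + 1) => [|f]; first by rewrite addr_gt0 // mulr_gt0.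
apply: (le_trans (snorm_H_le f)).
apply: (le_trans (leeD (snorm_smulD E om_gt0 (Po0 f) (Qo0 f)) (HB f))).
rewrite -addeA addeC; apply: leeD; last exact: lexx.
rewrite addeC; apply: add_le_const; [exact: snorm_ge0|by rewrite mulr_ge0 ?ltW|exact: ler01| |].
  by apply: lee_scale_trans (HD f); [exact: ltW|exact: lexx].
by rewrite mul1e; exact: lexx.
Qed.

(** As for theta = 0, with the halves exchanged; the weight of the upper half is
    b(rho), because rho^(-1) rho = 1. *)
Lemma reiteration_right : theta = 1 ->
  same_space (space Y0 Y1 theta b E)
    (cap_space (spaceR X0 X1 theta1 (fun u => beta1 u * b (rhof u)) E a1 F1)
       (spaceRR X0 X1 theta1 (b \o rhof) E b1 E1 a1 F1)).
Proof.
move=> th; have th0 : 0 < theta by rewrite th.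
have omE n : omr n = b (r n).
  rewrite /omr /om th -[X in X `^ _]/(r n) powR_inv1; last exact: ltW.
  by rewrite mulrAC mulVf ?mul1r // lt0r_neq0.
apply: reiterate; first exact: cap_space_carrier.
have eQ f : smul (fun n => d1 n * b (r n)) (dR f) = smul omr (Qi f).
  apply/funext => n; rewrite /smul omE /Qi /Q1 (QRE _ _ _ _ (wK1 f)).
  by rewrite muleA -EFinM [in RHS]mulrC.
have eP f : smul (fun n => b (r n)) (fun n => snorm E1 (above n (smul v1 (dR f)))) = smul omr (Pi f).
  by apply/funext => n; rewrite /smul omE /Pi /P1 (PRE _ _ _ v1_gt0 (wK1 f)).
apply: (@cap_space_equiv _ _ (fun f => snorm E (smul omr (Qi f))) (fun f => snorm E (smul omr (Pi f)))).
- by move=> f; exact: tnorm_ge0.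
- by move=> f; exact: tnorm_ge0.
- have [C C0 HC] := fsampled_tnorm E (fsampled_wmul (rsampled_mul sbeta1 sbrho) fR).
  by exists C => [|f]; [exact: C0|have h := HC f; rewrite eQ in h; exact: h].
- have [C C0 HC] := fsampled_tnorm E (fsampled_wmul sbrho
    (fsampled_above E1 (fsampled_wmul sv1 fR) (fdnreg_smul pv1 dR0 fdnR))).
  by exists C => [|f]; [exact: C0|have h := HC f; rewrite eP in h; exact: h].
- by move=> f; exact: snorm_ge0.
- by move=> f; exact: (le_H omr_gt0 (Qi0 f) (HQi f)).
- by move=> f; exact: (le_H omr_gt0 (Pi0 f) (HPi f)).
have [B B0 HB] := hardy_lo th0; have [D D0 HD] := W_le_Qi.
exists (B * D + 1) => [|f]; first by rewrite addr_gt0 // mulr_gt0.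
apply: (le_trans (snorm_H_le f)).
apply: (le_trans (leeD (HB f) (snorm_smulD E omr_gt0 (Pi0 f) (Qi0 f)))).
rewrite [X in (_ + X <= _)%E]addeC addeA; apply: leeD; last exact: lexx.
apply: add_le_const; [exact: snorm_ge0|by rewrite mulr_ge0 ?ltW|exact: ler01| |].
  by apply: lee_scale_trans (HD f); [exact: ltW|exact: lexx].
by rewrite mul1e; exact: lexx.
Qed.

End Theta.

End Reiteration.

Theorem theorem4p6 (R : realType) (V : topologicalLmodType R)
    (X0 X1 : nspace V) (hX : compatible_couple X0 X1)
    (theta0 theta1 : R)
    (htheta0 : 0 < theta0) (htheta01 : theta0 < theta1) (htheta1 : theta1 < 1)
    (E E0 E1 F0 F1 : ri_space R) (a0 a1 b b0 b1 : R -> R)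
    (ha0 : slowly_varying a0) (ha1 : slowly_varying a1)
    (hb : slowly_varying b)
    (hb0 : slowly_varying b0) (hb1 : slowly_varying b1)
    (hb0E0 : (wnorm_on E0 `]1%R, +oo[ b0 < +oo)%E)
    (hb1E1 : (wnorm_on E1 `]0%R, 1%R[ b1 < +oo)%E) :
  let beta0 := fun u : R => fine (wnorm_on E0 `]u, +oo[ b0) in
  let beta1 := fun u : R => fine (wnorm_on E1 `]0, u[ b1) in
  let rho := fun u : R =>
    u `^ (theta1 - theta0) * ((a0 u * beta0 u) / (a1 u * beta1 u)) in
  let Y0 := spaceL X0 X1 theta0 b0 E0 a0 F0 in
  let Y1 := spaceR X0 X1 theta1 b1 E1 a1 F1 in
  [/\ forall theta : R, 0 < theta -> theta < 1 ->
        same_space (space Y0 Y1 theta b E)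
          (space X0 X1 ((1 - theta) * theta0 + theta * theta1)
             (fun u => (a0 u * beta0 u) `^ (1 - theta) *
                       (a1 u * beta1 u) `^ theta * b (rho u)) E),
      (wnorm_on E `]1%R, +oo[ b < +oo)%E ->
        same_space (space Y0 Y1 0 b E)
          (cap_space
             (spaceL X0 X1 theta0 (fun u => beta0 u * b (rho u)) E a0 F0)
             (spaceLL X0 X1 theta0 (b \o rho) E b0 E0 a0 F0)) &
      (wnorm_on E `]0%R, 1%R[ b < +oo)%E ->
        same_space (space Y0 Y1 1 b E)
          (cap_space
             (spaceR X0 X1 theta1 (fun u => beta1 u * b (rho u)) E a1 F1)
             (spaceRR X0 X1 theta1 (b \o rho) E b1 E1 a1 F1))].
Proof.
have [_ [q0 _] [q1 _]] := hX.
split.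
- by move=> theta; exact: reiteration_interior.
- by move=> _; exact: reiteration_left.
- by move=> _; exact: reiteration_right.
Qed.
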